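(* Let $n\ge 2$ be an integer and consider the planar system with real coefficients $$\dot x=y,\qquad \dot y=-2x^3+a_{21}x^2y+a_{12}xy^2+a_{03}y^3+\sum_{i+j=2n+3}a_{ij}x^iy^j .$$ The origin is an analytic center if and only if $$a_{21}=a_{03}=a_{2n+2,1}=a_{2n,3}=\cdots=a_{2,2n+1}=a_{0,2n+3}=0,$$ i.e. if and only if $a_{21}=a_{03}=0$ and $a_{2n+2-2k,\,2k+1}=0$ for all $k=0,1,\dots,n+1$.
   Context: The origin of a planar real analytic system is called an analytic center if it is a center and the system has a (nonconstant) analytic first integral in a neighborhood of the origin. *)

(* Defs.v *)
From Stdlib Require Import Reals.
From Coquelicot Require Import Coquelicot.
Open Scope R_scope.

(** [(x, y)] solves [x' = P(x,y), y' = Q(x,y)] on the open interval [(s, t)];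
    the endpoints may be infinite. *)
Definition solves_on (P Q : R -> R -> R) (s t : Rbar) (x y : R -> R) : Prop :=
  forall u : R, Rbar_lt s u -> Rbar_lt u t ->
    is_derive x u (P (x u) (y u)) /\ is_derive y u (Q (x u) (y u)).

Definition periodic_solution (P Q : R -> R -> R) (T : R) (x y : R -> R) : Prop :=
  0 < T /\ solves_on P Q m_infty p_infty x y /\
  (forall t, x (t + T) = x t /\ y (t + T) = y t) /\
  (exists t, (x t, y t) <> (x 0, y 0)).

(** The origin is an equilibrium with an open neighborhood [U] such that
    [U] minus the origin is a union of (nonconstant) periodic orbits. *)
Definition origin_is_center (P Q : R -> R -> R) : Prop :=
  P 0 0 = 0 /\ Q 0 0 = 0 /\
  exists U : R * R -> Prop,
    open U /\ U (0, 0) /\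
    forall p : R * R, U p -> p <> (0, 0) ->
      exists (x y : R -> R) (T : R),
        periodic_solution P Q T x y /\ (x 0, y 0) = p /\
        forall t, U (x t, y t).

(** Near [(x0, y0)], [H] is the sum of an absolutely convergent double power
    series; the double series is summed along the diagonals [i + j = m]. *)
Definition analytic_at (H : R -> R -> R) (x0 y0 : R) : Prop :=
  exists (c : nat -> nat -> R) (r : R), 0 < r /\
    forall x y : R, Rabs (x - x0) < r -> Rabs (y - y0) < r ->
      let term i j := c i j * (x - x0) ^ i * (y - y0) ^ j in
      ex_series (fun m => sum_f_R0 (fun j => Rabs (term (m - j)%nat j)) m) /\
      is_series (fun m => sum_f_R0 (fun j => term (m - j)%nat j) m) (H x y).

(** The neighborhood is a ball of [R * R] (an open square), hence connected:
    for an analytic [H], being nonconstant on it is the same as being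
    nonconstant on every smaller neighborhood of the origin. *)
Definition has_analytic_first_integral (P Q : R -> R -> R) : Prop :=
  exists (H : R -> R -> R) (rho : posreal),
    let U := fun p : R * R => ball (0, 0) rho p in
    (forall x y, U (x, y) -> analytic_at H x y) /\
    (exists x y, U (x, y) /\ H x y <> H 0 0) /\
    (forall (s t : Rbar) (x y : R -> R),
        solves_on P Q s t x y ->
        (forall u : R, Rbar_lt s u -> Rbar_lt u t -> U (x u, y u)) ->
        forall u v : R, Rbar_lt s u -> Rbar_lt u t ->
          Rbar_lt s v -> Rbar_lt v t -> H (x u) (y u) = H (x v) (y v)).

Definition origin_is_analytic_center (P Q : R -> R -> R) : Prop :=
  origin_is_center P Q /\ has_analytic_first_integral P Q.

Definition xdot (x y : R) : R := y.

Definition ydot (n : nat) (a : nat -> nat -> R) (x y : R) : R :=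
  - 2 * x ^ 3 + a 2%nat 1%nat * x ^ 2 * y + a 1%nat 2%nat * x * y ^ 2
  + a 0%nat 3%nat * y ^ 3
  + sum_f_R0 (fun j => a (2 * n + 3 - j)%nat j * x ^ (2 * n + 3 - j) * y ^ j)
      (2 * n + 3).

(* Main.v *)
Require Import Defs.
From Stdlib Require Import Reals Arith Lra Lia Psatz Classical_Prop Ranalysis5 PSeries_reg.
From Coquelicot Require Import Coquelicot.
Open Scope R_scope.

(** Give [x] weight 1 and [y] weight 2. A first integral [H] is a power series
    killed by [y d/dx + Q d/dy], whose part of lowest weight is
    [D = y d/dx - 2 x^3 d/dy]; hence the lowest part of [H] is a multiple of a
    power of [x^4 + y^2]. The monomials [x^p y^r] of [Q] with [r] odd all have
    different weights. If the lightest one with nonzero coefficient is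
    [q x^p y^r], the equation for the part of [H] that is odd in both variables
    reads, in its lowest weight, [D K + q x^p y^r d/dy (x^4 + y^2)^k = 0]. All
    coefficients of the second term have the same sign, while the coefficients of
    [D K], weighted by suitable positive numbers, sum to zero: a contradiction.

    Conversely, if all these coefficients vanish then [Q = x G(x^2, y^2)], and
    [H = F(x^2, y^2)] is a first integral as soon as [F_u + G F_v = 0]; the
    solution with [F(0, v) = v] converges and gives [H ~ y^2 + x^4]. Small orbits
    are therefore trapped; as [x y' - y x' < 0] they keep crossing the [x]-axis,
    and reversibility makes them periodic. *)

(** * Series dominated by geometric ones *)

(** The condition [2 <= n] enters through the weights. In degree 3 the monomials with odd [r] have
    weights 4 and 6; in degree 2n + 3 their weights start at 2n + 4. For n = 1 both y^3 and x^4 y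
    would have weight 6, and the lightest monomial need not be unique.

    For necessity, the center supplies a solution through every point near the origin;
    differentiating the first integral along these solutions gives the equation for its Taylor
    coefficients.

    For sufficiency, the singular point is degenerate, but u = x^2, v = y^2 turn the orbits into
    solutions of dv/du = G(u, v), which is regular at the origin. The first integral thus solves a
    noncharacteristic Cauchy problem, and a majorant gives convergence. Periodic solutions must
    exist for all times, whereas the polynomial field only has local ones a priori; clamping both
    coordinates makes the field globally Lipschitz, and solutions that stay in the trapping region
    solve the original system. *)

(** A form of degree [m] has [m + 1] terms, and differentiation multiplies a coefficient by at most
    such a number. Absorbing these factors into the geometric ratio produces the ratios [2 * A] and
    [4 * A] used below. *)
Lemma INR_succ_le_pow2 (m : nat) : INR (S m) <= 2 ^ m.
Proof.
  induction m as [|m IH]; [simpl; lra|].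
  rewrite S_INR. assert (1 <= 2 ^ m) by (apply pow_R1_Rle; lra).
  simpl pow. lra.
Qed.

Lemma sum_f_R0_Rabs_le (f : nat -> R) (n : nat) (K : R) :
  (forall j, (j <= n)%nat -> Rabs (f j) <= K) ->
  Rabs (sum_f_R0 f n) <= INR (S n) * K.
Proof.
  intros Hf. eapply Rle_trans; [apply Rsum_abs|].
  replace (INR (S n) * K) with (sum_f_R0 (fun _ => K) n)
    by (rewrite sum_cte; ring).
  apply sum_Rle. auto.
Qed.

Lemma is_series_sum_f_R0 (a : nat -> R) (l : R) :
  is_series a l <-> is_lim_seq (sum_f_R0 a) l.
Proof.
  unfold is_series, is_lim_seq.
  split; apply filterlim_ext; intros n; [|symmetry]; apply sum_n_Reals.
Qed.

Lemma is_series_unique_eq (a : nat -> R) (l l' : R) :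
  is_series a l -> is_series a l' -> l = l'.
Proof.
  intros H H'. rewrite <- (is_series_unique _ _ H). now apply is_series_unique.
Qed.

Lemma ex_series_geom_bound (a : nat -> R) (K q : R) :
  0 <= q < 1 -> (forall m, Rabs (a m) <= K * q ^ m) -> ex_series a.
Proof.
  intros Hq Ha. apply (ex_series_le a (fun m => K * q ^ m)); [exact Ha|].
  apply (ex_series_scal (V := R_NormedModule)).
  apply ex_series_geom. rewrite Rabs_pos_eq; lra.
Qed.

(** The bound is the exact finite geometric sum, so that each induction step only adds one term; the
    negative part is dropped in [is_series_tail]. *)
Lemma partial_sum_le_geom (a : nat -> R) (K q : R) (N n : nat) :
  0 <= K -> 0 <= q < 1 ->
  (forall m, (N < m)%nat -> Rabs (a m) <= K * q ^ m) ->
  Rabs (sum_f_R0 a (N + n) - sum_f_R0 a N)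
    <= K * (q ^ S N - q ^ S (N + n)) / (1 - q).
Proof.
  intros HK Hq Ha. induction n as [|n IH].
  - rewrite Nat.add_0_r, !Rminus_diag, Rabs_R0. unfold Rdiv. lra.
  - rewrite Nat.add_succ_r, tech5.
    specialize (Ha (S (N + n)) ltac:(lia)).
    replace (K * (q ^ S N - q ^ S (S (N + n))) / (1 - q)) with
      (K * (q ^ S N - q ^ S (N + n)) / (1 - q) + K * q ^ S (N + n))
      by (simpl; field; lra).
    replace (sum_f_R0 a (N + n) + a (S (N + n)) - sum_f_R0 a N)
      with ((sum_f_R0 a (N + n) - sum_f_R0 a N) + a (S (N + n))) by ring.
    eapply Rle_trans; [apply Rabs_triang|]. lra.
Qed.

Lemma is_series_tail (a : nat -> R) (l K q : R) (N : nat) :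
  0 <= K -> 0 <= q < 1 -> is_series a l ->
  (forall m, (N < m)%nat -> Rabs (a m) <= K * q ^ m) ->
  Rabs (l - sum_f_R0 a N) <= K * q ^ S N / (1 - q).
Proof.
  intros HK Hq Hl Ha. apply is_series_sum_f_R0 in Hl.
  assert (L : is_lim_seq (fun n => Rabs (sum_f_R0 a (n + N) - sum_f_R0 a N))
                (Rabs (l - sum_f_R0 a N))).
  { apply (is_lim_seq_abs _ (l - sum_f_R0 a N)).
    apply is_lim_seq_minus'; [|apply is_lim_seq_const].
    now apply -> is_lim_seq_incr_n. }
  refine (is_lim_seq_le _ (fun _ => K * q ^ S N / (1 - q)) _ _ _ L
            (is_lim_seq_const _)).
  intros n. rewrite (Nat.add_comm n N).
  eapply Rle_trans; [apply (partial_sum_le_geom a K q); auto|].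
  apply Rmult_le_compat_r; [left; apply Rinv_0_lt_compat; lra|].
  assert (0 <= q ^ S (N + n)) by (apply pow_le; lra). nra.
Qed.

Lemma is_series_Rabs_le (a : nat -> R) (l K q : R) :
  0 <= K -> 0 <= q < 1 -> is_series a l ->
  (forall m, Rabs (a m) <= K * q ^ m) -> Rabs l <= K / (1 - q).
Proof.
  intros HK Hq Hl Ha.
  pose proof (is_series_tail a l K q 0 HK Hq Hl ltac:(auto)) as T.
  pose proof (Ha 0%nat) as A0. cbn [sum_f_R0 pow] in T, A0.
  replace l with ((l - a 0%nat) + a 0%nat) by ring.
  eapply Rle_trans; [apply Rabs_triang|].
  replace (K / (1 - q)) with (K * (q * 1) / (1 - q) + K * 1) by (field; lra).
  lra.
Qed.

Lemma geom_eventually_small (K q eps : R) :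
  0 <= K -> 0 <= q < 1 -> 0 < eps ->
  exists N, forall n, (N <= n)%nat -> K * q ^ n < eps.
Proof.
  intros HK Hq He.
  destruct (pow_lt_1_zero q ltac:(rewrite Rabs_pos_eq; lra) (eps / (K + 1))
              ltac:(apply Rdiv_lt_0_compat; lra)) as [N HN].
  exists N. intros n Hn. specialize (HN n Hn).
  assert (0 <= q ^ n) by (apply pow_le; lra).
  rewrite Rabs_pos_eq in HN by auto.
  apply Rlt_div_r in HN; [nra|lra].
Qed.

Lemma Rle_geom_0 (x K q : R) :
  0 <= K -> 0 <= q < 1 -> (forall n : nat, x <= K * q ^ n) -> x <= 0.
Proof.
  intros HK Hq Hx. destruct (Rle_lt_dec x 0) as [|Hpos]; [auto|].
  destruct (geom_eventually_small K q x HK Hq Hpos) as [N HN].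
  specialize (HN N (le_n _)). specialize (Hx N). lra.
Qed.

Lemma is_series_zero_shift (a : nat -> R) (l : R) :
  is_series a l -> is_series (fun m => match m with O => 0 | S k => a k end) l.
Proof.
  intros H. apply is_series_decr_1.
  change (is_series a (l + - 0)). now replace (l + - 0) with l by ring.
Qed.

Lemma is_series_scal_l_R (k : R) (a : nat -> R) (l : R) :
  is_series a l -> is_series (fun m => k * a m) (k * l).
Proof. exact (is_series_scal (V := R_NormedModule) k a l). Qed.

Lemma is_series_sum_swap (a : nat -> nat -> R) (l : nat -> R) (N : nat) :
  (forall j, (j <= N)%nat -> is_series (fun m => a m j) (l j)) ->
  is_series (fun m => sum_f_R0 (a m) N) (sum_f_R0 l N).
Proof.
  induction N as [|N IH]; intros H; simpl; [now apply H|].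
  apply (is_series_plus (V := R_NormedModule)); auto.
Qed.

Lemma is_series_terms_bounded (a : nat -> R) (l : R) :
  is_series a l -> exists M, 0 <= M /\ forall m, Rabs (a m) <= M.
Proof.
  intros H. apply is_series_sum_f_R0 in H.
  destruct (filterlim_bounded (K := R_AbsRing) (V := R_NormedModule)
              (sum_f_R0 a)) as [M HM]; [exists l; exact H|].
  assert (HM' : forall n, Rabs (sum_f_R0 a n) <= M) by exact HM.
  exists (2 * M). split.
  - pose proof (HM' 0%nat). pose proof (Rabs_pos (sum_f_R0 a 0)). lra.
  - intros [|m].
    + pose proof (HM' 0%nat) as H0. simpl in H0. pose proof (Rabs_pos (a 0%nat)).
      lra.
    + pose proof (HM' m) as H0. pose proof (HM' (S m)) as H1.
      rewrite tech5 in H1. split_Rabs; lra.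
Qed.

(** A power series in [s * u] that vanishes for small [u > 0] is zero; the sign
    of [s] selects the side of the origin. *)
Lemma one_sided_pseries_zero (e : nat -> R) (s delta : R) :
  s <> 0 -> 0 < delta ->
  (forall u, 0 < u < delta -> is_series (fun m => e m * (s * u) ^ m) 0) ->
  forall m, e m = 0.
Proof.
  intros Hs Hd He.
  set (d := delta / 2).
  (* Convergence at the single point [d] bounds all terms there, hence dominates the series
     geometrically at every smaller [u]. *)
  destruct (is_series_terms_bounded _ _ (He d ltac:(unfold d; lra)))
    as [M [HM Hb]].
  assert (Hb' : forall m u, 0 < u -> Rabs (e m * (s * u) ^ m) <= M * (u / d) ^ m).
  { intros m u Hu.
    replace (e m * (s * u) ^ m) with (e m * (s * d) ^ m * (u / d) ^ m).
    - rewrite Rabs_mult, (Rabs_pos_eq ((u / d) ^ m)).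
      + apply Rmult_le_compat_r; [|apply Hb].
        apply pow_le, Rlt_le, Rdiv_lt_0_compat; unfold d; lra.
      + apply pow_le, Rlt_le, Rdiv_lt_0_compat; unfold d; lra.
    - rewrite Rmult_assoc, <- Rpow_mult_distr. do 2 f_equal. field.
      unfold d; lra. }
  intros m. induction m as [m IH] using lt_wf_ind.
  assert (Hsum : forall u, sum_f_R0 (fun k => e k * (s * u) ^ k) m
                           = e m * (s * u) ^ m).
  { intros u. destruct m as [|m]; [reflexivity|].
    rewrite tech5, (sum_eq _ (fun _ => 0)), sum_cte; [ring|].
    intros i Hi. rewrite IH by lia. ring. }
  (* The lower coefficients vanish by induction, so at u = d * (1/2)^n / 2 the tail estimate bounds
     the term of order [m] by a multiple of u^(m+1). Division by u^m leaves a bound on [e m] that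
     tends to 0 with [n]. *)
  assert (Hle : forall n : nat, Rabs (e m) <=
                  2 * M / d / (Rabs s * d) ^ m * d * (1 / 2) ^ n).
  { intros n.
    assert (Hp : 0 < (1 / 2) ^ n <= 1).
    { split; [apply pow_lt; lra|]. apply Rle_trans with (1 ^ n); [apply pow_incr; lra|rewrite pow1; lra]. }
    set (t := (1 / 2) ^ n) in *.
    set (u := d * (t / 2)).
    assert (Hdpos : 0 < d) by (unfold d; lra).
    assert (Hu : 0 < u < delta).
    { unfold u. assert (d < delta) by (unfold d; lra). clearbody d t. clear -Hp Hdpos H.
      split; [apply Rmult_lt_0_compat; lra|nra]. }
    assert (Hud : u / d = t / 2) by (unfold u; field; lra).
    pose proof (is_series_tail _ 0 M (u / d) m HM ltac:(rewrite Hud; lra)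
                  (He u Hu) ltac:(intros; apply Hb'; lra)) as T.
    rewrite Hsum in T.
    rewrite Rminus_0_l, Rabs_Ropp, Rabs_mult, <- RPow_abs, Rabs_mult in T.
    rewrite (Rabs_pos_eq u) in T by lra.
    assert (Hspos : 0 < Rabs s) by now apply Rabs_pos_lt.
    assert (Hsu : 0 < (Rabs s * u) ^ m) by (apply pow_lt; nra).
    assert (Hsd : 0 < (Rabs s * d) ^ m) by (apply pow_lt; nra).
    apply Rmult_le_reg_r with ((Rabs s * u) ^ m); [auto|].
    eapply Rle_trans; [exact T|].
    replace (Rabs s * u) with (Rabs s * d * (t / 2)) by (unfold u; ring).
    rewrite Hud, (Rpow_mult_distr (Rabs s * d) (t / 2)).
    assert (0 < (t / 2) ^ m) by (apply pow_lt; lra).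
    replace (2 * M / d / (Rabs s * d) ^ m * d * t
             * ((Rabs s * d) ^ m * (t / 2) ^ m))
      with (2 * M * t * (t / 2) ^ m) by (field; lra).
    simpl pow. apply Rle_div_l; [lra|].
    assert (0 <= M * (t / 2) ^ m) by nra.
    replace (M * (t / 2 * (t / 2) ^ m)) with (M * (t / 2) ^ m * (t / 2)) by ring.
    replace (2 * M * t * (t / 2) ^ m * (1 - t / 2))
      with (M * (t / 2) ^ m * (t * (2 - t))) by field.
    apply Rmult_le_compat_l; [auto|nra]. }
  apply Rle_geom_0 in Hle; [|
    apply Rmult_le_pos; [apply Rmult_le_pos;
      [apply Rmult_le_pos; [|left; apply Rinv_0_lt_compat; unfold d; lra]|
       left; apply Rinv_0_lt_compat, pow_lt, Rmult_lt_0_compat;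
         [now apply Rabs_pos_lt|unfold d; lra]]|unfold d; lra]; lra | lra].
  pose proof (Rabs_pos (e m)). split_Rabs; lra.
Qed.

(** Cutting row [m] after column [S0] costs at most a multiple of [p ^ m * q ^ S0]. Summed over the
    rows, the error is a multiple of [q ^ S0], which tends to 0. *)
Lemma is_series_exchange (a : nat -> nat -> R) (A B : nat -> R)
    (K p q l : R) :
  0 <= K -> 0 <= p < 1 -> 0 <= q < 1 ->
  (forall m s, Rabs (a m s) <= K * p ^ m * q ^ s) ->
  (forall m, is_series (a m) (A m)) ->
  (forall s, is_series (fun m => a m s) (B s)) ->
  is_series A l -> is_series B l.
Proof.
  intros HK Hp Hq Ha HA HB Hl.
  assert (Hr : forall S0, Rabs (sum_f_R0 B S0 - l)
                 <= K / (1 - q) / (1 - p) * q * q ^ S0).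
  { intros S0.
    assert (T : forall m, Rabs (A m - sum_f_R0 (a m) S0)
                  <= K * q ^ S S0 / (1 - q) * p ^ m).
    { intros m.
      eapply Rle_trans.
      - apply (is_series_tail _ _ (K * p ^ m) q);
          [apply Rmult_le_pos; [lra|apply pow_le; lra]|lra|apply HA|auto].
      - right. field. lra. }
    assert (D : is_series (fun m => A m - sum_f_R0 (a m) S0)
                  (l - sum_f_R0 B S0)).
    { apply (is_series_minus (V := R_NormedModule)); [exact Hl|].
      apply is_series_sum_swap. auto. }
    assert (0 <= q ^ S S0) by (apply pow_le; lra).
    assert (0 < / (1 - q)) by (apply Rinv_0_lt_compat; lra).
    rewrite Rabs_minus_sym.
    eapply Rle_trans.
    - apply (is_series_Rabs_le (fun m => A m - sum_f_R0 (a m) S0) _ (K * q ^ S S0 / (1 - q)) p); auto.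
      unfold Rdiv. apply Rmult_le_pos; [nra|lra].
    - right. simpl. field. lra. }
  apply is_series_sum_f_R0, is_lim_seq_Reals. intros eps He.
  assert (0 <= K / (1 - q) / (1 - p) * q).
  { assert (0 < / (1 - q)) by (apply Rinv_0_lt_compat; lra).
    assert (0 < / (1 - p)) by (apply Rinv_0_lt_compat; lra).
    unfold Rdiv. apply Rmult_le_pos; [|lra].
    apply Rmult_le_pos; [apply Rmult_le_pos|]; lra. }
  destruct (geom_eventually_small _ q eps H Hq He) as [N HN].
  exists N. intros n Hn. unfold Rdist. eapply Rle_lt_trans; [apply Hr|auto].
Qed.

(** * Double power series *)

Definition hom (c : nat -> nat -> R) (m : nat) (x y : R) : R :=
  sum_f_R0 (fun j => c (m - j)%nat j * x ^ (m - j) * y ^ j) m.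

Definition psum (c : nat -> nat -> R) (x y : R) : R :=
  Series (fun m => hom c m x y).

Definition geom_bounded (c : nat -> nat -> R) (M A : R) : Prop :=
  0 <= M /\ 0 <= A /\ forall i j, Rabs (c i j) <= M * A ^ (i + j).

Definition dx (c : nat -> nat -> R) (i j : nat) : R := INR (S i) * c (S i) j.
Definition dy (c : nat -> nat -> R) (i j : nat) : R := INR (S j) * c i (S j).

Lemma hom_bound (c : nat -> nat -> R) (M A rho x y : R) (m : nat) :
  geom_bounded c M A -> Rabs x <= rho -> Rabs y <= rho ->
  Rabs (hom c m x y) <= M * (2 * A * rho) ^ m.
Proof.
  intros (HM & HA & Hc) Hx Hy.
  assert (0 <= rho) by (pose proof (Rabs_pos x); lra).
  assert (HP : 0 <= M * A ^ m * rho ^ m).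
  { apply Rmult_le_pos; [apply Rmult_le_pos|]; auto using pow_le. }
  eapply Rle_trans.
  - apply (sum_f_R0_Rabs_le _ _ (M * A ^ m * rho ^ m)). intros j Hj.
    rewrite !Rabs_mult, <- !RPow_abs, Rmult_assoc.
    apply Rmult_le_compat; auto using Rabs_pos.
    + apply Rmult_le_pos; apply pow_le, Rabs_pos.
    + specialize (Hc (m - j)%nat j). now replace (m - j + j)%nat with m in Hc by lia.
    + replace (rho ^ m) with (rho ^ (m - j) * rho ^ j)
        by (rewrite <- pow_add; f_equal; lia).
      apply Rmult_le_compat; try apply pow_le, Rabs_pos;
        apply pow_incr; split; auto using Rabs_pos.
  - replace (M * (2 * A * rho) ^ m) with (2 ^ m * (M * A ^ m * rho ^ m))
      by (rewrite !Rpow_mult_distr; ring).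
    apply Rmult_le_compat_r; [auto|apply INR_succ_le_pow2].
Qed.

Lemma is_series_psum (c : nat -> nat -> R) (M A rho x y : R) :
  geom_bounded c M A -> 2 * A * rho < 1 -> Rabs x <= rho -> Rabs y <= rho ->
  is_series (fun m => hom c m x y) (psum c x y).
Proof.
  intros Hc Hr Hx Hy. apply Series_correct.
  apply (ex_series_geom_bound _ M (2 * A * rho)).
  - pose proof (Rabs_pos x). destruct Hc as (_ & ? & _).
    split; [apply Rmult_le_pos|]; lra.
  - intros m. now apply hom_bound.
Qed.

Lemma psum_tail (c : nat -> nat -> R) (M A rho x y : R) (N : nat) :
  geom_bounded c M A -> 2 * A * rho < 1 -> Rabs x <= rho -> Rabs y <= rho ->
  Rabs (psum c x y - sum_f_R0 (fun m => hom c m x y) N)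
    <= M * (2 * A * rho) ^ S N / (1 - 2 * A * rho).
Proof.
  intros Hc Hr Hx Hy.
  apply is_series_tail; [apply Hc| |now apply (is_series_psum c M A rho)|].
  - pose proof (Rabs_pos x). destruct Hc as (_ & ? & _).
    split; [apply Rmult_le_pos|]; lra.
  - intros. now apply hom_bound.
Qed.

Lemma psum_bound (c : nat -> nat -> R) (M A rho x y : R) :
  geom_bounded c M A -> 2 * A * rho < 1 -> Rabs x <= rho -> Rabs y <= rho ->
  Rabs (psum c x y) <= M / (1 - 2 * A * rho).
Proof.
  intros Hc Hr Hx Hy.
  apply (is_series_Rabs_le (fun m => hom c m x y));
    [apply Hc| |now apply (is_series_psum c M A rho)|].
  - pose proof (Rabs_pos x). destruct Hc as (_ & ? & _).
    split; [apply Rmult_le_pos|]; lra.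
  - intros. now apply hom_bound.
Qed.

Lemma geom_bounded_dx (c : nat -> nat -> R) (M A : R) :
  geom_bounded c M A -> geom_bounded (dx c) (M * A) (2 * A).
Proof.
  intros (HM & HA & Hc). repeat split; [nra|lra|]. intros i j. unfold dx.
  rewrite Rabs_mult, (Rabs_pos_eq (INR (S i))) by apply pos_INR.
  replace (M * A * (2 * A) ^ (i + j)) with (2 ^ (i + j) * (M * A ^ (S i + j)))
    by (rewrite Rpow_mult_distr; simpl; ring).
  apply Rmult_le_compat; auto using pos_INR, Rabs_pos.
  eapply Rle_trans; [apply INR_succ_le_pow2|].
  apply Rle_pow; [lra|lia].
Qed.

Lemma geom_bounded_dy (c : nat -> nat -> R) (M A : R) :
  geom_bounded c M A -> geom_bounded (dy c) (M * A) (2 * A).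
Proof.
  intros (HM & HA & Hc). repeat split; [nra|lra|]. intros i j. unfold dy.
  rewrite Rabs_mult, (Rabs_pos_eq (INR (S j))) by apply pos_INR.
  replace (M * A * (2 * A) ^ (i + j)) with (2 ^ (i + j) * (M * A ^ (i + S j)))
    by (rewrite Rpow_mult_distr, Nat.add_succ_r; simpl; ring).
  apply Rmult_le_compat; auto using pos_INR, Rabs_pos.
  eapply Rle_trans; [apply INR_succ_le_pow2|].
  apply Rle_pow; [lra|lia].
Qed.

Lemma hom_scale (c : nat -> nat -> R) (m : nat) (u x y : R) :
  hom c m (u * x) (u * y) = hom c m x y * u ^ m.
Proof.
  unfold hom. rewrite (Rmult_comm _ (u ^ m)), scal_sum. apply sum_eq. intros j Hj.
  rewrite !Rpow_mult_distr.
  replace (u ^ m) with (u ^ (m - j) * u ^ j)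
    by (rewrite <- pow_add; f_equal; lia).
  ring.
Qed.

Lemma is_derive_sum_f_R0 (f : nat -> R -> R) (N : nat) (t : R) (d : nat -> R) :
  (forall k, (k <= N)%nat -> is_derive (f k) t (d k)) ->
  is_derive (fun s => sum_f_R0 (fun k => f k s) N) t (sum_f_R0 d N).
Proof.
  intros H. apply (is_derive_ext (fun s => sum_n (fun k => f k s) N)).
  - intros s. apply sum_n_Reals.
  - rewrite <- sum_n_Reals. now apply (is_derive_sum_n f).
Qed.

Lemma is_derive_hom (c : nat -> nat -> R) (m : nat) (x y : R -> R) (t x' y' : R) :
  is_derive x t x' -> is_derive y t y' ->
  is_derive (fun s => hom c (S m) (x s) (y s)) t
    (hom (dx c) m (x t) (y t) * x' + hom (dy c) m (x t) (y t) * y').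
Proof.
  intros Hx Hy. unfold hom at 1.
  evar_last.
  { apply (is_derive_sum_f_R0
      (fun j s => c (S m - j)%nat j * x s ^ (S m - j) * y s ^ j) (S m) t
      (fun j => c (S m - j)%nat j * INR (S m - j) * x t ^ pred (S m - j)
                  * y t ^ j * x'
              + c (S m - j)%nat j * x t ^ (S m - j) * INR j * y t ^ pred j
                  * y')).
    intros j _.
    evar_last.
    { apply (is_derive_mult (fun s => c (S m - j)%nat j * x s ^ (S m - j))
               (fun s => y s ^ j)); [|apply is_derive_pow, Hy|apply Rmult_comm].
      apply (is_derive_scal (fun s => x s ^ (S m - j))), is_derive_pow, Hx. }
    unfold plus, mult. simpl. ring. }
  rewrite sum_plus. f_equal.
  - rewrite tech5, Nat.sub_diag. change (INR 0) with 0. cbn [pred].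
    rewrite Rmult_0_r, !Rmult_0_l, Rplus_0_r.
    unfold hom, dx. rewrite (Rmult_comm _ x'), scal_sum.
    apply sum_eq. intros j Hj.
    replace (S m - j)%nat with (S (m - j)) by lia. cbn [pred]. ring.
  - rewrite decomp_sum by lia. change (INR 0) with 0. cbn [pred].
    rewrite Rmult_0_r, !Rmult_0_l, Rplus_0_l.
    unfold hom, dy. rewrite (Rmult_comm _ y'), scal_sum.
    apply sum_eq. intros j Hj.
    replace (S m - S j)%nat with (m - j)%nat by lia. ring.
Qed.

Lemma continuous_hom (c : nat -> nat -> R) (m : nat) (x y : R -> R) (t : R) :
  ex_derive x t -> ex_derive y t ->
  continuous (fun s => hom c m (x s) (y s)) t.
Proof.
  intros [x' Hx] [y' Hy]. destruct m as [|m].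
  - apply (continuous_ext (fun _ => hom c 0 0 0)); [|apply continuous_const].
    intros s. unfold hom. simpl. ring.
  - apply (ex_derive_continuous (V := R_NormedModule)).
    exists (hom (dx c) m (x t) (y t) * x' + hom (dy c) m (x t) (y t) * y').
    apply is_derive_hom; assumption.
Qed.

Lemma continuous_sum_f_R0 (f : nat -> R -> R) (N : nat) (t : R) :
  (forall k, (k <= N)%nat -> continuous (f k) t) ->
  continuous (fun s => sum_f_R0 (fun k => f k s) N) t.
Proof.
  induction N as [|N IH]; intros H; simpl; [now apply H|].
  apply (continuous_plus (V := R_NormedModule)); auto.
Qed.

Lemma continuous_locally_bounded (f : R -> R) (t : R) :
  continuous f t -> locally t (fun s => Rabs (f s) <= Rabs (f t) + 1).
Proof.
  intros Hf. specialize (Hf (ball (f t) 1)).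
  assert (B : locally (f t) (ball (f t) 1)) by (exists (mkposreal 1 Rlt_0_1); auto).
  pose proof (Hf B) as HB. unfold filtermap in HB.
  revert HB. apply filter_imp.
  intros s Hs. change (Rabs (f s - f t) < 1) in Hs. split_Rabs; lra.
Qed.

(** Continuity of the velocity is included because [derivable_pt_lim_CVU] asks for a continuous
    limit of the derivatives. *)
Definition C1_curve_in (rho : R) (x y x' y' : R -> R) (t : R) : Prop :=
  is_derive x t (x' t) /\ is_derive y t (y' t) /\
  continuous x' t /\ continuous y' t /\ Rabs (x t) <= rho /\ Rabs (y t) <= rho.

(** Termwise differentiation along a curve: the differentiated series converge uniformly near [t0].
    Their coefficients grow like powers of [2 * A] and [hom_bound] doubles this once more, hence
    [4 * A * rho < 1]. *)
Lemma is_derive_psum (c : nat -> nat -> R) (M A rho : R)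
    (x y x' y' : R -> R) (t0 : R) :
  geom_bounded c M A -> 4 * A * rho < 1 ->
  locally t0 (C1_curve_in rho x y x' y') ->
  is_derive (fun t => psum c (x t) (y t)) t0
    (psum (dx c) (x t0) (y t0) * x' t0 + psum (dy c) (x t0) (y t0) * y' t0).
Proof.
  intros Hc Hr Hloc.
  assert (Hr0 : 0 <= rho).
  { apply locally_singleton in Hloc. destruct Hloc as (_ & _ & _ & _ & H & _).
    pose proof (Rabs_pos (x t0)). lra. }
  pose proof (geom_bounded_dx _ _ _ Hc) as Hdx.
  pose proof (geom_bounded_dy _ _ _ Hc) as Hdy.
  assert (HA : 0 <= A) by apply Hc.
  assert (Hq : 0 <= 2 * (2 * A) * rho < 1)
    by (split; [repeat apply Rmult_le_pos|]; lra).
  assert (Hq2 : 0 <= 2 * A * rho < 1)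
    by (split; [repeat apply Rmult_le_pos|]; nra).
  (* Local bounds for the velocity keep the convergence uniform after multiplication by [x'] and
     [y']. *)
  set (B1 := Rabs (x' t0) + 1). set (B2 := Rabs (y' t0) + 1).
  assert (Hloc' : locally t0 (fun t => C1_curve_in rho x y x' y' t /\
                    Rabs (x' t) <= B1 /\ Rabs (y' t) <= B2)).
  { pose proof (locally_singleton _ _ Hloc) as (_ & _ & Cx & Cy & _).
    apply filter_and; [exact Hloc|].
    apply filter_and; now apply continuous_locally_bounded. }
  destruct Hloc' as [r Hball].
  assert (HB : forall t, Boule t0 r t -> C1_curve_in rho x y x' y' t /\
                 Rabs (x' t) <= B1 /\ Rabs (y' t) <= B2).
  { intros t Ht. apply Hball. exact Ht. }
  set (fn' := fun n t => sum_f_R0 (fun m => hom (dx c) m (x t) (y t) * x' t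
                            + hom (dy c) m (x t) (y t) * y' t) n).
  set (g := fun t => psum (dx c) (x t) (y t) * x' t
                     + psum (dy c) (x t) (y t) * y' t).
  assert (Hcvu : CVU fn' g t0 r).
  { intros eps He.
    set (K := M * A * (2 * (2 * A) * rho) / (1 - 2 * (2 * A) * rho) * (B1 + B2)).
    assert (HBs : 0 <= B1 + B2).
    { unfold B1, B2. pose proof (Rabs_pos (x' t0)).
      pose proof (Rabs_pos (y' t0)). lra. }
    assert (HK : 0 <= K).
    { unfold K. apply Rmult_le_pos; [|auto].
      apply Rmult_le_pos; [|left; apply Rinv_0_lt_compat; lra].
      apply Rmult_le_pos; [apply Hdx|lra]. }
    destruct (geom_eventually_small K _ eps HK Hq He) as [N HN].
    exists N. intros n t Hn Ht.
    destruct (HB t Ht) as ((_ & _ & _ & _ & Hx & Hy) & Hx' & Hy').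
    eapply Rle_lt_trans; [|apply (HN n Hn)].
    unfold g, fn'. rewrite sum_plus.
    rewrite <- (scal_sum (fun m => hom (dx c) m (x t) (y t))).
    rewrite <- (scal_sum (fun m => hom (dy c) m (x t) (y t))).
    pose proof (psum_tail (dx c) _ _ rho (x t) (y t) n Hdx ltac:(lra) Hx Hy) as T1.
    pose proof (psum_tail (dy c) _ _ rho (x t) (y t) n Hdy ltac:(lra) Hx Hy) as T2.
    set (s1 := sum_f_R0 (fun m => hom (dx c) m (x t) (y t)) n) in *.
    set (s2 := sum_f_R0 (fun m => hom (dy c) m (x t) (y t)) n) in *.
    replace (psum (dx c) (x t) (y t) * x' t + psum (dy c) (x t) (y t) * y' t
             - (x' t * s1 + y' t * s2))
      with ((psum (dx c) (x t) (y t) - s1) * x' t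
            + (psum (dy c) (x t) (y t) - s2) * y' t) by ring.
    eapply Rle_trans; [apply Rabs_triang|]. rewrite !Rabs_mult.
    set (T := M * A * (2 * (2 * A) * rho) ^ S n / (1 - 2 * (2 * A) * rho)) in *.
    replace (K * (2 * (2 * A) * rho) ^ n) with (T * B1 + T * B2)
      by (unfold T, K; simpl; field; lra).
    apply Rplus_le_compat; apply Rmult_le_compat; auto using Rabs_pos. }
  apply is_derive_Reals.
  (* Differentiation lowers the degree by one, so the partial sum up to [S n] corresponds to the
     derivative sum up to [n]; the constant part of degree 0 drops out. *)
  apply (derivable_pt_lim_CVU
           (fun n t => sum_f_R0 (fun m => hom c m (x t) (y t)) (S n)) fn'
           _ g t0 t0 r).
  - apply Boule_center.
  - intros t n Ht. apply is_derive_Reals.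
    destruct (HB t Ht) as ((Hx & Hy & _) & _).
    apply (is_derive_ext (fun t => hom c 0 0 0
             + sum_f_R0 (fun m => hom c (S m) (x t) (y t)) n)).
    { intros s. rewrite (decomp_sum _ (S n)) by lia. cbn [pred]. f_equal. }
      
    evar_last.
    { apply (is_derive_plus (V := R_NormedModule) (fun _ => hom c 0 0 0)).
      - apply is_derive_const.
      - apply is_derive_sum_f_R0. intros k _. apply is_derive_hom; eassumption. }
    unfold fn'. unfold plus, zero. simpl. ring.
  - intros t Ht. destruct (HB t Ht) as ((_ & _ & _ & _ & Hx & Hy) & _).
    pose proof (is_series_psum c M A rho (x t) (y t) Hc ltac:(lra) Hx Hy) as H.
    apply is_series_sum_f_R0, is_lim_seq_Reals in H.
    intros eps He. destruct (H eps He) as [N HN]. exists N.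
    intros n Hn. apply HN. lia.
  - exact Hcvu.
  - intros t Ht. apply (CVU_continuity fn' g t0 r Hcvu); [|exact Ht].
    intros n s Hs. apply continuity_pt_filterlim.
    destruct (HB s Hs) as ((Hx & Hy & Cx & Cy & _) & _).
    apply (continuous_sum_f_R0 (fun m t => hom (dx c) m (x t) (y t) * x' t
                            + hom (dy c) m (x t) (y t) * y' t) n).
    intros k _. apply (continuous_plus (V := R_NormedModule));
      apply (continuous_mult (K := R_AbsRing));
      try assumption; apply continuous_hom; eexists; eassumption.
Qed.

Lemma continuous_Rabs_lt (f : R -> R) (t rho : R) :
  continuous f t -> Rabs (f t) < rho -> locally t (fun s => Rabs (f s) < rho).
Proof.
  intros Cf Hf.
  apply (continuous_comp f Rabs t Cf (continuous_Rabs _) (fun v => v < rho)).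
  pose proof (Rabs_pos (f t)).
  apply (locally_interval _ _ (-1) rho); simpl; intros; lra.
Qed.

Lemma Rabs_segment_lt (a b t rho : R) :
  0 <= t <= 1 -> Rabs a < rho -> Rabs b < rho -> Rabs (a + t * (b - a)) < rho.
Proof.
  intros Ht Ha Hb. apply Rabs_def2 in Ha. apply Rabs_def2 in Hb.
  apply Rabs_def1; destruct (Rle_lt_dec t (1 / 2)); nra.
Qed.

(** The mean value theorem along the segment between the two points, which stays in the square by
    convexity. It serves to show that the trapping region is open. *)
Lemma psum_lipschitz (c : nat -> nat -> R) (M A rho x1 y1 x2 y2 : R) :
  geom_bounded c M A -> 4 * A * rho < 1 ->
  Rabs x1 < rho -> Rabs y1 < rho -> Rabs x2 < rho -> Rabs y2 < rho ->
  Rabs (psum c x2 y2 - psum c x1 y1)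
    <= M * A / (1 - 4 * A * rho) * (Rabs (x2 - x1) + Rabs (y2 - y1)).
Proof.
  intros Hc Hr Hx1 Hy1 Hx2 Hy2.
  pose proof (geom_bounded_dx _ _ _ Hc) as Hdx.
  pose proof (geom_bounded_dy _ _ _ Hc) as Hdy.
  set (X := fun t => x1 + t * (x2 - x1)). set (Y := fun t => y1 + t * (y2 - y1)).
  assert (HX : forall t, 0 <= t <= 1 -> Rabs (X t) < rho).
  { intros t Ht. unfold X. now apply Rabs_segment_lt. }
  assert (HY : forall t, 0 <= t <= 1 -> Rabs (Y t) < rho).
  { intros t Ht. unfold Y. now apply Rabs_segment_lt. }
  assert (HD : forall t, 0 <= t <= 1 -> is_derive (fun t => psum c (X t) (Y t)) t
     (psum (dx c) (X t) (Y t) * (x2 - x1) + psum (dy c) (X t) (Y t) * (y2 - y1))).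
  { intros t Ht.
    apply (is_derive_psum c M A rho X Y (fun _ => x2 - x1) (fun _ => y2 - y1) t);
      auto.
    assert (CX : continuous X t).
    { apply (ex_derive_continuous (V := R_NormedModule)). unfold X. auto_derive. auto. }
    assert (CY : continuous Y t).
    { apply (ex_derive_continuous (V := R_NormedModule)). unfold Y. auto_derive. auto. }
    pose proof (continuous_Rabs_lt X t rho CX (HX t Ht)) as LX.
    pose proof (continuous_Rabs_lt Y t rho CY (HY t Ht)) as LY.
    generalize (filter_and _ _ LX LY). apply filter_imp.
    intros s [H1 H2].
    split; [|split; [|split; [apply continuous_const|split;
      [apply continuous_const|lra]]]].
    - apply (is_derive_ext (fun v => x1 + v * (x2 - x1))); [reflexivity|].
      auto_derive; [auto|ring].
    - apply (is_derive_ext (fun v => y1 + v * (y2 - y1))); [reflexivity|].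
      auto_derive; [auto|ring]. }
  destruct (MVT_gen (fun t => psum c (X t) (Y t)) 0 1
     (fun t => psum (dx c) (X t) (Y t) * (x2 - x1)
               + psum (dy c) (X t) (Y t) * (y2 - y1))) as [t [Ht E]].
  - intros t Ht. rewrite Rmin_left, Rmax_right in Ht by lra. apply HD; lra.
  - intros t Ht. rewrite Rmin_left, Rmax_right in Ht by lra.
    apply continuity_pt_filterlim.
    apply (ex_derive_continuous (V := R_NormedModule)
             (fun t => psum c (X t) (Y t))). eexists. apply HD; lra.
  - rewrite Rmin_left, Rmax_right in Ht by lra.
    replace (X 1) with x2 in E by (unfold X; ring).
    replace (Y 1) with y2 in E by (unfold Y; ring).
    replace (X 0) with x1 in E by (unfold X; ring).
    replace (Y 0) with y1 in E by (unfold Y; ring).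
    pose proof (psum_bound (dx c) _ _ rho (X t) (Y t) Hdx ltac:(lra)
                  ltac:(left; auto) ltac:(left; auto)) as B1.
    pose proof (psum_bound (dy c) _ _ rho (X t) (Y t) Hdy ltac:(lra)
                  ltac:(left; auto) ltac:(left; auto)) as B2.
    replace (2 * (2 * A) * rho) with (4 * A * rho) in B1, B2 by ring.
    rewrite E, Rminus_0_r, Rmult_1_r, Rmult_plus_distr_l.
    eapply Rle_trans; [apply Rabs_triang|]. rewrite !Rabs_mult.
    apply Rplus_le_compat; apply Rmult_le_compat_r; auto using Rabs_pos.
Qed.

(** * Formal operations on the coefficients *)

(** The coefficients of [x ^ p * y ^ q * c]. *)
Definition shift (p q : nat) (c : nat -> nat -> R) (i j : nat) : R :=
  if andb (p <=? i) (q <=? j) then c (i - p)%nat (j - q)%nat else 0.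

(** The coefficients of the product of [c] with the homogeneous part of degree
    [d] of [g]. *)
Definition hom_mul (g : nat -> nat -> R) (d : nat) (c : nat -> nat -> R)
    (i j : nat) : R :=
  sum_f_R0 (fun l => g (d - l)%nat l * shift (d - l) l c i j) d.

Lemma shift_in (p q : nat) (c : nat -> nat -> R) (i j : nat) :
  (p <= i)%nat -> (q <= j)%nat -> shift p q c i j = c (i - p)%nat (j - q)%nat.
Proof.
  intros Hp Hq. unfold shift.
  apply Nat.leb_le in Hp. apply Nat.leb_le in Hq. now rewrite Hp, Hq.
Qed.

Lemma shift_out (p q : nat) (c : nat -> nat -> R) (i j : nat) :
  (i < p)%nat \/ (j < q)%nat -> shift p q c i j = 0.
Proof.
  intros H. unfold shift.
  destruct (Nat.leb_spec p i); destruct (Nat.leb_spec q j); try reflexivity; lia.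
Qed.

Lemma hom_ext (c d : nat -> nat -> R) (m : nat) (x y : R) :
  (forall i j, c i j = d i j) -> hom c m x y = hom d m x y.
Proof. intros H. apply sum_eq. intros j _. now rewrite H. Qed.

Lemma hom_plus (c d : nat -> nat -> R) (m : nat) (x y : R) :
  hom (fun i j => c i j + d i j) m x y = hom c m x y + hom d m x y.
Proof.
  unfold hom. rewrite <- sum_plus. apply sum_eq. intros j _. ring.
Qed.

Lemma hom_scal (k : R) (c : nat -> nat -> R) (m : nat) (x y : R) :
  hom (fun i j => k * c i j) m x y = k * hom c m x y.
Proof.
  unfold hom. rewrite scal_sum. apply sum_eq. intros j _. ring.
Qed.

Lemma hom_sum (F : nat -> nat -> nat -> R) (N m : nat) (x y : R) :
  hom (fun i j => sum_f_R0 (fun l => F l i j) N) m x y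
    = sum_f_R0 (fun l => hom (F l) m x y) N.
Proof.
  induction N as [|N IH]; [reflexivity|].
  rewrite tech5, <- IH, <- hom_plus. now apply hom_ext.
Qed.

Lemma hom_shift_x (c : nat -> nat -> R) (m : nat) (x y : R) :
  hom (shift 1 0 c) (S m) x y = x * hom c m x y.
Proof.
  unfold hom. rewrite tech5, Nat.sub_diag, shift_out by lia.
  rewrite scal_sum, !Rmult_0_l, Rplus_0_r. apply sum_eq. intros j Hj.
  rewrite shift_in by lia.
  replace (S m - j)%nat with (S (m - j)) by lia.
  rewrite Nat.sub_0_r. replace (S (m - j) - 1)%nat with (m - j)%nat by lia.
  simpl. ring.
Qed.

Lemma hom_shift_y (c : nat -> nat -> R) (m : nat) (x y : R) :
  hom (shift 0 1 c) (S m) x y = y * hom c m x y.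
Proof.
  unfold hom. rewrite decomp_sum by lia. rewrite shift_out by lia.
  rewrite scal_sum, !Rmult_0_l, Rplus_0_l. apply sum_eq. intros j Hj.
  rewrite shift_in by lia.
  replace (S m - S j - 0)%nat with (m - j)%nat by lia.
  replace (S j - 1)%nat with j by lia.
  replace (S m - S j)%nat with (m - j)%nat by lia. simpl. ring.
Qed.

(** Multiplication by one variable delays the series by one degree, which inserts a zero term and
    keeps the sum; [p] and [q] count how often this is done. *)
Lemma is_series_hom_shift (c : nat -> nat -> R) (p q : nat) (x y l : R) :
  is_series (fun m => hom c m x y) l ->
  is_series (fun m => hom (shift p q c) m x y) (x ^ p * y ^ q * l).
Proof.
  intros H. induction p as [|p IHp].
  - induction q as [|q IHq].
    + simpl. rewrite !Rmult_1_l. revert H. apply is_series_ext. intros m.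
      apply hom_ext. intros i j. rewrite shift_in by lia. now rewrite !Nat.sub_0_r.
    + apply (is_series_scal_l_R y), is_series_zero_shift in IHq.
      replace (x ^ 0 * y ^ S q * l) with (y * (x ^ 0 * y ^ q * l)) by (simpl; ring).
      revert IHq. apply is_series_ext. intros [|m].
      * unfold hom. simpl. rewrite shift_out by lia. ring.
      * rewrite <- hom_shift_y. apply hom_ext. intros i j.
        destruct (le_lt_dec (S q) j).
        -- rewrite !shift_in by lia. f_equal; lia.
        -- rewrite (shift_out 0 (S q)) by lia.
           destruct (le_lt_dec 1 j); [|apply shift_out; lia].
           rewrite shift_in, shift_out by lia. reflexivity.
  - apply (is_series_scal_l_R x), is_series_zero_shift in IHp.
    replace (x ^ S p * y ^ q * l) with (x * (x ^ p * y ^ q * l)) by (simpl; ring).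
    revert IHp. apply is_series_ext. intros [|m].
    + unfold hom. simpl. rewrite shift_out by lia. ring.
    + rewrite <- hom_shift_x. apply hom_ext. intros i j.
      destruct (le_lt_dec (S p) i).
      * destruct (le_lt_dec q j).
        -- rewrite !shift_in by lia. f_equal; lia.
        -- rewrite shift_in, !shift_out by lia. reflexivity.
      * rewrite (shift_out (S p) q) by lia.
        destruct (le_lt_dec 1 i); [|apply shift_out; lia].
        rewrite shift_in, shift_out by lia. reflexivity.
Qed.

Lemma is_series_hom_mul (g c : nat -> nat -> R) (d : nat) (x y l : R) :
  is_series (fun m => hom c m x y) l ->
  is_series (fun m => hom (hom_mul g d c) m x y) (hom g d x y * l).
Proof.
  intros H.
  apply (is_series_ext (fun m => sum_f_R0 (fun k =>
           g (d - k)%nat k * hom (shift (d - k) k c) m x y) d)).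
  - intros m. unfold hom_mul. rewrite hom_sum. apply sum_eq. intros k _.
    symmetry. apply hom_scal.
  - replace (hom g d x y * l) with
      (sum_f_R0 (fun k => g (d - k)%nat k * (x ^ (d - k) * y ^ k * l)) d).
    + apply (is_series_sum_swap
               (fun m k => g (d - k)%nat k * hom (shift (d - k) k c) m x y)).
      intros k _. now apply is_series_scal_l_R, is_series_hom_shift.
    + unfold hom. rewrite Rmult_comm, scal_sum. apply sum_eq. intros k _. ring.
Qed.

Lemma is_series_finite (a : nat -> R) (N : nat) :
  (forall k, (N < k)%nat -> a k = 0) -> is_series a (sum_f_R0 a N).
Proof.
  intros H. apply is_series_sum_f_R0.
  apply (is_lim_seq_ext_loc (fun _ => sum_f_R0 a N)); [|apply is_lim_seq_const].
  exists N. intros n Hn. induction Hn as [|n Hn IH]; [reflexivity|].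
  rewrite tech5, <- IH, H by lia. ring.
Qed.

(** On a ray the series is a power series whose coefficients are the values of the homogeneous
    parts, so each part vanishes. The one-sided uniqueness makes an open quadrant enough, and a
    quadrant avoids the origin. *)
Lemma double_pseries_zero (e : nat -> nat -> R) (delta : R) :
  0 < delta ->
  (forall x y, 0 < x < delta -> 0 < y < delta ->
     is_series (fun m => hom e m x y) 0) ->
  forall i j, e i j = 0.
Proof.
  intros Hd He.
  assert (Hh : forall m x y, 0 < x < delta -> 0 < y < delta -> hom e m x y = 0).
  { intros m x y Hx Hy.
    apply (one_sided_pseries_zero (fun m => hom e m x y) 1 1); [lra|lra|].
    intros u Hu. rewrite Rmult_1_l.
    apply (is_series_ext (fun m => hom e m (u * x) (u * y))).
    - intros k. apply hom_scale.
    - apply He; nra. }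
  intros i j. set (m := (i + j)%nat). set (x := delta / 2).
  (* With [x] fixed, the part of degree [m] is a polynomial in [y]; the [if] pads its coefficients
     with zeros to a power series, to which the uniqueness lemma applies again. *)
  assert (Z : (if j <=? m then e (m - j)%nat j * x ^ (m - j) else 0) = 0).
  { revert j m. cut (forall m j,
      (if j <=? m then e (m - j)%nat j * x ^ (m - j) else 0) = 0); [auto|].
    intros m. apply (one_sided_pseries_zero _ 1 delta); [lra|lra|].
    intros y Hy. rewrite Rmult_1_l.
    set (a := fun k => (if k <=? m then e (m - k)%nat k * x ^ (m - k) else 0)
                       * y ^ k).
    assert (E : sum_f_R0 a m = 0).
    { rewrite <- (Hh m x y) by (unfold x; lra). apply sum_eq. intros k Hk.
      unfold a. apply Nat.leb_le in Hk. now rewrite Hk. }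
    rewrite <- E. apply is_series_finite. intros k Hk. unfold a.
    destruct (Nat.leb_spec k m); [lia|]. apply Rmult_0_l. }
  assert (Hj : (j <= m)%nat) by (unfold m; lia).
  apply Nat.leb_le in Hj. rewrite Hj in Z.
  replace (m - j)%nat with i in Z by (unfold m; lia).
  apply Rmult_integral in Z. destruct Z as [Z|Z]; [exact Z|].
  exfalso. revert Z. apply pow_nonzero. unfold x. lra.
Qed.

(** * Formal obstruction to a first integral *)

Lemma sum_f_R0_zero (f : nat -> R) (N : nat) :
  (forall l, (l <= N)%nat -> f l = 0) -> sum_f_R0 f N = 0.
Proof.
  intros H. rewrite (sum_eq _ (fun _ => 0)), sum_cte by auto. ring.
Qed.

Lemma sum_f_R0_single (f : nat -> R) (N k : nat) :
  (k <= N)%nat -> (forall l, (l <= N)%nat -> l <> k -> f l = 0) ->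
  sum_f_R0 f N = f k.
Proof.
  intros Hk H. induction N as [|N IH].
  - now replace k with 0%nat by lia.
  - rewrite tech5. destruct (Nat.eq_dec k (S N)) as [->|Hne].
    + rewrite sum_f_R0_zero; [ring|]. intros l Hl. apply H; lia.
    + rewrite IH, (H (S N)) by (intros; try apply H; lia). ring.
Qed.

(** The coefficient of x^i y^j in y c_x + (q_3 + q_d) c_y, where q_3 and q_d are the homogeneous
    parts of the field in degrees 3 and [d]. *)
Definition first_integral_eq (q c : nat -> nat -> R) (d i j : nat) : Prop :=
  shift 0 1 (dx c) i j + hom_mul q 3 (dy c) i j + hom_mul q d (dy c) i j = 0.

Section Obstruction.

Variables (q c : nat -> nat -> R) (d : nat).
Hypothesis q30 : q 3%nat 0%nat = - 2.
Hypothesis d_odd : Nat.Odd d.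
Hypothesis d_ge : (7 <= d)%nat.
Hypothesis Hc : forall i j, first_integral_eq q c d i j.

Let degree_ok (p r : nat) : Prop := (p + r = 3 \/ p + r = d)%nat.

(** The operator x^p y^r d/dy sends x^(i-p) y^(j-r+1) to a multiple of x^i y^j; here this
    contribution is zero because one of the two coefficients is. *)
Let negligible (i j p r : nat) : Prop :=
  (p <= i)%nat -> (r <= j)%nat -> q p r = 0 \/ c (i - p)%nat (S (j - r)) = 0.

Lemma negligible_zero (i j p r : nat) :
  negligible i j p r -> q p r * shift p r (dy c) i j = 0.
Proof.
  intros H. destruct (le_lt_dec p i) as [Hp|]; [|rewrite shift_out by lia; ring].
  destruct (le_lt_dec r j) as [Hr|]; [|rewrite shift_out by lia; ring].
  rewrite shift_in by assumption. unfold dy.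
  destruct (H Hp Hr) as [-> | ->]; ring.
Qed.

(** Isolates the equation for the unperturbed operator [D] and a single perturbing monomial, once
    all other monomials are known to contribute nothing. *)
Lemma two_term_eq (i j p0 r0 : nat) :
  degree_ok p0 r0 -> (1 <= r0)%nat ->
  (forall p r, degree_ok p r -> (p, r) <> (3, 0)%nat -> (p, r) <> (p0, r0) ->
     negligible i j p r) ->
  shift 0 1 (dx c) i j - 2 * shift 3 0 (dy c) i j
    + q p0 r0 * shift p0 r0 (dy c) i j = 0.
Proof.
  intros Hd0 Hr0 Hn. pose proof (Hc i j) as E. unfold first_integral_eq in E.
  assert (Z : forall p r, degree_ok p r -> (p, r) <> (3, 0)%nat ->
                (p, r) <> (p0, r0) -> q p r * shift p r (dy c) i j = 0).
  { intros p r H1 H2 H3. apply negligible_zero. auto. }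
  unfold hom_mul in E.
  destruct Hd0 as [Hd0|Hd0].
  - rewrite (sum_f_R0_zero _ d) in E.
    2:{ intros l Hl. apply Z; [right; lia| |]; intros Ep; apply pair_equal_spec in Ep; lia. }
    rewrite decomp_sum, (sum_f_R0_single _ _ (pred r0)) in E; try lia.
    + change (3 - 0)%nat with 3%nat in E.
      rewrite q30 in E. replace (S (pred r0)) with r0 in E by lia.
      replace (3 - r0)%nat with p0 in E by lia. rewrite <- E. ring.
    + intros l Hl Hne. apply Z; [left; lia| |]; intros Ep; apply pair_equal_spec in Ep; lia.
  - rewrite (sum_f_R0_single _ 3 0) in E; [|lia|].
    2:{ intros l Hl Hne. apply Z; [left; lia| |]; intros Ep; apply pair_equal_spec in Ep; lia. }
    rewrite (sum_f_R0_single _ d r0) in E; [|lia|].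
    + rewrite Nat.sub_0_r, q30 in E.
      replace (d - r0)%nat with p0 in E by lia. rewrite <- E. ring.
    + intros l Hl Hne. apply Z; [right; lia| |]; intros Ep; apply pair_equal_spec in Ep; lia.
Qed.

(** [D] applied to the series [c] has coefficient zero at x^i y^j. *)
Let leading_eq (i j : nat) : Prop :=
  shift 0 1 (dx c) i j = 2 * shift 3 0 (dy c) i j.

Lemma one_term_eq (i j : nat) :
  (forall p r, degree_ok p r -> (p, r) <> (3, 0)%nat -> negligible i j p r) ->
  leading_eq i j.
Proof.
  intros Hn. unfold leading_eq.
  (* The monomial y^3 is an arbitrary choice of second term; it is negligible like the others. *)
  pose proof (two_term_eq i j 0 3 ltac:(left; lia) ltac:(lia)
                ltac:(intros; apply Hn; auto)) as E.
  rewrite negligible_zero in E; [lra|].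
  apply Hn; [left; lia|discriminate].
Qed.

(** [D] raises the weight by one. Its equation at (i + 3, j - 1) makes [c i j] proportional to
    [c (i + 4) (j - 2)]; for odd [j] the descent ends at j = 1, where y c_x has no term free of y.
    The flag [b] lets the same argument serve both parities of [i]. *)
Lemma leading_odd_zero (k : nat) (b : bool) :
  (forall i j, (i + 2 * j = k + 1)%nat -> Nat.Even j -> Nat.even i = b ->
     leading_eq i j) ->
  forall j i, Nat.Odd j -> Nat.even i = negb b -> (i + 2 * j = k)%nat ->
    c i j = 0.
Proof.
  intros HL j. induction j as [j IH] using lt_wf_ind. intros i Hj Hi Hk.
  assert (Hi3 : Nat.even (i + 3) = b).
  { rewrite Nat.even_add, Hi. now destruct b. }
  destruct Hj as [t Ht].
  pose proof (HL (i + 3)%nat (j - 1)%nat ltac:(lia) ltac:(exists t; lia) Hi3) as E.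
  unfold leading_eq in E. rewrite (shift_in 3 0) in E by lia. unfold dy in E.
  replace (i + 3 - 3)%nat with i in E by lia.
  replace (S (j - 1 - 0)) with j in E by lia.
  assert (HR : 0 < INR j) by (apply lt_0_INR; lia).
  enough (shift 0 1 (dx c) (i + 3) (j - 1) = 0) by nra.
  destruct t as [|t].
  - apply shift_out. lia.
  - rewrite shift_in by lia. unfold dx.
    replace (S (i + 3 - 0)) with (i + 4)%nat by lia.
    replace (j - 1 - 1)%nat with (j - 2)%nat by lia.
    rewrite IH; [ring|lia|exists t; lia| |lia].
    rewrite Nat.even_add, Hi. now destruct b.
Qed.

(** The least weight [i + 2 * j] of a nonconstant term of [c], where [x] has
    weight 1 and [y] weight 2. *)
Variable m : nat.
Hypothesis m_pos : (0 < m)%nat.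
Hypothesis below_m : forall i j, (0 < i + 2 * j < m)%nat -> c i j = 0.

(** Every admissible monomial other than x^3 has weight at least 4, so at weight [m + 1] it meets
    only coefficients of weight below [m]. *)
Lemma lowest_leading_eq (i j : nat) : (i + 2 * j = m + 1)%nat -> leading_eq i j.
Proof.
  intros Hw. apply one_term_eq. intros p r Hd H30 Hp Hr. right. apply below_m.
  assert (p <> 3 \/ r <> 0)%nat by (destruct (Nat.eq_dec p 3); [|auto];
    destruct (Nat.eq_dec r 0); [|auto]; exfalso; apply H30; congruence).
  unfold degree_ok in Hd. lia.
Qed.

(** The coefficient of y^(m/2), from which the recursion given by [D] generates the whole lowest
    part. For odd [m] there is no such monomial. *)
Let s : R := if Nat.even m then c 0%nat (m / 2)%nat else 0.

(** The lowest weighted homogeneous part is a power of [x ^ 4 + y ^ 2], whose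
    coefficients have the same sign. *)
Lemma lowest_same_sign (i j : nat) :
  (i + 2 * j = m)%nat -> exists k, 0 <= k /\ c i j = k * s.
Proof.
  revert j. induction i as [i IH] using lt_wf_ind. intros j Hw.
  destruct i as [|i].
  - exists 1. split; [lra|]. unfold s. replace m with (j * 2)%nat by lia.
    rewrite Nat.even_mul, Nat.div_mul by lia.
    rewrite Bool.orb_true_r. ring.
  (* This equation expresses [c (S i) j] through [c (i - 3) (j + 2)] with a positive factor, or
     makes it zero when [i < 3]. *)
  - pose proof (lowest_leading_eq i (S j) ltac:(lia)) as E.
    unfold leading_eq in E. rewrite (shift_in 0 1) in E by lia. unfold dx in E.
    replace (S (i - 0)) with (S i) in E by lia.
    replace (S j - 1)%nat with j in E by lia.
    assert (HR : 0 < INR (S i)) by (apply lt_0_INR; lia).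
    destruct (le_lt_dec 3 i) as [H3|H3].
    + rewrite shift_in in E by lia. unfold dy in E.
      destruct (IH (i - 3)%nat ltac:(lia) (S (S j)) ltac:(lia)) as [k [Hk Ek]].
      replace (S (S j - 0)) with (S (S j)) in E by lia. rewrite Ek in E.
      exists (2 * INR (S (S j)) * k / INR (S i)). split.
      * apply Rmult_le_pos; [|left; now apply Rinv_0_lt_compat].
        pose proof (pos_INR (S (S j))). nra.
      * apply (Rmult_eq_reg_l (INR (S i))); [|lra]. rewrite E. field. lra.
    + rewrite shift_out in E by lia. exists 0. split; [lra|]. nra.
Qed.

Hypothesis m_attained : exists i j, (i + 2 * j = m)%nat /\ c i j <> 0.

(** All coefficients of the lowest part are multiples of [s], so [s] is nonzero and [m] even. Were
    m/2 odd, [leading_odd_zero] would kill the coefficient of y^(m/2). *)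
Lemma lowest_witness :
  s <> 0 /\ exists h, (m = 4 * h)%nat /\ (1 <= h)%nat /\ s = c 0%nat (2 * h)%nat.
Proof.
  destruct m_attained as (i & j & Hw & Hne).
  destruct (lowest_same_sign i j Hw) as [k [_ Ek]].
  assert (Hs : s <> 0) by (intros Hs; apply Hne; rewrite Ek, Hs; ring).
  split; [exact Hs|].
  unfold s in *. destruct (Nat.even m) eqn:Em; [|now contradict Hs].
  apply Nat.even_spec in Em. destruct Em as [h Eh].
  assert (E2 : (m / 2 = h)%nat) by (rewrite Eh, Nat.mul_comm; apply Nat.div_mul; lia).
  rewrite E2 in *.
  destruct (Nat.Even_or_Odd h) as [[h' Eh']|Ho].
  - exists h'. split; [lia|split; [lia|now rewrite Eh']].
  - exfalso. apply Hs. apply (leading_odd_zero m false); auto.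
    intros. now apply lowest_leading_eq.
Qed.

Variables (p0 r0 : nat).
Hypothesis p0_even : Nat.Even p0.
Hypothesis r0_odd : Nat.Odd r0.
Hypothesis pr0_degree : degree_ok p0 r0.
Hypothesis lower_odd_zero : forall p r, Nat.Even p -> Nat.Odd r ->
  degree_ok p r -> (p + 2 * r < p0 + 2 * r0)%nat -> q p r = 0.

Lemma degree_ok_parity (p r : nat) :
  degree_ok p r -> Nat.Even r /\ Nat.Odd p \/ Nat.Odd r /\ Nat.Even p.
Proof.
  intros Hd. destruct d_odd as [e He].
  destruct (Nat.Even_or_Odd r) as [[t Ht]|[t Ht]]; [left|right]; split;
    try (exists t; lia); destruct Hd as [Hd|Hd].
  - exists (1 - t)%nat. lia.
  - exists (e - t)%nat. lia.
  - exists (1 - t)%nat. lia.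
  - exists (e - t)%nat. lia.
Qed.

(** At a position with even exponents, a monomial with [p] odd and [r] even meets a coefficient odd
    in both variables. Its weight is below [k], since [p + 2 * r] is at least 4 when x^3 is
    excluded. *)
Lemma even_case_negligible (k i j p r : nat) :
  (forall k' i j, (k' < k)%nat -> (i + 2 * j = k')%nat ->
     Nat.Odd i -> Nat.Odd j -> c i j = 0) ->
  (i + 2 * j = k + 1)%nat -> Nat.Even i -> Nat.Even j ->
  degree_ok p r -> (p, r) <> (3, 0)%nat -> Nat.Even r -> Nat.Odd p ->
  negligible i j p r.
Proof.
  intros IH Hw [i' Hi] [j' Hj] Hd H30 [r' Hr] [p' Hp] Hpi Hrj. right.
  assert (r <> 0 \/ p <> 3)%nat by (destruct (Nat.eq_dec p 3); [|auto];
    destruct (Nat.eq_dec r 0); [|auto]; exfalso; apply H30; congruence).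
  unfold degree_ok in Hd.
  apply (IH (i - p + 2 * S (j - r))%nat); [lia|reflexivity| |].
  - exists (i' - p' - 1)%nat. lia.
  - exists (j' - r')%nat. lia.
Qed.

(** Up to this weight the part odd in both variables obeys the unperturbed equation. Monomials with
    [r] even meet odd coefficients of smaller weight, zero by induction; those with [r] odd either
    vanish or are too heavy to meet a coefficient of weight [m] or more. *)
Lemma odd_part_zero (k i j : nat) :
  (k + 3 < m + p0 + 2 * r0)%nat -> (i + 2 * j = k)%nat ->
  Nat.Odd i -> Nat.Odd j -> c i j = 0.
Proof.
  revert i j. induction k as [k IH] using lt_wf_ind. intros i j Hk Hw Hi Hj.
  apply (leading_odd_zero k true); auto.
  - clear i j Hw Hi Hj. intros i j Hw Hj Hi. apply Nat.even_spec in Hi.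
    apply one_term_eq. intros p r Hd H30.
    destruct (degree_ok_parity p r Hd) as [[Hr Hp]|[Hr Hp]].
    + apply (even_case_negligible k); auto. intros. apply (IH k'); auto. lia.
    + intros Hpi Hrj.
      destruct (le_lt_dec (p0 + 2 * r0) (p + 2 * r)).
      * right. apply below_m. lia.
      * left. now apply lower_odd_zero.
  - simpl. apply Nat.odd_spec in Hi. rewrite <- Nat.negb_odd, Hi. reflexivity.
Qed.

(** The equations of weight [N] form a chain: each odd coefficient is a positive combination of the
    preceding one and a source term. After multiplication by [q p0 r0 * s] all sources are
    nonnegative and one is positive, so the sign propagates to the last equation, where no further
    coefficient is left to balance it. *)
Lemma lowest_odd_coefficient_zero : q p0 r0 = 0.
Proof.
  destruct lowest_witness as [Hs (h & Hm & Hh & Es)].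
  destruct (Req_dec (q p0 r0) 0) as [|Hq]; [assumption|exfalso].
  destruct p0_even as [p' Hp']. destruct r0_odd as [r' Hr'].
  (* The weight in which x^p0 y^r0 d/dy first acts on the lowest part. *)
  set (N := (m + p0 + 2 * r0 - 2)%nat).
  (* The default [X 0 = 0] reflects that y c_x has no term free of y. *)
  set (X := fun t => match t with O => 0 | S _ =>
              q p0 r0 * s * c (N + 1 - 4 * t)%nat (2 * t - 1)%nat end).
  set (e := fun t => q p0 r0 * s *
              (q p0 r0 * shift p0 r0 (dy c) (N - 4 * t)%nat (2 * t)%nat)).
  assert (E : forall t, (4 * t <= N)%nat ->
     INR (N - 4 * t + 1) * X t - 2 * (if (3 <=? N - 4 * t) then
        INR (2 * t + 1) * X (S t) else 0) + e t = 0).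
  { intros t Ht.
    pose proof (two_term_eq (N - 4 * t) (2 * t) p0 r0 pr0_degree ltac:(lia)) as T.
    assert (T' : shift 0 1 (dx c) (N - 4 * t) (2 * t)
       - 2 * shift 3 0 (dy c) (N - 4 * t) (2 * t)
       + q p0 r0 * shift p0 r0 (dy c) (N - 4 * t) (2 * t) = 0).
    { apply T. intros p r Hd H30 H0.
      destruct (degree_ok_parity p r Hd) as [[Hr Hp]|[Hr Hp]].
      - apply (even_case_negligible (m + p0 + 2 * r0 - 3)); auto.
        + intros k' i j Hk' Hw Hi Hj. apply (odd_part_zero k'); auto. lia.
        + lia.
        + exists (2 * h + p' + 2 * r' - 2 * t)%nat. unfold N. lia.
        + exists t. lia.
      - intros Hpi Hrj.
        destruct (lt_eq_lt_dec (p + 2 * r) (p0 + 2 * r0)) as [[Hlt|Heq]|Hgt].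
        + left. now apply lower_odd_zero.
        (* Within one degree the weight determines [r]. Across degrees there is no coincidence: for
           odd [r] the weight is at most 6 in degree 3 and at least 8 in degree [d], as [d >= 7]. *)
        + exfalso. apply H0. unfold degree_ok in *. destruct Hr as [r1 Hr1].
          f_equal; lia.
        + right. apply below_m. unfold N in *. lia. }
    clear T. apply (f_equal (Rmult (q p0 r0 * s))) in T'.
    rewrite Rmult_0_r in T'. unfold e.
    assert (A1 : q p0 r0 * s * shift 0 1 (dx c) (N - 4 * t) (2 * t)
                 = INR (N - 4 * t + 1) * X t).
    { destruct t as [|t]; [rewrite shift_out by lia; simpl; ring|].
      rewrite shift_in by lia. unfold dx, X.
      replace (S (N - 4 * S t - 0)) with (N - 4 * S t + 1)%nat by lia.
      replace (N + 1 - 4 * S t)%nat with (N - 4 * S t + 1)%nat by lia. ring. }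
    assert (A2 : q p0 r0 * s * shift 3 0 (dy c) (N - 4 * t) (2 * t)
                 = if 3 <=? N - 4 * t then INR (2 * t + 1) * X (S t) else 0).
    { destruct (Nat.leb_spec 3 (N - 4 * t)).
      - rewrite shift_in by lia. unfold dy, X.
        replace (S (2 * t - 0)) with (2 * t + 1)%nat by lia.
        replace (N - 4 * t - 3)%nat with (N + 1 - 4 * S t)%nat by lia.
        replace (2 * S t - 1)%nat with (2 * t + 1)%nat by lia. ring.
      - rewrite shift_out by lia. ring. }
    rewrite <- A1, <- A2. etransitivity; [|exact T']. ring. }
  assert (e_nonneg : forall t, (4 * t <= N)%nat -> 0 <= e t).
  { intros t Ht. unfold e.
    destruct (le_lt_dec p0 (N - 4 * t)) as [H1|];
      [|rewrite shift_out by lia; lra].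
    destruct (le_lt_dec r0 (2 * t)) as [H2|]; [|rewrite shift_out by lia; lra].
    rewrite shift_in by lia. unfold dy.
    destruct (lowest_same_sign (N - 4 * t - p0) (S (2 * t - r0))) as [k [Hk Ek]].
    { unfold N in *. lia. }
    rewrite Ek. pose proof (pos_INR (S (2 * t - r0))).
    replace (q p0 r0 * s * (q p0 r0 * (INR (S (2 * t - r0)) * (k * s))))
      with ((q p0 r0 * s) ^ 2 * (INR (S (2 * t - r0)) * k)) by ring.
    apply Rmult_le_pos; [apply pow2_ge_0|nra]. }
  (* At this index the source comes from the term y^(2h) of the lowest part, whose coefficient is
     [s]; it equals (q s)^2 times a positive integer. *)
  set (t1 := (r' + h)%nat).
  assert (e_pos : 0 < e t1).
  { unfold e. rewrite shift_in by (unfold t1, N; lia). unfold dy.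
    replace (N - 4 * t1 - p0)%nat with 0%nat by (unfold N, t1; lia).
    replace (S (2 * t1 - r0)) with (2 * h)%nat by (unfold t1; lia).
    rewrite <- Es.
    replace (q p0 r0 * s * (q p0 r0 * (INR (2 * h) * s)))
      with ((q p0 r0 * s) * (q p0 r0 * s) * INR (2 * h)) by ring.
    apply Rmult_lt_0_compat; [|apply lt_0_INR; lia].
    apply Rsqr_pos_lt. apply Rmult_integral_contrapositive. auto. }
  assert (X_sign : forall t, (4 * t <= N)%nat ->
                     0 <= X t /\ ((t1 < t)%nat -> 0 < X t)).
  { induction t as [|t IHt]; intros Ht; [split; [simpl; lra|lia]|].
    destruct (IHt ltac:(lia)) as [X0 X1].
    pose proof (E t ltac:(lia)) as Et.
    replace (3 <=? N - 4 * t) with true in Et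
      by (symmetry; apply Nat.leb_le; lia).
    pose proof (e_nonneg t ltac:(lia)) as e0.
    assert (R1 : 0 < INR (N - 4 * t + 1)) by (apply lt_0_INR; lia).
    assert (R2 : 0 < INR (2 * t + 1)) by (apply lt_0_INR; lia).
    split.
    - apply Rnot_lt_le. intros Hn. nra.
    - intros Hlt. apply Rnot_le_lt. intros Hn.
      destruct (Nat.eq_dec t t1) as [->|Hne]; [nra|].
      specialize (X1 ltac:(lia)). nra. }
  (* The last equation of the chain. As [N] is even, [N - 4 * t2] is 0 or 2, so the x^3 term
     contributes nothing. *)
  set (t2 := (N / 4)%nat).
  assert (Ht2 : (4 * t2 <= N < 4 * t2 + 4)%nat).
  { unfold t2. pose proof (Nat.div_mod N 4). pose proof (Nat.mod_upper_bound N 4).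
    lia. }
  pose proof (E t2 ltac:(lia)) as Et.
  replace (3 <=? N - 4 * t2) with false in Et.
  2:{ symmetry. apply Nat.leb_gt. unfold N in *. lia. }
  destruct (X_sign t2 ltac:(lia)) as [X0 X1].
  pose proof (e_nonneg t2 ltac:(lia)) as e0.
  assert (R1 : 0 < INR (N - 4 * t2 + 1)) by (apply lt_0_INR; lia).
  destruct (Nat.eq_dec t2 t1) as [Heq|Hne].
  - rewrite Heq in *. nra.
  - assert (t1 < t2)%nat by (unfold t1, N in *; lia).
    specialize (X1 H). nra.
Qed.

End Obstruction.

Lemma nat_least (P : nat -> Prop) (k : nat) :
  P k -> exists m, P m /\ forall m', (m' < m)%nat -> ~ P m'.
Proof.
  induction k as [k IH] using lt_wf_ind. intros Hk.
  destruct (classic (exists k', (k' < k)%nat /\ P k'))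
    as [(k' & Hlt & Hk')|Hno].
  - now apply (IH k').
  - exists k. split; [assumption|]. intros m' Hm' Hp. apply Hno. eauto.
Qed.

(** Strong induction on the weight [p + 2 * r]: when a monomial is treated, all lighter ones with
    [r] odd are already known to vanish. *)
Lemma formal_first_integral_obstruction (q c : nat -> nat -> R) (d : nat) :
  q 3%nat 0%nat = - 2 -> Nat.Odd d -> (7 <= d)%nat ->
  (forall i j, first_integral_eq q c d i j) ->
  (exists i j, (0 < i + j)%nat /\ c i j <> 0) ->
  forall p r, Nat.Even p -> Nat.Odd r -> (p + r = 3 \/ p + r = d)%nat ->
    q p r = 0.
Proof.
  intros Hq Hdo Hd7 Hc (i0 & j0 & Hij & Hne).
  destruct (nat_least (fun m => (0 < m)%nat /\
              exists i j, (i + 2 * j = m)%nat /\ c i j <> 0) (i0 + 2 * j0))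
    as (m & (Hm & Hatt) & Hleast).
  { split; [lia|]. eauto. }
  assert (Hbelow : forall i j, (0 < i + 2 * j < m)%nat -> c i j = 0).
  { intros i j Hw. destruct (Req_dec (c i j) 0) as [|Hn]; [assumption|].
    exfalso. apply (Hleast (i + 2 * j)%nat); [lia|]. split; [lia|]. eauto. }
  cut (forall w p r, (p + 2 * r = w)%nat -> Nat.Even p -> Nat.Odd r ->
         (p + r = 3 \/ p + r = d)%nat -> q p r = 0); [eauto|].
  intros w. induction w as [w IH] using lt_wf_ind. intros p r Hw Hp Hr Hd.
  apply (lowest_odd_coefficient_zero q c d Hq Hdo Hd7 Hc m Hm Hbelow Hatt); auto.
  intros p1 r1 Hp1 Hr1 Hd1 Hlt. apply (IH (p1 + 2 * r1)%nat); auto. lia.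
Qed.

(** * A first integral yields a formal first integral *)

Definition expands_at (f : R -> R) (s0 : R) : Prop :=
  exists (e : nat -> R) (delta : R), 0 < delta /\
    forall s, Rabs (s - s0) < delta -> is_series (fun m => e m * (s - s0) ^ m) (f s).

(** The expansion minus the constant vanishes to the left of [s0]; one-sided uniqueness with sign -1
    kills its coefficients, and the expansion is then constant on both sides. *)
Lemma expands_at_constant_left (f : R -> R) (s0 k eta : R) :
  expands_at f s0 -> 0 < eta -> (forall s, s0 - eta < s < s0 -> f s = k) ->
  exists delta, 0 < delta /\ forall s, Rabs (s - s0) < delta -> f s = k.
Proof.
  intros (e & delta & Hd & He) Heta Hk. exists delta. split; [assumption|].
  set (k' := fun m : nat => match m with O => k | S _ => 0 end).
  assert (Sk : forall u, is_series (fun m => k' m * u ^ m) k).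
  { intros u.
    assert (E : sum_f_R0 (fun m => k' m * u ^ m) 0 = k) by (simpl; ring).
    rewrite <- E. apply is_series_finite. intros [|j] Hj; [lia|simpl; ring]. }
  assert (Z : forall m, e m - k' m = 0).
  { apply (one_sided_pseries_zero _ (-1) (Rmin delta eta)).
    - lra.
    - now apply Rmin_pos.
    - intros u Hu. pose proof (Rmin_l delta eta). pose proof (Rmin_r delta eta).
      specialize (He (s0 - u)).
      replace (s0 - u - s0) with (-1 * u) in He by ring.
      rewrite Hk in He by lra.
      replace 0 with (k - k) by ring.
      apply (is_series_ext (fun m => e m * (-1 * u) ^ m - k' m * (-1 * u) ^ m)).
      { intros m. symmetry. apply Rmult_minus_distr_r. }
      apply (is_series_minus (V := R_NormedModule)); [|apply Sk].
      apply He. split_Rabs; lra. }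
  intros s Hs. apply (is_series_unique_eq (fun m => k' m * (s - s0) ^ m)); [|apply Sk].
  apply (is_series_ext (fun m => e m * (s - s0) ^ m)); [|now apply He].
  intros m. specialize (Z m). now replace (e m) with (k' m) by lra.
Qed.

(** The identity theorem on a segment: at the supremum of the interval where [f] is constant, the
    local expansion carries the constancy beyond it. *)
Lemma analytic_constant_segment (f : R -> R) (eta : R) :
  (forall s, 0 <= s <= 1 -> expands_at f s) ->
  0 < eta -> (forall s, 0 <= s < eta -> f s = f 0) -> f 1 = f 0.
Proof.
  intros Hexp Heta Hf.
  set (E := fun s => 0 <= s <= 1 /\ forall t, 0 <= t <= s -> f t = f 0).
  assert (E0 : E 0).
  { split; [lra|]. intros t Ht. now replace t with 0 by lra. }
  destruct (completeness E) as [S [Hub Hlub]].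
  { exists 1. intros s [Hs _]. lra. }
  { now exists 0. }
  assert (HS0 : 0 <= S) by now apply Hub.
  assert (HS1 : S <= 1) by (apply Hlub; intros s [Hs _]; lra).
  assert (Hbelow : forall t, 0 <= t < S -> f t = f 0).
  { intros t Ht. destruct (Req_dec (f t) (f 0)) as [|Hne]; [assumption|exfalso].
    assert (S <= t); [|lra]. apply Hlub. intros s [Hs1 Hs2].
    apply Rnot_lt_le. intros Hlt. apply Hne, Hs2. lra. }
  assert (HSpos : 0 < S).
  { set (s := Rmin (eta / 2) 1).
    pose proof (Rmin_l (eta / 2) 1). pose proof (Rmin_r (eta / 2) 1).
    assert (0 < s) by (apply Rmin_pos; lra).
    apply Rlt_le_trans with s; [assumption|]. apply Hub. unfold s in *.
    split; [lra|]. intros t Ht. apply Hf. lra. }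
  destruct (expands_at_constant_left f S (f 0) S) as (delta & Hd & Hconst).
  { apply Hexp. lra. }
  { assumption. }
  { intros s Hs. apply Hbelow. lra. }
  destruct (Rle_lt_dec 1 S) as [H1|H1].
  - apply Hconst. replace 1 with S by lra. rewrite Rminus_diag, Rabs_R0. lra.
  - exfalso. set (s := Rmin (S + delta / 2) 1).
    pose proof (Rmin_l (S + delta / 2) 1). pose proof (Rmin_r (S + delta / 2) 1).
    assert (S < s) by (apply Rmin_glb_lt; lra).
    assert (E s); [|specialize (Hub s H3); lra].
    unfold s in *. split; [lra|]. intros t Ht.
    destruct (Rlt_le_dec t S); [apply Hbelow; lra|].
    apply Hconst. split_Rabs; lra.
Qed.

Lemma analytic_at_series (H : R -> R -> R) (x0 y0 : R) :
  analytic_at H x0 y0 -> exists (c : nat -> nat -> R) (r : R), 0 < r /\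
    (exists M A, geom_bounded c M A) /\
    forall u v, Rabs u < r -> Rabs v < r ->
      is_series (fun m => hom c m u v) (H (x0 + u) (y0 + v)).
Proof.
  intros (c & r & Hr & Hser). exists c, r. split; [assumption|]. split.
  (* Absolute convergence at one corner point bounds every coefficient; this gives the growth rate
     [2 / r]. *)
  - destruct (Hser (x0 + r / 2) (y0 + r / 2)) as [Habs _].
    { replace (x0 + r / 2 - x0) with (r / 2) by ring. split_Rabs; lra. }
    { replace (y0 + r / 2 - y0) with (r / 2) by ring. split_Rabs; lra. }
    destruct Habs as [l Hl].
    destruct (is_series_terms_bounded _ _ Hl) as (M & HM & Hb).
    exists M, (2 / r).
    assert (Hr2 : 0 < 2 / r) by (apply Rdiv_lt_0_compat; lra).
    split; [assumption|]. split; [lra|]. intros i j.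
    specialize (Hb (i + j)%nat). cbv beta zeta in Hb.
    assert (Hp : 0 < (r / 2) ^ (i + j)) by (apply pow_lt; lra).
    apply Rmult_le_reg_r with ((r / 2) ^ (i + j)); [assumption|].
    replace (M * (2 / r) ^ (i + j) * (r / 2) ^ (i + j)) with M.
    2:{ rewrite Rmult_assoc, <- Rpow_mult_distr.
        replace (2 / r * (r / 2)) with 1 by (field; lra). rewrite pow1. ring. }
    eapply Rle_trans; [|exact Hb].
    eapply Rle_trans; [|apply Rle_abs].
    rewrite <- (Rabs_pos_eq ((r / 2) ^ (i + j))) by lra.
    rewrite <- Rabs_mult.
    set (F := fun j0 => Rabs (c (i + j - j0)%nat j0
         * (x0 + r / 2 - x0) ^ (i + j - j0) * (y0 + r / 2 - y0) ^ j0)).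
    replace (Rabs (c i j * (r / 2) ^ (i + j))) with (F j).
    + assert (G : forall N, (j <= N)%nat -> F j <= sum_f_R0 F N).
      { assert (Fpos : forall k, 0 <= F k) by (intros; apply Rabs_pos).
        induction N as [|N IH]; intros HN.
        - replace j with 0%nat by lia. simpl. lra.
        - rewrite tech5. destruct (Nat.eq_dec j (S N)) as [->|].
          + pose proof (cond_pos_sum F N Fpos). lra.
          + specialize (IH ltac:(lia)). specialize (Fpos (S N)). lra. }
      apply G. lia.
    + unfold F. replace (i + j - j)%nat with i by lia. f_equal.
      rewrite pow_add, Rmult_assoc.
      replace (x0 + r / 2 - x0) with (r / 2) by ring.
      now replace (y0 + r / 2 - y0) with (r / 2) by ring.
  - intros u v Hu Hv.
    destruct (Hser (x0 + u) (y0 + v)) as [_ Hs].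
    { now replace (x0 + u - x0) with u by ring. }
    { now replace (y0 + v - y0) with v by ring. }
    revert Hs. apply is_series_ext. intros m. unfold hom. apply sum_eq.
    intros j _. replace (x0 + u - x0) with u by ring.
    now replace (y0 + v - y0) with v by ring.
Qed.

Lemma analytic_at_expands (H : R -> R -> R) (x y s0 : R) :
  analytic_at H (s0 * x) (s0 * y) -> expands_at (fun s => H (s * x) (s * y)) s0.
Proof.
  intros HA. destruct (analytic_at_series _ _ _ HA) as (c & r & Hr & _ & Hs).
  exists (fun m => hom c m x y), (r / (1 + Rabs x + Rabs y)).
  pose proof (Rabs_pos x). pose proof (Rabs_pos y).
  split; [apply Rdiv_lt_0_compat; lra|]. intros s Hlt.
  apply Rlt_div_r in Hlt; [|lra].
  apply (is_series_ext (fun m => hom c m ((s - s0) * x) ((s - s0) * y))).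
  { intros m. apply hom_scale. }
  replace (s * x) with (s0 * x + (s - s0) * x) by ring.
  replace (s * y) with (s0 * y + (s - s0) * y) by ring.
  pose proof (Rabs_pos (s - s0)).
  apply Hs; rewrite Rabs_mult; nra.
Qed.

(** Every point of the square is joined to the origin by a segment along which [H] expands. This
    turns nonconstancy on the whole neighborhood into a nonconstant Taylor series at the origin. *)
Lemma analytic_constant_square (H : R -> R -> R) (rho eta : R) :
  0 < eta ->
  (forall x y, Rabs x < rho -> Rabs y < rho -> analytic_at H x y) ->
  (forall x y, Rabs x < eta -> Rabs y < eta -> H x y = H 0 0) ->
  forall x y, Rabs x < rho -> Rabs y < rho -> H x y = H 0 0.
Proof.
  intros Heta HA Hloc x y Hx Hy.
  pose proof (Rabs_pos x). pose proof (Rabs_pos y).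
  pose proof (analytic_constant_segment (fun s => H (s * x) (s * y))
                (eta / (1 + Rabs x + Rabs y))) as T.
  cbv beta in T. rewrite !Rmult_1_l, !Rmult_0_l in T. apply T.
  - intros s Hs. apply analytic_at_expands.
    apply HA; rewrite Rabs_mult, (Rabs_pos_eq s) by lra; nra.
  - apply Rdiv_lt_0_compat; lra.
  - intros s [Hs0 Hs]. apply Rlt_div_r in Hs; [|lra].
    apply Hloc; rewrite Rabs_mult, (Rabs_pos_eq s) by lra; nra.
Qed.

(** The array [a] leaves its entry (3, 0) free, while the field has -2 there; overriding it puts
    both homogeneous parts of the field into one array. *)
Definition field_coeff (a : nat -> nat -> R) (i j : nat) : R :=
  if andb (i =? 3) (j =? 0) then - 2 else a i j.

Lemma ydot_hom (n : nat) (a : nat -> nat -> R) (x y : R) :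
  (1 <= n)%nat ->
  ydot n a x y = hom (field_coeff a) 3 x y + hom (field_coeff a) (2 * n + 3) x y.
Proof.
  intros Hn. unfold ydot, hom at 1. f_equal.
  - unfold field_coeff. simpl. ring.
  - apply sum_eq. intros j Hj. unfold field_coeff.
    destruct (Nat.eqb_spec (2 * n + 3 - j) 3); [|reflexivity].
    destruct (Nat.eqb_spec j 0); [lia|reflexivity].
Qed.

Lemma ball_square (rho x y : R) :
  ball (0, 0) rho (x, y) <-> Rabs x < rho /\ Rabs y < rho.
Proof.
  change (Rabs (x - 0) < rho /\ Rabs (y - 0) < rho
          <-> Rabs x < rho /\ Rabs y < rho).
  now rewrite !Rminus_0_r.
Qed.

Lemma continuous_ydot (n : nat) (a : nat -> nat -> R) (x y : R -> R) (t : R) :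
  (1 <= n)%nat -> ex_derive x t -> ex_derive y t ->
  continuous (fun s => ydot n a (x s) (y s)) t.
Proof.
  intros Hn Hx Hy.
  apply (continuous_ext (fun s => hom (field_coeff a) 3 (x s) (y s)
           + hom (field_coeff a) (2 * n + 3) (x s) (y s))).
  - intros s. symmetry. now apply ydot_hom.
  - apply (continuous_plus (V := R_NormedModule)); now apply continuous_hom.
Qed.

(** Constancy of [H] along a solution through each point of a small quadrant gives the equation
    pointwise there; comparing power series then gives it coefficientwise. *)
Lemma first_integral_formal (n : nat) (a : nat -> nat -> R) :
  (1 <= n)%nat -> origin_is_analytic_center xdot (ydot n a) ->
  exists c, (exists i j, (0 < i + j)%nat /\ c i j <> 0) /\
    forall i j, first_integral_eq (field_coeff a) c (2 * n + 3) i j.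
Proof.
  intros Hn [(_ & _ & U & HUo & HU0 & HU) (H & rho & HA & Hnc & Hfi)].
  assert (HA0 : analytic_at H 0 0).
  { apply HA, ball_square. rewrite Rabs_R0. split; apply cond_pos. }
  destruct (analytic_at_series _ _ _ HA0) as (c & r & Hr & (M & A & Hc) & Hs).
  assert (Hs' : forall x y, Rabs x < r -> Rabs y < r ->
                  is_series (fun m => hom c m x y) (H x y)).
  { intros x y Hx Hy. specialize (Hs x y Hx Hy). now rewrite !Rplus_0_l in Hs. }
  exists c. split.
  - apply NNPP. intros Hno.
    assert (Hz : forall i j, (0 < i + j)%nat -> c i j = 0).
    { intros i j Hij. apply NNPP. intros Hne. apply Hno. eauto. }
    destruct Hnc as (x & y & Hxy & Hne). apply Hne.
    destruct (proj1 (ball_square _ _ _) Hxy) as [Hx Hy].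
    apply (analytic_constant_square H rho r); try assumption.
    + intros x1 y1 Hx1 Hy1. apply HA. now apply ball_square.
    + assert (Hc0 : forall x y, Rabs x < r -> Rabs y < r -> H x y = c 0%nat 0%nat).
      { intros x1 y1 Hx1 Hy1.
        apply (is_series_unique_eq (fun m => hom c m x1 y1)); [now apply Hs'|].
        replace (c 0%nat 0%nat) with (sum_f_R0 (fun m => hom c m x1 y1) 0)
          by (unfold hom; simpl; ring).
        apply is_series_finite. intros k Hk. apply sum_f_R0_zero.
        intros j Hj. rewrite Hz by lia. ring. }
      intros x1 y1 Hx1 Hy1. rewrite !Hc0; auto; rewrite Rabs_R0; assumption.
  - destruct (HUo (0, 0) HU0) as [eU HeU].
    assert (HA' : 0 <= A) by apply Hc.
    (* Small enough for the domain of [H], for its expansion at the origin, for the neighborhood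
       filled by periodic orbits, and for termwise differentiation, which needs
       [4 * A * rho1 < 1]. *)
    set (rho1 := Rmin (Rmin rho r) (Rmin eU (/ (4 * A + 1) / 2))).
    assert (Hrho1 : 0 < rho1).
    { apply Rmin_pos; apply Rmin_pos; auto using cond_pos.
      apply Rdiv_lt_0_compat; [apply Rinv_0_lt_compat|]; lra. }
    assert (Hle : rho1 <= rho /\ rho1 <= r /\ rho1 <= eU
                  /\ rho1 <= / (4 * A + 1) / 2).
    { unfold rho1.
      pose proof (Rmin_l (Rmin rho r) (Rmin eU (/ (4 * A + 1) / 2))).
      pose proof (Rmin_r (Rmin rho r) (Rmin eU (/ (4 * A + 1) / 2))).
      pose proof (Rmin_l rho r). pose proof (Rmin_r rho r).
      pose proof (Rmin_l eU (/ (4 * A + 1) / 2)).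
      pose proof (Rmin_r eU (/ (4 * A + 1) / 2)). lra. }
    destruct Hle as (Hle1 & Hle2 & Hle3 & Hle4).
    assert (HArho : 4 * A * rho1 < 1).
    { apply Rle_lt_trans with (4 * A * (/ (4 * A + 1) / 2)).
      - apply Rmult_le_compat_l; lra.
      - apply Rmult_lt_reg_r with (2 * (4 * A + 1)); [lra|].
        replace (4 * A * (/ (4 * A + 1) / 2) * (2 * (4 * A + 1)))
          with (4 * A) by (field; lra). lra. }
    unfold first_integral_eq.
    apply (double_pseries_zero
             (fun i j => shift 0 1 (dx c) i j
                + hom_mul (field_coeff a) 3 (dy c) i j
                + hom_mul (field_coeff a) (2 * n + 3) (dy c) i j) rho1 Hrho1).
    intros x0 y0 Hx0 Hy0.
    (* From the periodic orbit only the fact that it is a solution starting at (x0, y0) is kept. *)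
    destruct (HU (x0, y0)) as (X & Y & T & (_ & Hsol & _) & Hinit & _).
    { apply HeU, ball_square. split; rewrite Rabs_pos_eq; lra. }
    { intros E. apply pair_equal_spec in E. lra. }
    apply pair_equal_spec in Hinit. destruct Hinit as [HX0 HY0].
    assert (DX : forall t, is_derive X t (Y t)) by (intros; now apply Hsol).
    assert (DY : forall t, is_derive Y t (ydot n a (X t) (Y t)))
      by (intros; now apply Hsol).
    assert (CX : forall t, continuous X t).
    { intros t. apply (ex_derive_continuous (V := R_NormedModule)).
      eexists. apply DX. }
    assert (CY : forall t, continuous Y t).
    { intros t. apply (ex_derive_continuous (V := R_NormedModule)).
      eexists. apply DY. }
    assert (Hloc : locally 0 (fun t => Rabs (X t) < rho1 /\ Rabs (Y t) < rho1)).
    { apply filter_and; apply continuous_Rabs_lt; auto;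
        rewrite ?HX0, ?HY0, Rabs_pos_eq; lra. }
    assert (Hder : is_derive (fun t => psum c (X t) (Y t)) 0
       (psum (dx c) x0 y0 * y0 + psum (dy c) x0 y0 * ydot n a x0 y0)).
    { rewrite <- HX0 at 1 2 3. rewrite <- HY0 at 1 2 3 4.
      apply (is_derive_psum c M A rho1 X Y Y (fun t => ydot n a (X t) (Y t)));
        try assumption.
      revert Hloc. apply filter_imp. intros t [H1 H2].
      split; [apply DX|split; [apply DY|split; [apply CY|split; [|lra]]]].
      apply continuous_ydot; [assumption| |]; eexists; [apply DX|apply DY]. }
    assert (Hzero : is_derive (fun t => psum c (X t) (Y t)) 0 0).
    { apply (is_derive_ext_loc (fun _ => H x0 y0)); [|exact (is_derive_const (V := R_NormedModule) (H x0 y0) 0)].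
      destruct Hloc as [tau Htau].
      exists tau. intros t Ht.
      assert (Hin : forall u, -tau < u < tau -> Rabs (X u) < rho1 /\ Rabs (Y u) < rho1).
      { intros u Hu. apply Htau. change (Rabs (u - 0) < tau). split_Rabs; lra. }
      assert (Ht' : - tau < t < tau).
      { change (Rabs (t - 0) < tau) in Ht. split_Rabs; lra. }
      pose proof (cond_pos tau).
      destruct (Hin t Ht') as [H1 H2].
      transitivity (H (X t) (Y t)).
      - rewrite <- HX0, <- HY0.
        apply (Hfi (-tau) tau X Y); simpl; try lra.
        + intros u _ _. now apply Hsol.
        + intros u Hu1 Hu2. destruct (Hin u ltac:(lra)).
          apply ball_square. lra.
      - apply (is_series_unique_eq (fun m => hom c m (X t) (Y t))).
        + apply Hs'; lra.
        + apply (is_series_psum c M A rho1); try assumption; lra. }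
    assert (E : y0 * psum (dx c) x0 y0 + hom (field_coeff a) 3 x0 y0 * psum (dy c) x0 y0
       + hom (field_coeff a) (2 * n + 3) x0 y0 * psum (dy c) x0 y0 = 0).
    { pose proof (is_derive_unique _ _ _ Hder) as E1.
      rewrite (is_derive_unique _ _ _ Hzero), ydot_hom in E1 by assumption. lra. }
    rewrite <- E.
    pose proof (geom_bounded_dx _ _ _ Hc) as Hdx.
    pose proof (geom_bounded_dy _ _ _ Hc) as Hdy.
    assert (Rx : Rabs x0 <= rho1) by (rewrite Rabs_pos_eq; lra).
    assert (Ry : Rabs y0 <= rho1) by (rewrite Rabs_pos_eq; lra).
    pose proof (is_series_psum _ _ _ rho1 _ _ Hdx ltac:(lra) Rx Ry) as Sx.
    pose proof (is_series_psum _ _ _ rho1 _ _ Hdy ltac:(lra) Rx Ry) as Sy.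
    apply (is_series_ext (fun m => hom (shift 0 1 (dx c)) m x0 y0
      + hom (hom_mul (field_coeff a) 3 (dy c)) m x0 y0
      + hom (hom_mul (field_coeff a) (2 * n + 3) (dy c)) m x0 y0)).
    { intros m. now rewrite !hom_plus. }
    apply (is_series_plus (V := R_NormedModule));
      [apply (is_series_plus (V := R_NormedModule))|];
      [|now apply is_series_hom_mul..].
    pose proof (is_series_hom_shift _ 0 1 _ _ _ Sx) as S.
    now replace (x0 ^ 0 * y0 ^ 1 * psum (dx c) x0 y0)
      with (y0 * psum (dx c) x0 y0) in S by ring.
Qed.

Lemma analytic_center_necessary (n : nat) (a : nat -> nat -> R) :
  (2 <= n)%nat -> origin_is_analytic_center xdot (ydot n a) ->
  a 2%nat 1%nat = 0 /\ a 0%nat 3%nat = 0 /\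
  forall k, (k <= n + 1)%nat -> a (2 * n + 2 - 2 * k)%nat (2 * k + 1)%nat = 0.
Proof.
  intros Hn Hcen.
  destruct (first_integral_formal n a ltac:(lia) Hcen) as (c & Hne & Hc).
  assert (Z : forall p r, Nat.Even p -> Nat.Odd r ->
                (p + r = 3 \/ p + r = 2 * n + 3)%nat -> a p r = 0).
  { intros p r Hp Hr Hd.
    rewrite <- (formal_first_integral_obstruction (field_coeff a) c (2 * n + 3)
                  eq_refl ltac:(exists (n + 1)%nat; lia) ltac:(lia) Hc Hne p r Hp Hr Hd).
    unfold field_coeff. destruct Hr as [r' ->].
    replace (2 * r' + 1 =? 0) with false by (symmetry; apply Nat.eqb_neq; lia).
    now rewrite Bool.andb_false_r. }
  split; [|split].
  - apply Z; [now exists 1%nat|now exists 0%nat|lia].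
  - apply Z; [now exists 0%nat|now exists 1%nat|lia].
  - intros k Hk. apply Z; [exists (n + 1 - k)%nat|exists k|]; lia.
Qed.

(** * Solving [F_u + G F_v = 0] by power series *)

(** [rows g e k] agrees with the solution up to the power [u ^ k]. *)
Fixpoint rows (g : nat -> nat -> R) (e k : nat) : nat -> nat -> R :=
  match k with
  | O => fun i j => if andb (i =? 0) (j =? 1) then 1 else 0
  | S k' => fun i j =>
      if i =? S k'
      then - (hom_mul g 1 (dy (rows g e k')) k' j
              + hom_mul g e (dy (rows g e k')) k' j) / INR (S k')
      else rows g e k' i j
  end.

Definition pde_solution (g : nat -> nat -> R) (e i j : nat) : R :=
  rows g e i i j.

Lemma rows_stable (g : nat -> nat -> R) (e k i j : nat) :
  (i <= k)%nat -> rows g e k i j = pde_solution g e i j.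
Proof.
  intros Hi. induction k as [|k IH]; [now replace i with 0%nat by lia|].
  destruct (Nat.eq_dec i (S k)) as [->|Hne]; [reflexivity|].
  simpl. replace (i =? S k) with false by (symmetry; now apply Nat.eqb_neq).
  apply IH. lia.
Qed.

(** Differentiation in v keeps the power of u and multiplication never lowers it, so row [i] of the
    right-hand side depends on the rows up to [i] only. *)
Lemma hom_mul_dy_local (g c c' : nat -> nat -> R) (d i j : nat) :
  (forall i' j', (i' <= i)%nat -> c i' j' = c' i' j') ->
  hom_mul g d (dy c) i j = hom_mul g d (dy c') i j.
Proof.
  intros H. apply sum_eq. intros l _. f_equal.
  destruct (le_lt_dec (d - l) i); [|now rewrite !shift_out by lia].
  destruct (le_lt_dec l j); [|now rewrite !shift_out by lia].
  rewrite !shift_in by assumption. unfold dy. rewrite H by lia. reflexivity.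
Qed.

Lemma pde_solution_eq (g : nat -> nat -> R) (e i j : nat) :
  let f := pde_solution g e in
  dx f i j + hom_mul g 1 (dy f) i j + hom_mul g e (dy f) i j = 0.
Proof.
  intros f. unfold dx.
  replace (f (S i) j) with
    (- (hom_mul g 1 (dy f) i j + hom_mul g e (dy f) i j) / INR (S i)).
  - field. apply not_0_INR. lia.
  - unfold f at 3, pde_solution. simpl rows. rewrite Nat.eqb_refl.
    do 3 f_equal; apply hom_mul_dy_local; intros i' j' Hi'; symmetry;
      now apply rows_stable.
Qed.

Lemma pde_solution_0 (g : nat -> nat -> R) (e j : nat) :
  pde_solution g e 0 j = if j =? 1 then 1 else 0.
Proof. reflexivity. Qed.

(** The coefficients of [1 / (1 - u - v)]; the majorant turns [d/du] and [d/dv]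
    into the same operation. *)
Definition multichoose (i j : nat) : R :=
  INR (fact (i + j)) / (INR (fact i) * INR (fact j)).

Lemma multichoose_pos (i j : nat) : 0 < multichoose i j.
Proof.
  apply Rdiv_lt_0_compat; [|apply Rmult_lt_0_compat]; apply INR_fact_lt_0.
Qed.

(** The right-hand side is the coefficient of 1 / (1 - u - v)^2, the common value of both partial
    derivatives of 1 / (1 - u - v). *)
Lemma multichoose_x (i j : nat) :
  INR (S i) * multichoose (S i) j = INR (S (i + j)) * multichoose i j.
Proof.
  unfold multichoose. simpl (S i + j)%nat. rewrite !fact_simpl, !mult_INR.
  field. repeat split; try apply INR_fact_neq_0. apply not_0_INR. lia.
Qed.

Lemma multichoose_y (i j : nat) :
  INR (S j) * multichoose i (S j) = INR (S (i + j)) * multichoose i j.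
Proof.
  unfold multichoose. rewrite Nat.add_succ_r, !fact_simpl, !mult_INR.
  field. repeat split; try apply INR_fact_neq_0. apply not_0_INR. lia.
Qed.

Lemma multichoose_incr_x (i j : nat) : multichoose i j <= multichoose (S i) j.
Proof.
  pose proof (multichoose_x i j). pose proof (multichoose_pos i j).
  assert (INR (S i) <= INR (S (i + j))) by (apply le_INR; lia).
  assert (0 < INR (S i)) by (apply lt_0_INR; lia).
  apply Rmult_le_reg_l with (INR (S i)); nra.
Qed.

Lemma multichoose_incr_y (i j : nat) : multichoose i j <= multichoose i (S j).
Proof.
  pose proof (multichoose_y i j). pose proof (multichoose_pos i j).
  assert (INR (S j) <= INR (S (i + j))) by (apply le_INR; lia).
  assert (0 < INR (S j)) by (apply lt_0_INR; lia).
  apply Rmult_le_reg_l with (INR (S j)); nra.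
Qed.

Lemma multichoose_le (i j i' j' : nat) :
  (i <= i')%nat -> (j <= j')%nat -> multichoose i j <= multichoose i' j'.
Proof.
  intros Hi Hj. apply Rle_trans with (multichoose i' j).
  - induction Hi as [|i' Hi IH]; [lra|].
    eapply Rle_trans; [exact IH|apply multichoose_incr_x].
  - induction Hj as [|j' Hj IH]; [lra|].
    eapply Rle_trans; [exact IH|apply multichoose_incr_y].
Qed.

Lemma multichoose_le_pow2 (i j : nat) : multichoose i j <= 2 ^ (i + j).
Proof.
  remember (i + j)%nat as s eqn:Es. revert i j Es.
  induction s as [|s IH]; intros i j Es.
  - replace i with 0%nat by lia. replace j with 0%nat by lia.
    unfold multichoose. simpl. lra.
  - assert (1 <= 2 ^ S s) by (apply pow_R1_Rle; lra).
    destruct i as [|i].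
    { unfold multichoose. simpl (0 + j)%nat. simpl (fact 0).
      replace (INR (fact j) / (INR 1 * INR (fact j))) with 1; [assumption|].
      simpl. field. apply INR_fact_neq_0. }
    destruct j as [|j].
    { unfold multichoose. rewrite Nat.add_0_r. simpl (fact 0).
      replace (INR (fact (S i)) / (INR (fact (S i)) * INR 1)) with 1; [assumption|].
      change (INR 1) with 1. field. apply INR_fact_neq_0. }
    pose proof (IH i (S j) ltac:(lia)). pose proof (IH (S i) j ltac:(lia)).
    pose proof (multichoose_x i (S j)) as Ex.
    pose proof (multichoose_y (S i) j) as Ey.
    rewrite Nat.add_succ_r in Ex. simpl (S i + j)%nat in Ey.
    assert (0 < INR (S (S (i + j)))) by (apply lt_0_INR; lia).
    assert (E : INR (S i) + INR (S j) = INR (S (S (i + j))))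
      by (rewrite !S_INR, plus_INR; ring).
    (* Pascal's rule, obtained by adding the two derivative identities. *)
    assert (multichoose (S i) (S j) = multichoose i (S j) + multichoose (S i) j).
    { apply Rmult_eq_reg_l with (INR (S (S (i + j)))); [|lra].
      rewrite <- E at 1. lra. }
    simpl pow. lra.
Qed.

Definition hom_norm (g : nat -> nat -> R) (d : nat) : R :=
  sum_f_R0 (fun l => Rabs (g (d - l)%nat l)) d.

Lemma hom_norm_nonneg (g : nat -> nat -> R) (d : nat) : 0 <= hom_norm g d.
Proof. apply cond_pos_sum. intros. apply Rabs_pos. Qed.

(** Each monomial of [g] refers back to smaller indices, where the majorant of the derivative is no
    larger. Only the sum of the absolute coefficients of [g] is lost. *)
Lemma hom_mul_dy_bound (g f : nat -> nat -> R) (d i j : nat) (K : R) :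
  1 <= K ->
  (forall i' j', (i' <= i)%nat -> Rabs (f i' j') <= multichoose i' j' * K ^ i') ->
  Rabs (hom_mul g d (dy f) i j)
    <= hom_norm g d * (INR (S i) * multichoose (S i) j * K ^ i).
Proof.
  intros HK Hf. unfold hom_mul, hom_norm.
  eapply Rle_trans; [apply Rsum_abs|].
  rewrite (Rmult_comm (sum_f_R0 _ _)), scal_sum.
  apply sum_Rle. intros l Hl. rewrite Rabs_mult.
  apply Rmult_le_compat_l; [apply Rabs_pos|].
  pose proof (multichoose_pos (S i) j). pose proof (pos_INR (S i)).
  assert (0 <= K ^ i) by (apply pow_le; lra).
  destruct (le_lt_dec (d - l) i) as [Hi|].
  2:{ rewrite shift_out by lia. rewrite Rabs_R0.
      apply Rmult_le_pos; [apply Rmult_le_pos|]; lra. }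
  destruct (le_lt_dec l j) as [Hj|].
  2:{ rewrite shift_out by lia. rewrite Rabs_R0.
      apply Rmult_le_pos; [apply Rmult_le_pos|]; lra. }
  rewrite shift_in by assumption. unfold dy.
  rewrite multichoose_x, Rabs_mult, (Rabs_pos_eq (INR _)) by apply pos_INR.
  set (i' := (i - (d - l))%nat). set (j' := (j - l)%nat).
  apply Rle_trans with (INR (S j') * (multichoose i' (S j') * K ^ i')).
  { apply Rmult_le_compat_l; [apply pos_INR|]. apply Hf. unfold i'. lia. }
  rewrite <- Rmult_assoc, multichoose_y.
  assert (0 <= K ^ i') by (apply pow_le; lra).
  pose proof (multichoose_pos i' j').
  apply Rmult_le_compat; try assumption.
  - apply Rmult_le_pos; [apply pos_INR|lra].
  - apply Rmult_le_compat; [apply pos_INR|lra| |].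
    + apply le_INR. unfold i', j'. lia.
    + apply multichoose_le; unfold i', j'; lia.
  - apply Rle_pow; [lra|unfold i'; lia].
Qed.

Definition pde_growth (g : nat -> nat -> R) (e : nat) : R :=
  1 + hom_norm g 1 + hom_norm g e.

Lemma pde_growth_ge_1 (g : nat -> nat -> R) (e : nat) : 1 <= pde_growth g e.
Proof.
  unfold pde_growth. pose proof (hom_norm_nonneg g 1).
  pose proof (hom_norm_nonneg g e). lra.
Qed.

(** The solution is dominated by 1 / (1 - K u - v) with K = [pde_growth g e]. Passing to the next
    row costs the two norms of [g], whose sum is below K. *)
Lemma pde_solution_majorant (g : nat -> nat -> R) (e i j : nat) :
  Rabs (pde_solution g e i j) <= multichoose i j * pde_growth g e ^ i.
Proof.
  pose proof (pde_growth_ge_1 g e) as HK.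
  revert j. induction i as [i IH] using lt_wf_ind. intros j.
  destruct i as [|i].
  - rewrite pde_solution_0.
    assert (1 <= multichoose 0 j).
    { apply Rle_trans with (multichoose 0 0); [|apply multichoose_le; lia].
      unfold multichoose. simpl. lra. }
    simpl pow. destruct (j =? 1); rewrite ?Rabs_R0, ?Rabs_R1; lra.
  - pose proof (pde_solution_eq g e i j) as E. cbv zeta in E. unfold dx in E.
    pose proof (hom_mul_dy_bound g (pde_solution g e) 1 i j _ HK
                  ltac:(intros; apply IH; lia)) as B1.
    pose proof (hom_mul_dy_bound g (pde_solution g e) e i j _ HK
                  ltac:(intros; apply IH; lia)) as B2.
    assert (HR : 0 < INR (S i)) by (apply lt_0_INR; lia).
    assert (0 <= pde_growth g e ^ i) by (apply pow_le; lra).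
    pose proof (multichoose_pos (S i) j).
    set (T := INR (S i) * multichoose (S i) j * pde_growth g e ^ i) in *.
    assert (0 <= T).
    { unfold T. apply Rmult_le_pos; [apply Rmult_le_pos|]; lra. }
    apply Rmult_le_reg_l with (INR (S i)); [assumption|].
    replace (INR (S i) * (multichoose (S i) j * pde_growth g e ^ S i))
      with (pde_growth g e * T) by (unfold T; simpl; ring).
    rewrite <- (Rabs_pos_eq (INR (S i))) at 1 by lra. rewrite <- Rabs_mult.
    replace (INR (S i) * pde_solution g e (S i) j) with
      (- (hom_mul g 1 (dy (pde_solution g e)) i j
          + hom_mul g e (dy (pde_solution g e)) i j)) by lra.
    rewrite Rabs_Ropp. eapply Rle_trans; [apply Rabs_triang|].
    unfold pde_growth at 1. lra.
Qed.

Lemma pde_solution_geom_bounded (g : nat -> nat -> R) (e : nat) :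
  geom_bounded (pde_solution g e) 1 (2 * pde_growth g e).
Proof.
  pose proof (pde_growth_ge_1 g e) as HK.
  split; [lra|]. split; [lra|]. intros i j.
  eapply Rle_trans; [apply pde_solution_majorant|].
  rewrite Rpow_mult_distr, Rmult_1_l.
  apply Rmult_le_compat.
  - left; apply multichoose_pos.
  - apply pow_le; lra.
  - apply multichoose_le_pow2.
  - apply Rle_pow; [lra|lia].
Qed.

Lemma pde_solution_psum (g : nat -> nat -> R) (e : nat) (rho u v : R) :
  4 * (2 * pde_growth g e) * rho < 1 -> Rabs u <= rho -> Rabs v <= rho ->
  psum (dx (pde_solution g e)) u v
    + (hom g 1 u v + hom g e u v) * psum (dy (pde_solution g e)) u v = 0.
Proof.
  intros Hr Hu Hv. set (f := pde_solution g e).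
  pose proof (pde_solution_geom_bounded g e) as Hf.
  pose proof (geom_bounded_dx _ _ _ Hf) as Hdx.
  pose proof (geom_bounded_dy _ _ _ Hf) as Hdy.
  pose proof (is_series_psum _ _ _ rho u v Hdx ltac:(lra) Hu Hv) as Sx.
  pose proof (is_series_psum _ _ _ rho u v Hdy ltac:(lra) Hu Hv) as Sy.
  fold f in Sx, Sy.
  rewrite Rmult_plus_distr_r, <- Rplus_assoc.
  apply (is_series_unique_eq (fun m => hom (dx f) m u v
      + hom (hom_mul g 1 (dy f)) m u v + hom (hom_mul g e (dy f)) m u v)).
  - apply (is_series_plus (V := R_NormedModule));
      [apply (is_series_plus (V := R_NormedModule))|];
      [exact Sx|now apply is_series_hom_mul..].
  - apply (is_series_ext (fun _ => 0)).
    + intros m. rewrite <- !hom_plus. symmetry. apply sum_f_R0_zero.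
      intros j _. unfold f. rewrite pde_solution_eq. ring.
    + pose proof (is_series_finite (fun _ => 0) 0 ltac:(auto)) as Z. exact Z.
Qed.

Lemma hom_mul_dy_zero (g f : nat -> nat -> R) (d i : nat) :
  (i < d)%nat -> hom_mul g d (dy f) i 0 = 0.
Proof.
  intros Hd. apply sum_f_R0_zero. intros l Hl.
  rewrite shift_out by lia. ring.
Qed.

Lemma pde_solution_1_0 (g : nat -> nat -> R) (e : nat) :
  (1 <= e)%nat -> pde_solution g e 1 0 = 0.
Proof.
  intros He. pose proof (pde_solution_eq g e 0 0) as E. cbv zeta in E.
  rewrite !hom_mul_dy_zero in E by lia. unfold dx in E. simpl in E. lra.
Qed.

Lemma pde_solution_2_0 (g : nat -> nat -> R) (e : nat) :
  (2 <= e)%nat -> pde_solution g e 2 0 = - g 1%nat 0%nat / 2.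
Proof.
  intros He. pose proof (pde_solution_eq g e 1 0) as E. cbv zeta in E.
  rewrite (hom_mul_dy_zero g _ e) in E by lia.
  unfold hom_mul in E. simpl sum_f_R0 in E.
  rewrite shift_in, shift_out in E by lia.
  unfold dx, dy in E. simpl INR in E. simpl Nat.sub in E.
  rewrite pde_solution_0 in E. simpl in E. lra.
Qed.

(** A monomial of degree [m >= 2] either contains v or equals u^m, so it is at most rho^(m-2) (u^2 +
    v). The remainder is thus compared with the leading part v + u^2 rather than with a power of the
    radius. *)
Lemma hom_le_quasi (f : nat -> nat -> R) (A rho u v : R) (m : nat) :
  geom_bounded f 1 A -> 0 < rho <= 1 -> 0 <= u <= rho -> 0 <= v <= rho ->
  (2 <= m)%nat ->
  Rabs (hom f m u v) <= (u ^ 2 + v) / rho ^ 2 * (2 * A * rho) ^ m.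
Proof.
  intros (_ & HA & Hf) Hrho Hu Hv Hm.
  replace ((u ^ 2 + v) / rho ^ 2 * (2 * A * rho) ^ m)
    with (2 ^ m * (A ^ m * (rho ^ (m - 2) * (u ^ 2 + v)))).
  2:{ replace ((2 * A * rho) ^ m) with (2 ^ m * A ^ m * (rho ^ (m - 2) * rho ^ 2)).
      - field. lra.
      - rewrite !Rpow_mult_distr, <- pow_add. do 2 f_equal. lia. }
  assert (HP : forall k, 0 <= rho ^ k) by (intros; apply pow_le; lra).
  assert (HT : 0 <= A ^ m * (rho ^ (m - 2) * (u ^ 2 + v))).
  { apply Rmult_le_pos; [now apply pow_le|].
    apply Rmult_le_pos; [apply HP|]. pose proof (pow2_ge_0 u). lra. }
  eapply Rle_trans;
    [|apply Rmult_le_compat_r; [exact HT|apply INR_succ_le_pow2]].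
  apply sum_f_R0_Rabs_le. intros j Hj.
  rewrite !Rabs_mult, Rmult_assoc.
  apply Rmult_le_compat.
  - apply Rabs_pos.
  - apply Rmult_le_pos; apply Rabs_pos.
  - specialize (Hf (m - j)%nat j). replace (m - j + j)%nat with m in Hf by lia. lra.
  - assert (Hk : forall k, 0 <= u ^ k <= rho ^ k).
    { intros k. split; [apply pow_le|apply pow_incr]; lra. }
    assert (Hl : forall k, 0 <= v ^ k <= rho ^ k).
    { intros k. split; [apply pow_le|apply pow_incr]; lra. }
    rewrite !Rabs_pos_eq by (apply Hk || apply Hl).
    pose proof (HP (m - 2)%nat). pose proof (pow2_ge_0 u).
    destruct j as [|j].
    + rewrite Nat.sub_0_r, pow_O, Rmult_1_r.
      replace (u ^ m) with (u ^ (m - 2) * u ^ 2)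
        by (rewrite <- pow_add; f_equal; lia).
      apply Rmult_le_compat; try lra; try apply Hk.
    + replace (v ^ S j) with (v ^ j * v) by (simpl; ring).
      rewrite <- Rmult_assoc.
      apply Rmult_le_compat; try lra.
      * apply Rmult_le_pos; [apply Hk|apply Hl].
      * apply Rle_trans with (rho ^ (m - S j) * rho ^ j).
        -- apply Rmult_le_compat; try apply Hk; apply Hl.
        -- rewrite <- pow_add.
           replace (m - S j + j)%nat with (S (m - 2)) by lia.
           simpl pow. nra.
Qed.

Lemma pde_solution_quasi (g : nat -> nat -> R) (e : nat) (rho u v : R) :
  (2 <= e)%nat -> g 1%nat 0%nat = - 2 ->
  let A := 2 * pde_growth g e in
  0 < rho <= / (64 * A ^ 3) -> 0 <= u <= rho -> 0 <= v <= rho ->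
  Rabs (psum (pde_solution g e) u v - (v + u ^ 2)) <= (v + u ^ 2) / 2.
Proof.
  intros He Hg A Hrho Hu Hv.
  pose proof (pde_growth_ge_1 g e) as HK.
  assert (HA : 1 <= A) by (unfold A; lra).
  pose proof (pde_solution_geom_bounded g e) as Hf. fold A in Hf.
  set (f := pde_solution g e) in *.
  assert (HA2 : 1 <= A ^ 2) by (apply pow_R1_Rle; lra).
  assert (HA3 : A ^ 2 <= A ^ 3 /\ A <= A ^ 3) by (simpl in *; nra).
  assert (Hr : rho * (64 * A ^ 3) <= 1).
  { apply Rmult_le_reg_r with (/ (64 * A ^ 3)); [apply Rinv_0_lt_compat; lra|].
    rewrite Rmult_assoc, Rinv_r by lra. lra. }
  assert (Hrho1 : 0 < rho <= 1) by nra.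
  assert (HAr : 64 * (A * rho) <= 1) by nra.
  assert (HA2r : 64 * (A ^ 2 * rho) <= 1) by nra.
  assert (HAr0 : 0 < A * rho) by nra.
  assert (Hp : is_series (fun m => hom f m u v) (psum f u v)).
  { apply (is_series_psum f 1 A rho); try assumption; try rewrite Rabs_pos_eq; lra. }
  assert (Hv0 : 0 <= v + u ^ 2) by (pose proof (pow2_ge_0 u); lra).
  pose proof (is_series_tail _ _ ((u ^ 2 + v) / rho ^ 2) (2 * A * rho) 2
     ltac:(apply Rmult_le_pos; [lra|left; apply Rinv_0_lt_compat, pow_lt; lra])
     ltac:(lra) Hp
     ltac:(intros m Hm; apply hom_le_quasi; try assumption; lia)) as T.
  (* The Cauchy data and the first two rows determine everything up to degree 2 except the
     coefficient of u v; the term u^2 arises from the coefficient -2 of u in [g]. *)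
  replace (sum_f_R0 (fun m => hom f m u v) 2)
    with (v + u ^ 2 + f 1%nat 1%nat * u * v) in T.
  2:{ unfold hom. simpl sum_f_R0. simpl Nat.sub. unfold f.
      rewrite pde_solution_1_0, pde_solution_2_0, !pde_solution_0, Hg by lia.
      simpl. field. }
  assert (T11 : Rabs (f 1%nat 1%nat * u * v) <= (v + u ^ 2) / 8).
  { destruct Hf as (_ & _ & Hf). specialize (Hf 1%nat 1%nat).
    simpl Nat.add in Hf. rewrite !Rabs_mult, (Rabs_pos_eq u), (Rabs_pos_eq v) by lra.
    apply Rle_trans with (A ^ 2 * rho * v).
    - apply Rmult_le_compat_r; [lra|].
      apply Rmult_le_compat; try lra. apply Rabs_pos.
    - pose proof (pow2_ge_0 u). nra. }
  (* The factor 64 A^3 in the bound on [rho] is used here: relative to v + u^2 the tail is at most 8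
     rho A^3 / (1 - 2 A rho), with numerator at most 1/8. *)
  assert (T3 : (u ^ 2 + v) / rho ^ 2 * (2 * A * rho) ^ 3 / (1 - 2 * A * rho)
               <= (v + u ^ 2) / 4).
  { apply Rle_div_l; [lra|].
    replace ((u ^ 2 + v) / rho ^ 2 * (2 * A * rho) ^ 3)
      with ((v + u ^ 2) * (8 * (rho * A ^ 3))) by (field; lra).
    unfold Rdiv. rewrite Rmult_assoc. apply Rmult_le_compat_l; [assumption|]. nra. }
  replace (psum f u v - (v + u ^ 2)) with
    ((psum f u v - (v + u ^ 2 + f 1%nat 1%nat * u * v)) + f 1%nat 1%nat * u * v)
    by ring.
  eapply Rle_trans; [apply Rabs_triang|]. lra.
Qed.

(** * Recentering a double power series *)

(** The coefficient of [u ^ k] in [(x0 + u) ^ i]. *)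
Fixpoint pow_coeff (x0 : R) (i k : nat) : R :=
  match i with
  | O => if k =? 0 then 1 else 0
  | S i' => x0 * pow_coeff x0 i' k
            + match k with O => 0 | S k' => pow_coeff x0 i' k' end
  end.

Lemma is_series_pow_coeff (x0 u : R) (i : nat) :
  is_series (fun k => pow_coeff x0 i k * u ^ k) ((x0 + u) ^ i).
Proof.
  induction i as [|i IH].
  - pose proof (is_series_finite (fun k => pow_coeff x0 0 k * u ^ k) 0) as H.
    simpl in H. rewrite Rmult_1_r in H. apply H.
    intros [|k] Hk; [lia|]. simpl. ring.
  - replace ((x0 + u) ^ S i) with (x0 * (x0 + u) ^ i + u * (x0 + u) ^ i)
      by (simpl; ring).
    apply (is_series_ext (fun k => x0 * (pow_coeff x0 i k * u ^ k)
      + match k with O => 0 | S k' => u * (pow_coeff x0 i k' * u ^ k') end)).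
    { intros [|k]; simpl; ring. }
    apply (is_series_plus (V := R_NormedModule)).
    + now apply is_series_scal_l_R.
    + now apply (is_series_zero_shift (fun k => u * (pow_coeff x0 i k * u ^ k))),
        is_series_scal_l_R.
Qed.

(** Cauchy's estimate on |u| = rho, where |x0 + u| is at most 2 rho, here proved by the recursion
    for the coefficients. *)
Lemma pow_coeff_bound (x0 rho : R) (i k : nat) :
  Rabs x0 <= rho -> 0 < rho -> Rabs (pow_coeff x0 i k) <= (2 * rho) ^ i * (/ rho) ^ k.
Proof.
  intros Hx Hr.
  assert (Hri : 0 < / rho) by now apply Rinv_0_lt_compat.
  revert k. induction i as [|i IH]; intros k.
  - assert (0 <= (/ rho) ^ k) by (apply pow_le; lra).
    destruct k; simpl in *; rewrite ?Rabs_R0, ?Rabs_R1; lra.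
  - simpl pow_coeff. eapply Rle_trans; [apply Rabs_triang|]. rewrite Rabs_mult.
    replace ((2 * rho) ^ S i * (/ rho) ^ k) with
      (rho * ((2 * rho) ^ i * (/ rho) ^ k) + rho * ((2 * rho) ^ i * (/ rho) ^ k))
      by (simpl; ring).
    apply Rplus_le_compat.
    + apply Rmult_le_compat; auto using Rabs_pos.
    + destruct k as [|k].
      * rewrite Rabs_R0. simpl. assert (0 <= (2 * rho) ^ i) by (apply pow_le; lra).
        nra.
      * eapply Rle_trans; [apply IH|]. right. simpl. field. lra.
Qed.

Lemma pow_coeff_abs_summable (x0 rho u : R) (i : nat) :
  Rabs x0 <= rho -> 0 < rho -> Rabs u <= rho / 4 ->
  ex_series (fun k => Rabs (pow_coeff x0 i k * u ^ k)).
Proof.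
  intros Hx Hr Hu. apply (ex_series_geom_bound _ ((2 * rho) ^ i) (1 / 4)); [lra|].
  intros k. rewrite Rabs_Rabsolu, Rabs_mult, <- RPow_abs.
  replace ((2 * rho) ^ i * (1 / 4) ^ k)
    with ((2 * rho) ^ i * (/ rho) ^ k * (rho / 4) ^ k).
  - apply Rmult_le_compat; auto using Rabs_pos, pow_coeff_bound.
    + apply pow_le, Rabs_pos.
    + apply pow_incr. split; auto using Rabs_pos.
  - rewrite Rmult_assoc, <- Rpow_mult_distr. do 2 f_equal. field. lra.
Qed.

Section Recentering.

Variables (f : nat -> nat -> R) (M A rho x0 y0 : R).
Hypothesis f_bounded : geom_bounded f M A.
Hypothesis rho_pos : 0 < rho.
Hypothesis rho_small : 8 * A * rho ^ 2 <= 1 / 2.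
Hypothesis x0_le : Rabs x0 <= rho.
Hypothesis y0_le : Rabs y0 <= rho.

(** The ratio 2 A (2 rho)^2: both squares are of size (2 rho)^2, and the number of terms of a form
    doubles [A]. *)
Let q : R := 8 * A * rho ^ 2.

(** The coefficients of [hom f m ((x0 + u) ^ 2) ((y0 + v) ^ 2)] in [u] and [v]. *)
Definition recentered_part (m k l : nat) : R :=
  sum_f_R0 (fun j => f (m - j)%nat j
    * (pow_coeff y0 (2 * j) l * pow_coeff x0 (2 * (m - j)) k)) m.

Definition recentered (k l : nat) : R :=
  Series (fun m => recentered_part m k l).

Lemma recentering_ratio : 0 <= q < 1.
Proof.
  unfold q. split; [|lra]. destruct f_bounded as (_ & HA & _).
  pose proof (pow2_ge_0 rho). apply Rmult_le_pos; lra.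
Qed.

Lemma recentered_part_bounded (m : nat) :
  geom_bounded (recentered_part m) (M * q ^ m) (/ rho).
Proof.
  destruct f_bounded as (HM & HA & Hf).
  assert (Hri : 0 < / rho) by now apply Rinv_0_lt_compat.
  pose proof recentering_ratio as Hq.
  split; [apply Rmult_le_pos; [assumption|apply pow_le; lra]|].
  split; [lra|]. intros k l. unfold recentered_part.
  set (T := M * A ^ m * ((2 * rho) ^ (2 * m) * (/ rho) ^ (k + l))).
  assert (HT : 0 <= T).
  { unfold T. repeat apply Rmult_le_pos; try apply pow_le; lra. }
  replace (M * q ^ m * (/ rho) ^ (k + l)) with (2 ^ m * T).
  2:{ unfold T, q. rewrite pow_mult.
      replace (8 * A * rho ^ 2) with (2 * A * (2 * rho) ^ 2) by ring.
      rewrite !(Rpow_mult_distr _ _ m). ring. }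
  eapply Rle_trans; [|apply Rmult_le_compat_r; [exact HT|apply INR_succ_le_pow2]].
  apply sum_f_R0_Rabs_le. intros j Hj. unfold T. rewrite Rabs_mult.
  apply Rmult_le_compat; try apply Rabs_pos.
  - specialize (Hf (m - j)%nat j). now replace (m - j + j)%nat with m in Hf by lia.
  - rewrite Rabs_mult.
    replace ((2 * rho) ^ (2 * m) * (/ rho) ^ (k + l)) with
      ((2 * rho) ^ (2 * j) * (/ rho) ^ l * ((2 * rho) ^ (2 * (m - j)) * (/ rho) ^ k)).
    + apply Rmult_le_compat; auto using Rabs_pos, pow_coeff_bound.
    + replace (2 * m)%nat with (2 * j + 2 * (m - j))%nat by lia.
      rewrite !pow_add. ring.
Qed.

Lemma is_series_recentered (k l : nat) :
  is_series (fun m => recentered_part m k l) (recentered k l).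
Proof.
  apply Series_correct.
  apply (ex_series_geom_bound _ (M * (/ rho) ^ (k + l)) q recentering_ratio).
  intros m. destruct (recentered_part_bounded m) as (_ & _ & H).
  eapply Rle_trans; [apply H|]. right. ring.
Qed.

Lemma recentered_bounded : geom_bounded recentered (M / (1 - q)) (/ rho).
Proof.
  destruct f_bounded as (HM & _).
  assert (Hri : 0 < / rho) by now apply Rinv_0_lt_compat.
  pose proof recentering_ratio as Hq.
  assert (0 < / (1 - q)) by (apply Rinv_0_lt_compat; lra).
  split; [apply Rmult_le_pos; lra|]. split; [lra|]. intros k l.
  replace (M / (1 - q) * (/ rho) ^ (k + l))
    with (M * (/ rho) ^ (k + l) / (1 - q)) by (field; lra).
  apply (is_series_Rabs_le _ _ _ q) with (3 := is_series_recentered k l); auto.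
  - apply Rmult_le_pos; [assumption|apply pow_le; lra].
  - intros m. destruct (recentered_part_bounded m) as (_ & _ & H').
    eapply Rle_trans; [apply H'|]. right. ring.
Qed.

Variables u v : R.
Hypothesis u_le : Rabs u <= rho / 4.
Hypothesis v_le : Rabs v <= rho / 4.

Lemma is_series_recentered_part (m : nat) :
  is_series (fun s => hom (recentered_part m) s u v)
    (hom f m ((x0 + u) ^ 2) ((y0 + v) ^ 2)).
Proof.
  set (B := fun j k l => pow_coeff y0 (2 * j) l * pow_coeff x0 (2 * (m - j)) k).
  apply (is_series_ext (fun s => sum_f_R0 (fun j =>
           f (m - j)%nat j * hom (B j) s u v) m)).
  { intros s. unfold recentered_part.
    rewrite (hom_sum (fun j k l => f (m - j)%nat j
       * (pow_coeff y0 (2 * j) l * pow_coeff x0 (2 * (m - j)) k))).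
    apply sum_eq. intros j _. symmetry. apply hom_scal. }
  unfold hom at 2.
  apply (is_series_sum_swap (fun s j => f (m - j)%nat j * hom (B j) s u v)).
  intros j Hj. rewrite Rmult_assoc. apply is_series_scal_l_R.
  (* The factor in y comes first, because the Cauchy product counts the exponent of its first factor
     upwards, as [hom] does for y. *)
  pose proof (is_series_mult _ _ _ _
    (is_series_pow_coeff y0 v (2 * j)) (is_series_pow_coeff x0 u (2 * (m - j)))
    (pow_coeff_abs_summable y0 rho v _ y0_le rho_pos v_le)
    (pow_coeff_abs_summable x0 rho u _ x0_le rho_pos u_le)) as P.
  rewrite !pow_mult in P. rewrite Rmult_comm in P.
  revert P. apply is_series_ext. intros s. apply sum_eq. intros l _.
  unfold B. ring.
Qed.

(** The sums over the degree in the old and in the new variables are exchanged. The double series is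
    dominated with ratio [q] in the first and 1/2 in the second, the latter from |u|, |v| <= rho /
    4. *)
Lemma is_series_psum_recentered :
  is_series (fun s => hom recentered s u v)
    (psum f ((x0 + u) ^ 2) ((y0 + v) ^ 2)).
Proof.
  pose proof recentering_ratio as Hq. destruct f_bounded as (HM & HA & _).
  apply (is_series_exchange (fun m s => hom (recentered_part m) s u v)
           (fun m => hom f m ((x0 + u) ^ 2) ((y0 + v) ^ 2)) _ M q (1 / 2));
    try lra.
  - intros m s.
    eapply Rle_trans; [apply (hom_bound _ _ _ (rho / 4) _ _ s
                                (recentered_part_bounded m)); assumption|].
    right. do 2 f_equal. field. lra.
  - apply is_series_recentered_part.
  - intros s.
    apply (is_series_sum_swap (fun m j => recentered_part m (s - j) j
             * u ^ (s - j) * v ^ j)).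
    intros j _. rewrite Rmult_assoc, Rmult_comm.
    apply (is_series_ext (fun m => u ^ (s - j) * v ^ j * recentered_part m (s - j) j)).
    { intros m. simpl. ring. }
    apply is_series_scal_l_R, is_series_recentered.
  - assert (Hsq : forall a b, Rabs a <= rho -> Rabs b <= rho / 4 ->
                    Rabs ((a + b) ^ 2) <= 2 * rho ^ 2).
    { intros a b Ha Hb. rewrite <- RPow_abs.
      apply Rle_trans with ((rho + rho / 4) ^ 2); [|simpl; nra].
      apply pow_incr. split; [apply Rabs_pos|].
      eapply Rle_trans; [apply Rabs_triang|]. lra. }
    apply (is_series_psum f M A (2 * rho ^ 2)); auto. nra.
Qed.

End Recentering.

(** A first integral must be analytic at every point of its neighborhood, not only at the origin
    where its series is given; hence the recentering. *)
Lemma psum_squares_analytic (f : nat -> nat -> R) (M A rho x0 y0 : R) :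
  geom_bounded f M A -> 0 < rho -> 8 * A * rho ^ 2 <= 1 / 2 ->
  Rabs x0 <= rho -> Rabs y0 <= rho ->
  analytic_at (fun x y => psum f (x ^ 2) (y ^ 2)) x0 y0.
Proof.
  intros Hf Hr Hs Hx0 Hy0.
  set (d := recentered f x0 y0).
  pose proof (recentered_bounded f M A rho x0 y0 Hf Hr Hs Hx0 Hy0) as Hd.
  fold d in Hd. set (M' := M / (1 - 8 * A * rho ^ 2)) in Hd.
  exists d, (rho / 4). split; [lra|]. intros x y Hx Hy. cbv zeta. split.
  - assert (Hd' : geom_bounded (fun i j => Rabs (d i j)) M' (/ rho)).
    { destruct Hd as (H1 & H2 & H3). split; [assumption|]. split; [assumption|].
      intros i j. rewrite Rabs_Rabsolu. apply H3. }
    apply (ex_series_geom_bound _ M' (1 / 2)); [lra|]. intros s.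
    replace (sum_f_R0 (fun j => Rabs (d (s - j)%nat j * (x - x0) ^ (s - j)
               * (y - y0) ^ j)) s)
      with (hom (fun i j => Rabs (d i j)) s (Rabs (x - x0)) (Rabs (y - y0))).
    + eapply Rle_trans; [apply (hom_bound _ _ _ (rho / 4) _ _ s Hd');
                         rewrite Rabs_Rabsolu; lra|].
      right. do 2 f_equal. field. lra.
    + apply sum_eq. intros j _. now rewrite !Rabs_mult, <- !RPow_abs.
  - pose proof (is_series_psum_recentered f M A rho x0 y0 Hf Hr Hs Hx0 Hy0
                  (x - x0) (y - y0) ltac:(lra) ltac:(lra)) as S.
    replace (x0 + (x - x0)) with x in S by ring.
    replace (y0 + (y - y0)) with y in S by ring. exact S.
Qed.

(** * Second order equations with a Lipschitz right-hand side *)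

Lemma is_derive_continuity_pt (f : R -> R) (t l : R) :
  is_derive f t l -> continuity_pt f t.
Proof.
  intros H. apply continuity_pt_filterlim.
  apply (ex_derive_continuous (V := R_NormedModule)). now exists l.
Qed.

Lemma derive_nonneg_le (f df : R -> R) (a b : R) :
  a <= b -> (forall t, a <= t <= b -> is_derive f t (df t)) ->
  (forall t, a <= t <= b -> 0 <= df t) -> f a <= f b.
Proof.
  intros Hab Hd Hpos.
  destruct (MVT_gen f a b df) as [c [Hc E]].
  - intros t Ht. rewrite Rmin_left, Rmax_right in Ht by assumption. apply Hd. lra.
  - intros t Ht. rewrite Rmin_left, Rmax_right in Ht by assumption.
    apply (is_derive_continuity_pt f t (df t)). now apply Hd.
  - rewrite Rmin_left, Rmax_right in Hc by assumption.
    specialize (Hpos c Hc). nra.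
Qed.

Lemma is_derive_reflect (f : R -> R) (t l : R) :
  is_derive f (- t) l -> is_derive (fun s => f (- s)) t (- l).
Proof.
  intros H. evar_last.
  - apply (is_derive_comp f (fun s => - s) t l (-1)); [exact H|].
    auto_derive; [auto|ring].
  - unfold scal. simpl. unfold mult. simpl. ring.
Qed.

Lemma is_derive_opp_R (f : R -> R) (t l : R) :
  is_derive f t l -> is_derive (fun s => - f s) t (- l).
Proof. exact (is_derive_opp (V := R_NormedModule) f t l). Qed.

Lemma exp_growth_upper (g g' : R -> R) (K lambda t : R) :
  0 <= K -> 0 < lambda -> g 0 = 0 -> 0 <= t ->
  (forall s, 0 <= s -> is_derive g s (g' s)) ->
  (forall s, 0 <= s -> g' s <= K * exp (lambda * s)) ->
  g t <= K / lambda * exp (lambda * t).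
Proof.
  intros HK Hl Hg Ht Hd Hb.
  assert (H : K / lambda * exp (lambda * 0) - g 0
              <= K / lambda * exp (lambda * t) - g t).
  { apply (derive_nonneg_le (fun s => K / lambda * exp (lambda * s) - g s)
             (fun s => K * exp (lambda * s) - g' s)); [assumption| |].
    - intros s Hs. apply (is_derive_minus (V := R_NormedModule));
        [|now apply Hd]. auto_derive; [auto|field; lra].
    - intros s Hs. specialize (Hb s ltac:(lra)). lra. }
  rewrite Hg, Rmult_0_r, exp_0 in H.
  assert (0 <= K / lambda) by (apply Rmult_le_pos; [|left; apply Rinv_0_lt_compat]; lra).
  lra.
Qed.

(** Integration against the weight exp (lambda |t|) gains the factor 1 / lambda, the source of the
    contraction in the Picard iteration. *)
Lemma exp_growth (g g' : R -> R) (K lambda t : R) :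
  0 <= K -> 0 < lambda -> g 0 = 0 ->
  (forall s, is_derive g s (g' s)) ->
  (forall s, Rabs (g' s) <= K * exp (lambda * Rabs s)) ->
  Rabs (g t) <= K / lambda * exp (lambda * Rabs t).
Proof.
  intros HK Hl Hg Hd Hb.
  assert (Hb' : forall s, 0 <= s -> Rabs (g' s) <= K * exp (lambda * s)
                       /\ Rabs (g' (- s)) <= K * exp (lambda * s)).
  { intros s Hs. pose proof (Hb s) as H1. pose proof (Hb (- s)) as H2.
    rewrite Rabs_Ropp, (Rabs_pos_eq s) in * by assumption. auto. }
  destruct (Rle_lt_dec 0 t) as [Ht|Ht].
  - rewrite (Rabs_pos_eq t) by assumption. apply Rabs_le. split.
    + cut (- g t <= K / lambda * exp (lambda * t)); [lra|].
      apply (exp_growth_upper (fun s => - g s) (fun s => - g' s)); auto.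
      * rewrite Hg. ring.
      * intros s _. now apply is_derive_opp_R.
      * intros s Hs. destruct (Hb' s Hs). split_Rabs; lra.
    + apply (exp_growth_upper g g'); auto.
      intros s Hs. destruct (Hb' s Hs). split_Rabs; lra.
  - rewrite (Rabs_left t) by assumption. apply Rabs_le. split.
    + cut (- g t <= K / lambda * exp (lambda * - t)); [lra|].
      rewrite <- (Ropp_involutive t) at 1.
      apply (exp_growth_upper (fun s => - g (- s)) (fun s => - - g' (- s)));
        auto; try lra.
      * rewrite Ropp_0, Hg. ring.
      * intros s _. now apply is_derive_opp_R, is_derive_reflect.
      * intros s Hs. destruct (Hb' s Hs). split_Rabs; lra.
    + rewrite <- (Ropp_involutive t) at 1.
      apply (exp_growth_upper (fun s => g (- s)) (fun s => - g' (- s)));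
        auto; try lra.
      * now rewrite Ropp_0.
      * intros s _. now apply is_derive_reflect.
      * intros s Hs. destruct (Hb' s Hs). split_Rabs; lra.
Qed.

(** The product [E s * exp (- k * s)] does not increase and starts at 0. *)
Lemma gronwall_zero_forward (E E' : R -> R) (k t : R) :
  E 0 = 0 -> 0 <= t -> 0 <= E t ->
  (forall s, 0 <= s -> is_derive E s (E' s)) ->
  (forall s, 0 <= s -> E' s <= k * E s) -> E t = 0.
Proof.
  intros H0 Ht Hpos Hd Hb.
  assert (H : - (E 0 * exp (- k * 0)) <= - (E t * exp (- k * t))).
  { apply (derive_nonneg_le (fun s => - (E s * exp (- k * s)))
             (fun s => (k * E s - E' s) * exp (- k * s))); [assumption| |].
    - intros s Hs. evar_last.
      + apply is_derive_opp_R.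
        apply (is_derive_mult E (fun s => exp (- k * s)) s (E' s)
                 (- k * exp (- k * s))); [now apply Hd| |apply Rmult_comm].
        auto_derive; [auto|ring].
      + unfold plus, mult. simpl. ring.
    - intros s Hs. specialize (Hb s ltac:(lra)).
      pose proof (exp_pos (- k * s)). nra. }
  rewrite H0 in H. pose proof (exp_pos (- k * t)). nra.
Qed.

Lemma gronwall_zero (E E' : R -> R) (k t : R) :
  E 0 = 0 -> (forall s, 0 <= E s) -> (forall s, is_derive E s (E' s)) ->
  (forall s, Rabs (E' s) <= k * E s) -> E t = 0.
Proof.
  intros H0 Hpos Hd Hb. destruct (Rle_lt_dec 0 t) as [Ht|Ht].
  - apply (gronwall_zero_forward E E' k); auto.
    intros s _. specialize (Hb s). split_Rabs; lra.
  - rewrite <- (Ropp_involutive t).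
    apply (gronwall_zero_forward (fun s => E (- s)) (fun s => - E' (- s)) k); auto.
    + now rewrite Ropp_0.
    + lra.
    + intros s _. now apply is_derive_reflect.
    + intros s _. specialize (Hb (- s)). split_Rabs; lra.
Qed.

Definition lipschitz2 (f : R -> R -> R) (L : R) : Prop :=
  forall x y x' y',
    Rabs (f x y - f x' y') <= L * (Rabs (x - x') + Rabs (y - y')).

Definition second_order_solution (f : R -> R -> R) (x y : R -> R) : Prop :=
  forall t, is_derive x t (y t) /\ is_derive y t (f (x t) (y t)).

(** Gronwall's argument for the squared distance of the two solutions. *)
Lemma second_order_unique (f : R -> R -> R) (L : R) (x y x' y' : R -> R) (t : R) :
  0 <= L -> lipschitz2 f L ->
  second_order_solution f x y -> second_order_solution f x' y' ->
  x 0 = x' 0 -> y 0 = y' 0 -> x t = x' t /\ y t = y' t.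
Proof.
  intros HL Hf H1 H2 Ex Ey.
  set (E := fun s => (x s - x' s) ^ 2 + (y s - y' s) ^ 2).
  assert (Z : E t = 0).
  { apply (gronwall_zero E (fun s => 2 * (x s - x' s) * (y s - y' s)
      + 2 * (y s - y' s) * (f (x s) (y s) - f (x' s) (y' s))) (1 + 4 * L)).
    - unfold E. rewrite Ex, Ey. ring.
    - intros s. unfold E. pose proof (pow2_ge_0 (x s - x' s)).
      pose proof (pow2_ge_0 (y s - y' s)). lra.
    - intros s. destruct (H1 s) as [Dx Dy]. destruct (H2 s) as [Dx' Dy'].
      pose proof (is_derive_minus (V := R_NormedModule) _ _ _ _ _ Dx Dx') as D1.
      pose proof (is_derive_minus (V := R_NormedModule) _ _ _ _ _ Dy Dy') as D2.
      evar_last.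
      + apply (is_derive_plus (V := R_NormedModule));
          apply is_derive_pow; [exact D1|exact D2].
      + unfold minus, plus, opp. simpl. ring.
    - intros s. pose proof (Hf (x s) (y s) (x' s) (y' s)) as Lf. unfold E.
      set (a := x s - x' s) in *. set (b := y s - y' s) in *.
      set (d := f (x s) (y s) - f (x' s) (y' s)) in *.
      eapply Rle_trans; [apply Rabs_triang|].
      rewrite !Rabs_mult, (Rabs_pos_eq 2) by lra.
      rewrite <- (pow2_abs a), <- (pow2_abs b).
      pose proof (Rabs_pos a). pose proof (Rabs_pos b). pose proof (Rabs_pos d).
      set (a' := Rabs a) in *. set (b' := Rabs b) in *. set (d' := Rabs d) in *.
      assert (b' * d' <= b' * (L * (a' + b'))) by (apply Rmult_le_compat_l; lra).
      assert (2 * a' * b' <= a' ^ 2 + b' ^ 2).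
      { pose proof (pow2_ge_0 (a' - b')). nra. }
      assert (L * (2 * a' * b') <= L * (a' ^ 2 + b' ^ 2))
        by (apply Rmult_le_compat_l; lra).
      assert (0 <= L * a' ^ 2) by (apply Rmult_le_pos; [lra|apply pow2_ge_0]).
      nra. }
  unfold E in Z. pose proof (pow2_ge_0 (x t - x' t)).
  pose proof (pow2_ge_0 (y t - y' t)).
  assert (Zx : (x t - x' t) ^ 2 = 0) by lra.
  assert (Zy : (y t - y' t) ^ 2 = 0) by lra.
  rewrite <- Rsqr_pow2 in Zx, Zy. apply Rsqr_eq_0 in Zx. apply Rsqr_eq_0 in Zy.
  lra.
Qed.

Lemma continuous_lipschitz2 (f : R -> R -> R) (L : R) (x y : R -> R) (t : R) :
  0 <= L -> lipschitz2 f L -> continuous x t -> continuous y t ->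
  continuous (fun s => f (x s) (y s)) t.
Proof.
  intros HL Hf Cx Cy. apply continuity_pt_filterlim.
  apply continuity_pt_filterlim in Cx. apply continuity_pt_filterlim in Cy.
  intros eps He.
  assert (He' : 0 < eps / (2 * (L + 1))) by (apply Rdiv_lt_0_compat; lra).
  destruct (Cx _ He') as (d1 & Hd1 & H1). destruct (Cy _ He') as (d2 & Hd2 & H2).
  exists (Rmin d1 d2). split; [now apply Rmin_pos|]. intros s [Ds Hs].
  change (Rabs (s - t) < Rmin d1 d2) in Hs.
  change (Rabs (f (x s) (y s) - f (x t) (y t)) < eps).
  pose proof (Rmin_l d1 d2). pose proof (Rmin_r d1 d2).
  assert (Hs1 : Rabs (s - t) < d1) by lra. assert (Hs2 : Rabs (s - t) < d2) by lra.
  pose proof (H1 s (conj Ds Hs1)) as B1. change (Rabs (x s - x t) < eps / (2 * (L + 1))) in B1.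
  pose proof (H2 s (conj Ds Hs2)) as B2. change (Rabs (y s - y t) < eps / (2 * (L + 1))) in B2.
  eapply Rle_lt_trans; [apply Hf|].
  apply Rle_lt_trans with (L * (eps / (L + 1))).
  - apply Rmult_le_compat_l; [assumption|].
    replace (eps / (L + 1)) with (eps / (2 * (L + 1)) + eps / (2 * (L + 1)))
      by (field; lra). lra.
  - apply Rmult_lt_reg_r with (L + 1); [lra|].
    replace (L * (eps / (L + 1)) * (L + 1)) with (L * eps) by (field; lra). nra.
Qed.

Lemma is_derive_RInt_continuous (f : R -> R) (c t : R) :
  (forall s, continuous f s) -> is_derive (fun s => c + RInt f 0 s) t (f t).
Proof.
  intros Hf. evar_last.
  - apply (is_derive_plus (V := R_NormedModule) (fun _ => c));
      [apply is_derive_const|].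
    apply (is_derive_RInt f (fun s => RInt f 0 s) 0); [|apply Hf].
    apply filter_forall. intros s. apply (RInt_correct (V := R_CompleteNormedModule)).
    apply (ex_RInt_continuous (V := R_CompleteNormedModule)). auto.
  - unfold plus, zero. simpl. ring.
Qed.

Section Picard.

Variables (f : R -> R -> R) (L x0 y0 : R).
Hypothesis L_ge_1 : 1 <= L.
Hypothesis f_lipschitz : lipschitz2 f L.

Fixpoint picard (k : nat) : (R -> R) * (R -> R) :=
  match k with
  | O => (fun _ => x0, fun _ => y0)
  | S k' => let (x, y) := picard k' in
      (fun t => x0 + RInt y 0 t, fun t => y0 + RInt (fun s => f (x s) (y s)) 0 t)
  end.

Let X (k : nat) : R -> R := fst (picard k).
Let Y (k : nat) : R -> R := snd (picard k).

Lemma picard_S (k : nat) :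
  X (S k) = (fun t => x0 + RInt (Y k) 0 t) /\
  Y (S k) = (fun t => y0 + RInt (fun s => f (X k s) (Y k s)) 0 t).
Proof. unfold X, Y. simpl. now destruct (picard k). Qed.

Lemma picard_derive (k : nat) :
  (forall t, continuous (X k) t) /\ (forall t, continuous (Y k) t) /\
  (forall t, is_derive (X (S k)) t (Y k t)) /\
  (forall t, is_derive (Y (S k)) t (f (X k t) (Y k t))).
Proof.
  assert (Step : forall k, (forall t, continuous (X k) t) ->
            (forall t, continuous (Y k) t) ->
            (forall t, is_derive (X (S k)) t (Y k t)) /\
            (forall t, is_derive (Y (S k)) t (f (X k t) (Y k t)))).
  { intros j CX CY. destruct (picard_S j) as [-> ->]. split; intros t.
    - now apply is_derive_RInt_continuous.
    - apply (is_derive_RInt_continuous (fun s => f (X j s) (Y j s))).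
      intros s. apply (continuous_lipschitz2 f L); auto. lra. }
  induction k as [|k (CX & CY & DX & DY)].
  - assert (C0 : forall c t : R, continuous (fun _ : R => c) t)
      by (intros; apply continuous_const).
    split; [exact (C0 x0)|]. split; [exact (C0 y0)|].
    apply Step; [exact (C0 x0)|exact (C0 y0)].
  - assert (CX' : forall t, continuous (X (S k)) t).
    { intros t. apply (ex_derive_continuous (V := R_NormedModule)).
      eexists. apply DX. }
    assert (CY' : forall t, continuous (Y (S k)) t).
    { intros t. apply (ex_derive_continuous (V := R_NormedModule)).
      eexists. apply DY. }
    split; [exact CX'|]. split; [exact CY'|]. now apply Step.
Qed.

Lemma picard_init (k : nat) : X k 0 = x0 /\ Y k 0 = y0.
Proof.
  destruct k as [|k]; [split; reflexivity|].
  destruct (picard_S k) as [-> ->].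
  rewrite !(RInt_point (V := R_CompleteNormedModule)).
  unfold zero. simpl. split; ring.
Qed.

(** The first Picard step moves the two components by a total of K |t|. *)
Let K : R := Rabs y0 + Rabs (f x0 y0).

(** The weight [exp (4 L |t|)] makes the Picard operator a contraction of ratio
    1/2 on the whole line. *)
Lemma picard_contraction (k : nat) (t : R) :
  Rabs (X (S k) t - X k t) + Rabs (Y (S k) t - Y k t)
    <= K * (1 / 2) ^ k * exp (4 * L * Rabs t).
Proof.
  assert (HK : 0 <= K).
  { unfold K. pose proof (Rabs_pos y0). pose proof (Rabs_pos (f x0 y0)). lra. }
  revert t. induction k as [|k IH]; intros t.
  - destruct (picard_S 0) as [-> ->]. unfold X, Y. simpl fst. simpl snd.
    rewrite !(RInt_const (V := R_CompleteNormedModule)).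
    unfold scal. simpl. unfold mult. simpl.
    replace (x0 + (t - 0) * y0 - x0) with (t * y0) by ring.
    replace (y0 + (t - 0) * f x0 y0 - y0) with (t * f x0 y0) by ring.
    rewrite !Rabs_mult.
    assert (Rabs t <= exp (4 * L * Rabs t)).
    { pose proof (exp_ineq1_le (4 * L * Rabs t)). pose proof (Rabs_pos t). nra. }
    unfold K in *. nra.
  - destruct (picard_derive k) as (_ & _ & DX & DY).
    destruct (picard_derive (S k)) as (_ & _ & DX' & DY').
    destruct (picard_init k) as [IX IY]. destruct (picard_init (S k)) as [IX1 IY1].
    destruct (picard_init (S (S k))) as [IX2 IY2].
    (* Since [L >= 1], the same [K'] bounds both derivatives; each component gains 1 / (4 L), and
       the two together give the ratio 1/2. *)
    set (K' := L * (K * (1 / 2) ^ k)).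
    assert (Hk : 0 <= K * (1 / 2) ^ k) by (apply Rmult_le_pos; [|apply pow_le]; lra).
    assert (HK' : 0 <= K') by (unfold K'; nra).
    assert (B1 : Rabs (X (S (S k)) t - X (S k) t)
                 <= K' / (4 * L) * exp (4 * L * Rabs t)).
    { apply (exp_growth (fun t => X (S (S k)) t - X (S k) t)
               (fun t => Y (S k) t - Y k t)); try lra.
      - intros s. now apply (is_derive_minus (V := R_NormedModule)).
      - intros s. specialize (IH s). pose proof (Rabs_pos (X (S k) s - X k s)).
        pose proof (exp_pos (4 * L * Rabs s)). unfold K'.
        assert (K * (1 / 2) ^ k * exp (4 * L * Rabs s)
                <= L * (K * (1 / 2) ^ k) * exp (4 * L * Rabs s)); [|lra].
        apply Rmult_le_compat_r; [lra|nra]. }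
    assert (B2 : Rabs (Y (S (S k)) t - Y (S k) t)
                 <= K' / (4 * L) * exp (4 * L * Rabs t)).
    { apply (exp_growth (fun t => Y (S (S k)) t - Y (S k) t)
               (fun t => f (X (S k) t) (Y (S k) t) - f (X k t) (Y k t))); try lra.
      - intros s. now apply (is_derive_minus (V := R_NormedModule)).
      - intros s. eapply Rle_trans; [apply f_lipschitz|].
        unfold K'. rewrite Rmult_assoc. apply Rmult_le_compat_l; [lra|apply IH]. }
    replace (K * (1 / 2) ^ S k) with (K' / (4 * L) + K' / (4 * L))
      by (unfold K'; simpl; field; lra).
    lra.
Qed.

Let Xlim (t : R) : R := x0 + Series (fun k => X (S k) t - X k t).
Let Ylim (t : R) : R := y0 + Series (fun k => Y (S k) t - Y k t).

Lemma telescope (u : nat -> R) (N : nat) :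
  sum_f_R0 (fun k => u (S k) - u k) N = u (S N) - u 0%nat.
Proof. induction N as [|N IH]; [reflexivity|]. rewrite tech5, IH. ring. Qed.

Lemma picard_limit (N : nat) (t : R) :
  Rabs (Xlim t - X (S N) t) <= K * exp (4 * L * Rabs t) * (1 / 2) ^ N /\
  Rabs (Ylim t - Y (S N) t) <= K * exp (4 * L * Rabs t) * (1 / 2) ^ N.
Proof.
  set (K' := K * exp (4 * L * Rabs t)).
  assert (HK' : 0 <= K').
  { unfold K', K. pose proof (Rabs_pos y0). pose proof (Rabs_pos (f x0 y0)).
    pose proof (exp_pos (4 * L * Rabs t)). apply Rmult_le_pos; lra. }
  assert (B : forall k, Rabs (X (S k) t - X k t) <= K' * (1 / 2) ^ k /\
                        Rabs (Y (S k) t - Y k t) <= K' * (1 / 2) ^ k).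
  { intros k. pose proof (picard_contraction k t).
    pose proof (Rabs_pos (X (S k) t - X k t)).
    pose proof (Rabs_pos (Y (S k) t - Y k t)).
    replace (K' * (1 / 2) ^ k) with (K * (1 / 2) ^ k * exp (4 * L * Rabs t))
      by (unfold K'; ring). lra. }
  assert (T : forall (u : nat -> R), (forall k, Rabs (u (S k) - u k) <= K' * (1 / 2) ^ k) ->
     Rabs (u 0%nat + Series (fun k => u (S k) - u k) - u (S N)) <= K' * (1 / 2) ^ N).
  { intros u Hu.
    pose proof (is_series_tail (fun k => u (S k) - u k)
      (Series (fun k => u (S k) - u k)) K' (1 / 2) N HK' ltac:(lra)) as T.
    rewrite telescope in T.
    replace (u 0%nat + Series (fun k => u (S k) - u k) - u (S N))
      with (Series (fun k => u (S k) - u k) - (u (S N) - u 0%nat)) by ring.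
    eapply Rle_trans; [apply T|].
    - apply Series_correct. apply (ex_series_geom_bound _ K' (1 / 2)); [lra|exact Hu].
    - intros m _. apply Hu.
    - right. simpl. field. }
  split; [apply (T (fun k => X k t))|apply (T (fun k => Y k t))]; apply B.
Qed.

Lemma picard_CVU (g : nat -> R -> R) (glim : R -> R) (K' c : R) (r : posreal) :
  0 <= K' ->
  (forall N t, Rabs (glim t - g N t) <= K' * exp (4 * L * Rabs t) * (1 / 2) ^ N) ->
  CVU g glim c r.
Proof.
  intros HK' Hg eps He.
  set (K2 := K' * exp (4 * L * (Rabs c + r))).
  assert (HK2 : 0 <= K2).
  { unfold K2. apply Rmult_le_pos; [assumption|left; apply exp_pos]. }
  destruct (geom_eventually_small K2 (1 / 2) eps HK2 ltac:(lra) He) as [N HN].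
  exists N. intros n t Hn Ht.
  eapply Rle_lt_trans; [apply Hg|]. eapply Rle_lt_trans; [|apply (HN n Hn)].
  apply Rmult_le_compat_r; [apply pow_le; lra|]. unfold K2.
  apply Rmult_le_compat_l; [assumption|].
  assert (4 * L * Rabs t <= 4 * L * (Rabs c + r)).
  { apply Rmult_le_compat_l; [lra|]. unfold Boule in Ht. split_Rabs; lra. }
  destruct H as [H| ->]; [left; now apply exp_increasing|lra].
Qed.

(** Existence on the whole line, as the definition of a periodic solution demands. *)
Lemma picard_lindelof :
  exists x y, second_order_solution f x y /\ x 0 = x0 /\ y 0 = y0.
Proof.
  assert (HK : 0 <= K).
  { unfold K. pose proof (Rabs_pos y0). pose proof (Rabs_pos (f x0 y0)). lra. }
  set (one := mkposreal 1 Rlt_0_1).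
  assert (CVX : forall c, CVU (fun N => X (S N)) Xlim c one).
  { intros c. apply (picard_CVU _ _ K); [exact HK|]. apply picard_limit. }
  assert (CVY : forall c, CVU (fun N => Y (S N)) Ylim c one).
  { intros c. apply (picard_CVU _ _ K); [exact HK|]. apply picard_limit. }
  assert (CX : forall t, continuity_pt Xlim t).
  { intros t. apply (CVU_continuity _ _ _ _ (CVX t)); [|apply Boule_center].
    intros N s _. apply continuity_pt_filterlim. apply picard_derive. }
  assert (CY : forall t, continuity_pt Ylim t).
  { intros t. apply (CVU_continuity _ _ _ _ (CVY t)); [|apply Boule_center].
    intros N s _. apply continuity_pt_filterlim. apply picard_derive. }
  assert (PW : forall (g : nat -> R -> R) glim t, CVU g glim t one ->
                 Un_cv (fun N => g N t) (glim t)).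
  { intros g glim t H eps He. destruct (H eps He) as [N HN].
    exists N. intros n Hn. unfold Rdist. rewrite Rabs_minus_sym.
    apply HN; [assumption|apply Boule_center]. }
  exists Xlim, Ylim. split; [|split].
  - intros t. split; apply is_derive_Reals.
    + apply (derivable_pt_lim_CVU (fun N => X (S (S N))) (fun N => Y (S N))
               Xlim Ylim t t one).
      * apply Boule_center.
      * intros s N _. apply is_derive_Reals. apply picard_derive.
      * intros s _. apply (PW (fun N => X (S (S N)))).
        intros eps He. destruct (CVX s eps He) as [N HN]. exists N.
        intros n u Hn Hu. apply HN; [lia|assumption].
      * apply CVY.
      * intros s _. apply CY.
    + apply (derivable_pt_lim_CVU (fun N => Y (S (S N)))
               (fun N s => f (X (S N) s) (Y (S N) s))
               Ylim (fun s => f (Xlim s) (Ylim s)) t t one).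
      * apply Boule_center.
      * intros s N _. apply is_derive_Reals. apply picard_derive.
      * intros s _. apply (PW (fun N => Y (S (S N)))).
        intros eps He. destruct (CVY s eps He) as [N HN]. exists N.
        intros n u Hn Hu. apply HN; [lia|assumption].
      * apply (picard_CVU _ _ (L * (K + K))); [nra|].
        intros N s. eapply Rle_trans; [apply f_lipschitz|].
        replace (L * (K + K) * exp (4 * L * Rabs s) * (1 / 2) ^ N) with
          (L * (K * exp (4 * L * Rabs s) * (1 / 2) ^ N
                + K * exp (4 * L * Rabs s) * (1 / 2) ^ N)) by ring.
        apply Rmult_le_compat_l; [lra|].
        apply Rplus_le_compat; apply picard_limit.
      * intros s _. apply continuity_pt_filterlim.
        apply (continuous_lipschitz2 f L); [lra|exact f_lipschitz| |];
          apply continuity_pt_filterlim; auto.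
  - assert (E : Rabs (Xlim 0 - x0) <= 0).
    { apply (Rle_geom_0 _ (K * exp (4 * L * Rabs 0)) (1 / 2)); [|lra|].
      - apply Rmult_le_pos; [exact HK|left; apply exp_pos].
      - intros N. rewrite <- (proj1 (picard_init (S N))). apply picard_limit. }
    pose proof (Rabs_pos (Xlim 0 - x0)). split_Rabs; lra.
  - assert (E : Rabs (Ylim 0 - y0) <= 0).
    { apply (Rle_geom_0 _ (K * exp (4 * L * Rabs 0)) (1 / 2)); [|lra|].
      - apply Rmult_le_pos; [exact HK|left; apply exp_pos].
      - intros N. rewrite <- (proj2 (picard_init (S N))). apply picard_limit. }
    pose proof (Rabs_pos (Ylim 0 - y0)). split_Rabs; lra.
Qed.

End Picard.

(** * The reversible case *)

Lemma derive_zero_const (f : R -> R) (a b : R) :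
  a <= b -> (forall t, a <= t <= b -> is_derive f t 0) -> f a = f b.
Proof.
  intros Hab Hd. apply Rle_antisym.
  - apply (derive_nonneg_le f (fun _ => 0)); auto. intros; lra.
  - cut (- f a <= - f b); [lra|].
    apply (derive_nonneg_le (fun t => - f t) (fun _ => - 0)); auto.
    + intros t Ht. now apply is_derive_opp_R, Hd.
    + intros; lra.
Qed.

(** Consider the supremum of the initial intervals on which [P] holds: [P] holds there by closedness
    from the left and extends past it by openness. *)
Lemma continuous_induction (P : R -> Prop) :
  P 0 -> (forall t, 0 <= t -> P t -> locally t P) ->
  (forall t, 0 < t -> (forall s, 0 <= s < t -> P s) -> P t) ->
  forall t, 0 <= t -> P t.
Proof.
  intros P0 Popen Pclosed t0 Ht0.
  destruct (classic (P t0)) as [|Hn]; [assumption|exfalso].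
  set (E := fun s => 0 <= s <= t0 /\ forall r, 0 <= r <= s -> P r).
  destruct (completeness E) as [S [Hub Hlub]].
  { exists t0. intros s [Hs _]. lra. }
  { exists 0. split; [lra|]. intros r Hr. now replace r with 0 by lra. }
  assert (E0 : E 0) by (split; [lra|]; intros r Hr; now replace r with 0 by lra).
  assert (HS0 : 0 <= S) by now apply Hub.
  assert (HSt : S <= t0) by (apply Hlub; intros s [Hs _]; lra).
  assert (Hbelow : forall r, 0 <= r < S -> P r).
  { intros r Hr. destruct (classic (P r)) as [|Hnr]; [assumption|exfalso].
    assert (S <= r); [|lra]. apply Hlub. intros s [Hs1 Hs2].
    apply Rnot_lt_le. intros Hlt. apply Hnr, Hs2. lra. }
  assert (PS : P S).
  { destruct (Req_dec S 0) as [->|]; [assumption|]. apply Pclosed; [lra|assumption]. }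
  destruct (Popen S HS0 PS) as [eps Heps].
  assert (HSlt : S < t0).
  { destruct HSt as [|E1]; [assumption|]. exfalso. apply Hn. now rewrite <- E1. }
  set (s := Rmin (S + eps / 2) t0).
  pose proof (Rmin_l (S + eps / 2) t0). pose proof (Rmin_r (S + eps / 2) t0).
  pose proof (cond_pos eps).
  assert (S < s) by (apply Rmin_glb_lt; lra).
  assert (E s); [|specialize (Hub s H3); lra].
  unfold s in *. split; [lra|]. intros r Hr.
  destruct (Rlt_le_dec r S); [apply Hbelow; lra|].
  apply Heps. change (Rabs (r - S) < eps). split_Rabs; lra.
Qed.

Lemma continuous_le_left (f : R -> R) (t k : R) :
  0 < t -> continuous f t -> (forall s, 0 <= s < t -> f s <= k) -> f t <= k.
Proof.
  intros Ht Cf Hs. apply Rnot_lt_le. intros Hlt.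
  assert (L : locally t (fun s => k < f s)).
  { apply (Cf (fun v => k < v)). now apply open_gt. }
  destruct L as [eps Heps]. pose proof (cond_pos eps).
  set (s := Rmax 0 (t - eps / 2)).
  pose proof (Rmax_l 0 (t - eps / 2)). pose proof (Rmax_r 0 (t - eps / 2)).
  assert (s < t) by (apply Rmax_lub_lt; lra).
  assert (k < f s).
  { apply Heps. change (Rabs (s - t) < eps). unfold s in *. split_Rabs; lra. }
  specialize (Hs s ltac:(unfold s in *; lra)). lra.
Qed.

(** * Making the polynomial field globally Lipschitz *)

Lemma pow_lipschitz (x x' : R) (i : nat) :
  Rabs x <= 1 -> Rabs x' <= 1 -> Rabs (x ^ i - x' ^ i) <= INR i * Rabs (x - x').
Proof.
  intros Hx Hx'. induction i as [|i IH].
  - simpl. rewrite Rminus_diag, Rabs_R0. lra.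
  - rewrite S_INR. simpl pow.
    replace (x * x ^ i - x' * x' ^ i)
      with (x * (x ^ i - x' ^ i) + (x - x') * x' ^ i) by ring.
    eapply Rle_trans; [apply Rabs_triang|]. rewrite !Rabs_mult.
    assert (Rabs (x' ^ i) <= 1).
    { rewrite <- RPow_abs, <- (pow1 i). apply pow_incr. split; [apply Rabs_pos|lra]. }
    pose proof (Rabs_pos x). pose proof (Rabs_pos (x - x')).
    pose proof (Rabs_pos (x ^ i - x' ^ i)). nra.
Qed.

Lemma hom_lipschitz (c : nat -> nat -> R) (m : nat) (x y x' y' : R) :
  Rabs x <= 1 -> Rabs y <= 1 -> Rabs x' <= 1 -> Rabs y' <= 1 ->
  Rabs (hom c m x y - hom c m x' y')
    <= hom_norm c m * INR m * (Rabs (x - x') + Rabs (y - y')).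
Proof.
  intros Hx Hy Hx' Hy'. unfold hom. rewrite <- minus_sum.
  eapply Rle_trans; [apply Rsum_abs|].
  unfold hom_norm. rewrite Rmult_assoc, Rmult_comm, scal_sum.
  apply sum_Rle. intros j Hj.
  replace (c (m - j)%nat j * x ^ (m - j) * y ^ j
           - c (m - j)%nat j * x' ^ (m - j) * y' ^ j)
    with (c (m - j)%nat j * (x ^ (m - j) * (y ^ j - y' ^ j)
           + (x ^ (m - j) - x' ^ (m - j)) * y' ^ j)) by ring.
  rewrite Rabs_mult. apply Rmult_le_compat_l; [apply Rabs_pos|].
  eapply Rle_trans; [apply Rabs_triang|]. rewrite !Rabs_mult.
  assert (H1 : forall z k, Rabs z <= 1 -> Rabs (z ^ k) <= 1).
  { intros z k Hz. rewrite <- RPow_abs, <- (pow1 k).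
    apply pow_incr. split; [apply Rabs_pos|lra]. }
  pose proof (pow_lipschitz x x' (m - j) Hx Hx') as Lx.
  pose proof (pow_lipschitz y y' j Hy Hy') as Ly.
  pose proof (H1 x (m - j)%nat Hx). pose proof (H1 y' j Hy').
  pose proof (Rabs_pos (x ^ (m - j))). pose proof (Rabs_pos (y' ^ j)).
  pose proof (Rabs_pos (y ^ j - y' ^ j)).
  pose proof (Rabs_pos (x ^ (m - j) - x' ^ (m - j))).
  pose proof (Rabs_pos (x - x')). pose proof (Rabs_pos (y - y')).
  assert (INR (m - j) <= INR m) by (apply le_INR; lia).
  assert (INR j <= INR m) by (apply le_INR; lia).
  assert (Rabs (x ^ (m - j)) * Rabs (y ^ j - y' ^ j) <= INR m * Rabs (y - y')) by nra.
  assert (Rabs (x ^ (m - j) - x' ^ (m - j)) * Rabs (y' ^ j) <= INR m * Rabs (x - x'))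
    by nra.
  lra.
Qed.

(** Truncation is 1-Lipschitz and odd, so the clamped field gets global solutions and keeps the
    reversibility in y. *)
Definition clamp (delta x : R) : R := Rmax (- delta) (Rmin delta x).

Lemma clamp_lipschitz (delta x x' : R) :
  Rabs (clamp delta x - clamp delta x') <= Rabs (x - x').
Proof.
  unfold clamp, Rmax, Rmin. repeat destruct (Rle_dec _ _); split_Rabs; lra.
Qed.

Lemma clamp_bound (delta x : R) : 0 <= delta -> Rabs (clamp delta x) <= delta.
Proof.
  intros Hd. unfold clamp, Rmax, Rmin. repeat destruct (Rle_dec _ _); split_Rabs; lra.
Qed.

Lemma clamp_id (delta x : R) : Rabs x <= delta -> clamp delta x = x.
Proof.
  intros Hx. unfold clamp, Rmax, Rmin. repeat destruct (Rle_dec _ _); split_Rabs; lra.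
Qed.

Lemma clamp_opp (delta x : R) : 0 <= delta -> clamp delta (- x) = - clamp delta x.
Proof.
  intros Hd. unfold clamp, Rmax, Rmin. repeat destruct (Rle_dec _ _); lra.
Qed.

Lemma ydot_clamp_lipschitz (n : nat) (a : nat -> nat -> R) (delta : R) :
  (1 <= n)%nat -> 0 <= delta <= 1 ->
  exists L, 1 <= L /\
    lipschitz2 (fun x y => ydot n a (clamp delta x) (clamp delta y)) L.
Proof.
  intros Hn Hd. set (q := field_coeff a).
  set (L1 := hom_norm q 3 * INR 3).
  set (L2 := hom_norm q (2 * n + 3) * INR (2 * n + 3)).
  assert (H1 : 0 <= L1) by (apply Rmult_le_pos; [apply hom_norm_nonneg|apply pos_INR]).
  assert (H2 : 0 <= L2) by (apply Rmult_le_pos; [apply hom_norm_nonneg|apply pos_INR]).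
  exists (1 + L1 + L2). split; [lra|]. intros x y x' y'.
  rewrite !ydot_hom by assumption. fold q.
  assert (HB : forall z, Rabs (clamp delta z) <= 1).
  { intros z. eapply Rle_trans; [apply clamp_bound|]; lra. }
  pose proof (clamp_lipschitz delta x x') as Lx.
  pose proof (clamp_lipschitz delta y y') as Ly.
  pose proof (hom_lipschitz q 3 _ _ _ _ (HB x) (HB y) (HB x') (HB y')) as A1.
  pose proof (hom_lipschitz q (2 * n + 3) _ _ _ _ (HB x) (HB y) (HB x') (HB y')) as A2.
  fold L1 in A1. fold L2 in A2.
  set (D := Rabs (clamp delta x - clamp delta x')
            + Rabs (clamp delta y - clamp delta y')) in *.
  set (D' := Rabs (x - x') + Rabs (y - y')).
  assert (HD : 0 <= D <= D').
  { unfold D, D'. pose proof (Rabs_pos (clamp delta x - clamp delta x')).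
    pose proof (Rabs_pos (clamp delta y - clamp delta y')). lra. }
  match goal with |- Rabs (?p + ?r - (?p' + ?r')) <= _ =>
    replace (p + r - (p' + r')) with ((p - p') + (r - r')) by ring end.
  eapply Rle_trans; [apply Rabs_triang|]. nra.
Qed.

Lemma sum_f_R0_pairs (F : nat -> R) (d : nat) :
  sum_f_R0 F (2 * d + 1) = sum_f_R0 (fun k => F (2 * k)%nat + F (2 * k + 1)%nat) d.
Proof.
  induction d as [|d IH]; [reflexivity|].
  replace (2 * S d + 1)%nat with (S (S (2 * d + 1))) by lia.
  rewrite !tech5, IH.
  replace (2 * S d)%nat with (S (2 * d + 1)) by lia.
  replace (S (2 * d + 1) + 1)%nat with (S (S (2 * d + 1))) by lia. ring.
Qed.

(** The coefficients of G when the field has the form x G(x^2, y^2). *)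
Definition halved (q : nat -> nat -> R) (i j : nat) : R := q (2 * i + 1)%nat (2 * j)%nat.

Lemma hom_halved (q : nat -> nat -> R) (d : nat) (x y : R) :
  (forall k, (k <= d)%nat -> q (2 * d - 2 * k)%nat (2 * k + 1)%nat = 0) ->
  hom q (2 * d + 1) x y = x * hom (halved q) d (x ^ 2) (y ^ 2).
Proof.
  intros Hq. unfold hom. rewrite sum_f_R0_pairs, scal_sum.
  apply sum_eq. intros k Hk.
  replace (2 * d + 1 - (2 * k + 1))%nat with (2 * d - 2 * k)%nat by lia.
  rewrite Hq by assumption. unfold halved. rewrite <- !pow_mult.
  replace (2 * d + 1 - 2 * k)%nat with (2 * (d - k) + 1)%nat by lia.
  rewrite (pow_add x (2 * (d - k)) 1). ring.
Qed.

(** As long as [y > 0], the quotient [x / y] increases at a definite rate; once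
    [x > 0], the quotient [y / x] decreases at a definite rate. *)
Lemma turning_not_positive (x y w : R -> R) (kappa t0 : R) :
  0 < kappa -> (forall t, is_derive x t (y t)) -> (forall t, is_derive y t (w t)) ->
  (forall t, Rabs (x t) <= 1 /\ Rabs (y t) <= 1) ->
  (forall t, t0 <= t -> x t * w t - y t ^ 2 <= - kappa) ->
  ~ (forall t, t0 <= t -> 0 < y t).
Proof.
  intros Hk Dx Dy Hb HW Hy.
  assert (Hsq : forall z, Rabs z <= 1 -> z ^ 2 <= 1).
  { intros z Hz. rewrite <- pow2_abs. pose proof (Rabs_pos z). nra. }
  (* The derivative of x / y is (y^2 - x w) / y^2, at least [kappa] because y^2 <= 1. *)
  assert (HR : forall t, t0 <= t ->
     x t0 / y t0 - kappa * t0 <= x t / y t - kappa * t).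
  { intros t Ht.
    apply (derive_nonneg_le (fun t => x t / y t - kappa * t)
             (fun t => (y t * y t - x t * w t) / y t ^ 2 - kappa)); [assumption| |].
    - intros s Hs. specialize (Hy s ltac:(lra)).
      apply (is_derive_minus (V := R_NormedModule));
        [|auto_derive; [auto|ring]].
      evar_last; [apply (is_derive_div x y s (y s) (w s)); auto; lra|].
      simpl. field. lra.
    - intros s Hs. specialize (Hy s ltac:(lra)). specialize (HW s ltac:(lra)).
      pose proof (Hsq (y s) (proj2 (Hb s))).
      assert (0 < y s ^ 2) by (apply pow_lt; lra).
      cut (kappa <= (y s * y s - x s * w s) / y s ^ 2); [lra|].
      apply Rle_div_r; [assumption|]. nra. }
  (* From this time on x / y is at least 1, hence x is positive. *)
  set (t1 := Rmax t0 (t0 + (1 - x t0 / y t0) / kappa)).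
  assert (Hx : forall t, t1 <= t -> 0 < x t).
  { intros t Ht. pose proof (Rmax_l t0 (t0 + (1 - x t0 / y t0) / kappa)).
    pose proof (Rmax_r t0 (t0 + (1 - x t0 / y t0) / kappa)). fold t1 in H, H0.
    specialize (HR t ltac:(lra)). specialize (Hy t ltac:(lra)).
    assert (E : (1 - x t0 / y t0) / kappa <= t - t0) by lra.
    apply Rle_div_l in E; [|assumption].
    assert (Hpos : 0 < x t / y t) by lra.
    replace (x t) with (x t / y t * y t) by (field; lra). nra. }
  assert (HS : forall t, t1 <= t ->
     - (y t1 / x t1 + kappa * t1) <= - (y t / x t + kappa * t)).
  { intros t Ht.
    apply (derive_nonneg_le (fun t => - (y t / x t + kappa * t))
             (fun t => - ((w t * x t - y t * y t) / x t ^ 2 + kappa)));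
      [assumption| |].
    - intros s Hs. specialize (Hx s ltac:(lra)). apply is_derive_opp_R.
      apply (is_derive_plus (V := R_NormedModule));
        [|auto_derive; [auto|ring]].
      evar_last; [apply (is_derive_div y x s (w s) (y s)); auto; lra|].
      simpl. field. lra.
    - intros s Hs. specialize (Hx s ltac:(lra)).
      assert (t0 <= s).
      { pose proof (Rmax_l t0 (t0 + (1 - x t0 / y t0) / kappa)). fold t1 in H. lra. }
      specialize (HW s H). pose proof (Hsq (x s) (proj1 (Hb s))).
      assert (0 < x s ^ 2) by (apply pow_lt; lra).
      cut ((w s * x s - y s * y s) / x s ^ 2 <= - kappa); [lra|].
      apply Rle_div_l; [assumption|]. nra. }
  assert (Ht1 : t0 <= t1) by apply Rmax_l.
  (* By this time y / x, decreasing at rate at least [kappa], should have reached 0, although it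
     stays positive. *)
  set (t2 := t1 + y t1 / x t1 / kappa).
  assert (Hp : 0 < y t1 / x t1).
  { apply Rdiv_lt_0_compat; [apply Hy|apply Hx]; lra. }
  assert (Ht2 : t1 <= t2).
  { unfold t2. pose proof (Rdiv_lt_0_compat _ _ Hp Hk). lra. }
  specialize (HS t2 Ht2).
  assert (0 < y t2 / x t2).
  { apply Rdiv_lt_0_compat; [apply Hy|apply Hx]; lra. }
  assert (kappa * t2 = kappa * t1 + y t1 / x t1) 
    by (specialize (Hx t1 ltac:(lra)); unfold t2; field; lra).
  lra.
Qed.

(** Without a zero, y keeps its sign by the intermediate value theorem; negative y is reduced to
    positive y by changing the sign of x, y and w. *)
Lemma turning_zero (x y w : R -> R) (kappa t0 : R) :
  0 < kappa -> (forall t, is_derive x t (y t)) -> (forall t, is_derive y t (w t)) ->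
  (forall t, Rabs (x t) <= 1 /\ Rabs (y t) <= 1) ->
  (forall t, t0 <= t -> x t * w t - y t ^ 2 <= - kappa) ->
  exists t, t0 <= t /\ y t = 0.
Proof.
  intros Hk Dx Dy Hb HW. apply NNPP. intros Hno.
  assert (Hne : forall t, t0 <= t -> y t <> 0) by (intros t Ht E; apply Hno; eauto).
  assert (Cy : continuity y) by (intros t; now apply (is_derive_continuity_pt y t (w t))).
  assert (Hsign : forall t, t0 <= t -> 0 < y t0 * y t).
  { intros t Ht. apply Rnot_le_lt. intros Hle.
    destruct (IVT_cor y t0 t Cy Ht Hle) as [z [Hz Ez]].
    apply (Hne z); [lra|assumption]. }
  destruct (Rtotal_order (y t0) 0) as [Hneg|[Hz|Hpos]].
  - apply (turning_not_positive (fun t => - x t) (fun t => - y t) (fun t => - w t)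
             kappa t0); auto.
    + intros t. now apply is_derive_opp_R.
    + intros t. now apply is_derive_opp_R.
    + intros t. now rewrite !Rabs_Ropp.
    + intros t Ht. specialize (HW t Ht). simpl in *. lra.
    + intros t Ht. specialize (Hsign t Ht). nra.
  - apply (Hne t0); lra.
  - apply (turning_not_positive x y w kappa t0); auto.
    intros t Ht. specialize (Hsign t Ht). nra.
Qed.

Section Reversible.

Variables (n : nat) (a : nat -> nat -> R).
Hypothesis n_ge_2 : (2 <= n)%nat.
Hypothesis a21 : a 2%nat 1%nat = 0.
Hypothesis a03 : a 0%nat 3%nat = 0.
Hypothesis a_odd : forall k : nat, (k <= n + 1)%nat ->
  a (2 * n + 2 - 2 * k)%nat (2 * k + 1)%nat = 0.

Let g : nat -> nat -> R := halved (field_coeff a).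
Let G (u v : R) : R := hom g 1 u v + hom g (n + 1) u v.
Let A : R := 2 * pde_growth g (n + 1).
Let rho : R := / (64 * A ^ 3).
(** Half of [rho], so that a curve through a point of the closed square of size [delta] stays for a
    while in the square of size [rho], where [F] can be differentiated. *)
Let delta : R := rho / 2.
Let F (u v : R) : R := psum (pde_solution g (n + 1)) u v.
Let H (x y : R) : R := F (x ^ 2) (y ^ 2).

Lemma ydot_reversible (x y : R) : ydot n a x y = x * G (x ^ 2) (y ^ 2).
Proof.
  assert (Hodd : forall i k, field_coeff a i (2 * k + 1) = a i (2 * k + 1)%nat).
  { intros i k. unfold field_coeff.
    replace (2 * k + 1 =? 0) with false by (symmetry; apply Nat.eqb_neq; lia).
    now rewrite Bool.andb_false_r. }
  rewrite ydot_hom by lia. unfold G, g.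
  rewrite Rmult_plus_distr_l. f_equal.
  - apply (hom_halved _ 1). intros [|[|k]] Hk; [| |lia]; rewrite Hodd; assumption.
  - replace (2 * n + 3)%nat with (2 * (n + 1) + 1)%nat by lia.
    apply hom_halved. intros k Hk. rewrite Hodd.
    replace (2 * (n + 1) - 2 * k)%nat with (2 * n + 2 - 2 * k)%nat by lia.
    now apply a_odd.
Qed.

Lemma ydot_even (x y : R) : ydot n a x (- y) = ydot n a x y.
Proof. rewrite !ydot_reversible. now replace ((- y) ^ 2) with (y ^ 2) by ring. Qed.

Lemma constants_ok :
  2 <= A /\ 0 < rho /\ 64 * (A * rho) <= 1 /\ 64 * rho <= 1.
Proof.
  pose proof (pde_growth_ge_1 g (n + 1)).
  assert (HA : 2 <= A) by (unfold A; lra).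
  assert (HA2 : 1 <= A ^ 2) by (apply pow_R1_Rle; lra).
  assert (HA3 : A <= A ^ 3) by (simpl in *; nra).
  assert (Hp : 0 < 64 * A ^ 3) by lra.
  assert (Hr : rho * (64 * A ^ 3) = 1) by (unfold rho; field; lra).
  assert (0 < rho) by (now apply Rinv_0_lt_compat).
  repeat split; nra.
Qed.

Lemma F_bounded : geom_bounded (pde_solution g (n + 1)) 1 A.
Proof. apply pde_solution_geom_bounded. Qed.

Lemma square_in (x : R) : Rabs x <= delta -> 0 <= x ^ 2 <= delta ^ 2 /\ delta ^ 2 < rho.
Proof.
  destruct constants_ok as (HA & Hr & _ & Hr1). intros Hx.
  split; [split; [apply pow2_ge_0|]|].
  - rewrite <- pow2_abs. apply pow_incr. split; [apply Rabs_pos|assumption].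
  - unfold delta. simpl. nra.
Qed.

Lemma H_quasi (x y : R) : Rabs x <= delta -> Rabs y <= delta ->
  Rabs (H x y - (y ^ 2 + x ^ 4)) <= (y ^ 2 + x ^ 4) / 2.
Proof.
  intros Hx Hy. destruct constants_ok as (HA & Hr & _ & Hr1).
  replace (x ^ 4) with ((x ^ 2) ^ 2) by ring.
  pose proof (square_in x Hx). pose proof (square_in y Hy).
  apply (pde_solution_quasi g (n + 1) rho); try lia; try lra; [reflexivity|].
  split; [assumption|apply Rle_refl].
Qed.

Lemma H_sandwich (x y : R) : Rabs x <= delta -> Rabs y <= delta ->
  (y ^ 2 + x ^ 4) / 2 <= H x y <= 3 / 2 * (y ^ 2 + x ^ 4).
Proof. intros Hx Hy. pose proof (H_quasi x y Hx Hy). split_Rabs; lra. Qed.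

Lemma H_even (x y : R) : H x (- y) = H x y.
Proof. unfold H. now replace ((- y) ^ 2) with (y ^ 2) by ring. Qed.

(** With u = x^2 and v = y^2 the left side is u G(u, v) - v. Its main terms are -2 u^2 - v; the
    choice of [rho] makes the remaining terms small multiples of u^2 and v. *)
Lemma angular_momentum (x y : R) : Rabs x <= delta -> Rabs y <= delta ->
  x * ydot n a x y - y ^ 2 <= - (y ^ 2 + x ^ 4) / 2.
Proof.
  intros Hx Hy. destruct constants_ok as (HA & Hr & HAr & Hr1).
  rewrite ydot_reversible.
  destruct (square_in x Hx) as [Hu Hd]. destruct (square_in y Hy) as [Hv _].
  replace (x * (x * G (x ^ 2) (y ^ 2))) with (x ^ 2 * G (x ^ 2) (y ^ 2)) by ring.
  replace (x ^ 4) with ((x ^ 2) ^ 2) by ring.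
  set (u := x ^ 2) in *. set (v := y ^ 2) in *. unfold G.
  set (N := pde_growth g (n + 1)).
  pose proof (hom_norm_nonneg g 1). pose proof (hom_norm_nonneg g (n + 1)).
  assert (EN : A = 2 * N) by reflexivity.
  assert (HN : hom_norm g 1 <= N /\ hom_norm g (n + 1) <= N)
    by (unfold N, pde_growth; lra).
  assert (B1 : hom g 1 u v <= - 2 * u + N * v).
  { unfold hom. simpl. replace (g 1%nat 0%nat) with (-2) by reflexivity.
    assert (Rabs (g 0%nat 1%nat) <= N).
    { unfold hom_norm in HN. simpl in HN. pose proof (Rabs_pos (g 1%nat 0%nat)). lra. }
    assert (g 0%nat 1%nat * v <= N * v).
    { apply Rmult_le_compat_r; [lra|]. split_Rabs; lra. }
    lra. }
  assert (Hd0 : 0 <= delta ^ 2 <= 1) by lra.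
  assert (B2 : hom g (n + 1) u v <= N * (delta ^ 2 * (u + v))).
  { eapply Rle_trans; [apply Rle_abs|].
    apply Rle_trans with (hom_norm g (n + 1) * (delta ^ 2 * (u + v))).
    2:{ apply Rmult_le_compat_r; [apply Rmult_le_pos|]; lra. }
    eapply Rle_trans; [apply Rsum_abs|]. unfold hom_norm.
    rewrite Rmult_comm, scal_sum. apply sum_Rle. intros j Hj.
    rewrite !Rabs_mult, Rmult_assoc. apply Rmult_le_compat_l; [apply Rabs_pos|].
    assert (P : forall z k, 0 <= z <= delta ^ 2 -> 0 <= z ^ k <= 1).
    { intros z k Hz. split; [apply pow_le; lra|].
      rewrite <- (pow1 k). apply pow_incr. lra. }
    assert (P1 : forall z k, 0 <= z <= delta ^ 2 -> 0 <= z ^ S k <= delta ^ 2).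
    { intros z k Hz. pose proof (P z k Hz). simpl. nra. }
    rewrite !Rabs_pos_eq by (apply P; lra).
    assert (Q : forall p q z : R, 0 <= p <= delta ^ 2 -> 0 <= q <= 1 -> 0 <= z ->
                  p * q * z <= delta ^ 2 * z).
    { intros p q z Hp Hq Hz. apply Rmult_le_compat_r; [assumption|]. nra. }
    assert (0 <= delta ^ 2 * u /\ 0 <= delta ^ 2 * v)
      by (split; apply Rmult_le_pos; lra).
    destruct j as [|[|j]].
    - replace (u ^ (n + 1 - 0)) with (u ^ S (n - 1) * 1 * u).
      2:{ replace (n + 1 - 0)%nat with (S (S (n - 1))) by lia. simpl. ring. }
      pose proof (Q _ 1 u (P1 u (n - 1)%nat Hu) ltac:(lra) ltac:(lra)). simpl (v ^ 0).
      lra.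
    - replace (n + 1 - 1)%nat with (S (n - 1)) by lia.
      pose proof (Q _ 1 v (P1 u (n - 1)%nat Hu) ltac:(lra) ltac:(lra)).
      rewrite pow_1. lra.
    - pose proof (Q _ _ v (P1 v j Hv) (P u (n + 1 - S (S j))%nat Hu) ltac:(lra)) as Q'.
      replace (u ^ (n + 1 - S (S j)) * v ^ S (S j))
        with (v ^ S j * u ^ (n + 1 - S (S j)) * v) by (simpl; ring).
      lra. }
  set (k := N * delta ^ 2).
  assert (HN1 : 1 <= N) by apply pde_growth_ge_1.
  assert (HNr : N * rho <= 1 / 128) by (rewrite EN in HAr; lra).
  assert (Hk : 0 <= k <= 1 / 128) by (unfold k; split; nra).
  assert (Hu2 : 0 <= u ^ 2) by apply pow2_ge_0.
  assert (HNu : N * u <= 1 / 128) by nra.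
  assert (T1 : (N * u) * v <= 1 / 128 * v) by (apply Rmult_le_compat_r; lra).
  assert (T2 : k * u ^ 2 <= 1 / 128 * u ^ 2) by (apply Rmult_le_compat_r; lra).
  assert (Hku : k * u <= 1 / 128) by nra.
  assert (T3 : (k * u) * v <= 1 / 128 * v) by (apply Rmult_le_compat_r; lra).
  assert (T4 : u * (hom g 1 u v + hom g (n + 1) u v)
               <= u * (- 2 * u + N * v + N * (delta ^ 2 * (u + v))))
    by (apply Rmult_le_compat_l; lra).
  replace (u * (- 2 * u + N * v + N * (delta ^ 2 * (u + v)))) with
    (- 2 * u ^ 2 + (N * u) * v + k * u ^ 2 + (k * u) * v) in T4 by (unfold k; ring).
  lra.
Qed.

(** Along the flow u' = 2 x y and v' = 2 x y G, so the derivative is 2 x y (F_u + G F_v). The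
    velocity [w] has to agree with the field only at [t], which covers solutions of both the
    original and the clamped system. *)
Lemma H_derive_zero (x y w : R -> R) (t : R) :
  locally t (fun s => is_derive x s (y s) /\ is_derive y s (w s) /\ continuous w s) ->
  Rabs (x t) <= delta -> Rabs (y t) <= delta -> w t = ydot n a (x t) (y t) ->
  is_derive (fun s => H (x s) (y s)) t 0.
Proof.
  intros Hloc Hx Hy Hw. destruct constants_ok as (HA & Hr & HAr & Hr1).
  pose proof (square_in _ Hx) as [Hx2 Hd]. pose proof (square_in _ Hy) as [Hy2 _].
  assert (C : forall (k : R -> R) (s l : R), is_derive k s l -> continuous k s).
  { intros k s l D. apply (ex_derive_continuous (V := R_NormedModule)). now exists l. }
  pose proof (locally_singleton _ _ Hloc) as (Dx & Dy & _).
  assert (Hd2 : delta < rho) by (unfold delta; lra).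
  assert (Lx : locally t (fun s => Rabs (x s) < rho))
    by (apply continuous_Rabs_lt; [exact (C _ _ _ Dx)|lra]).
  assert (Ly : locally t (fun s => Rabs (y s) < rho))
    by (apply continuous_Rabs_lt; [exact (C _ _ _ Dy)|lra]).
  assert (Hsq : forall z, Rabs z < rho -> Rabs (z ^ 2) <= rho).
  { intros z Hz. rewrite <- RPow_abs. pose proof (Rabs_pos z). nra. }
  evar_last.
  { apply (is_derive_psum (pde_solution g (n + 1)) 1 A rho
             (fun s => x s ^ 2) (fun s => y s ^ 2)
             (fun s => 2 * x s * y s) (fun s => 2 * y s * w s));
      [apply F_bounded|lra|].
    generalize (filter_and _ _ Hloc (filter_and _ _ Lx Ly)). apply filter_imp.
    intros s ((Dxs & Dys & Cw) & Hxs & Hys).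
    pose proof (C _ _ _ Dxs) as Cx. pose proof (C _ _ _ Dys) as Cy.
    split; [|split; [|split; [|split; [|split; apply Hsq; assumption]]]].
    - evar_last; [apply is_derive_pow, Dxs|simpl; ring].
    - evar_last; [apply is_derive_pow, Dys|simpl; ring].
    - apply (continuous_mult (K := R_AbsRing)); [|exact Cy].
      apply (continuous_mult (K := R_AbsRing)); [apply continuous_const|exact Cx].
    - apply (continuous_mult (K := R_AbsRing)); [|exact Cw].
      apply (continuous_mult (K := R_AbsRing)); [apply continuous_const|exact Cy]. }
  rewrite Hw, ydot_reversible. unfold G.
  pose proof (pde_solution_psum g (n + 1) rho (x t ^ 2) (y t ^ 2)
     ltac:(fold A; lra) ltac:(rewrite Rabs_pos_eq; lra)
     ltac:(rewrite Rabs_pos_eq; lra)) as E.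
  match goal with |- ?p * _ + ?q * (_ * (_ * ?r)) = 0 =>
    transitivity (2 * x t * y t * (p + r * q)); [ring|] end.
  rewrite E. ring.
Qed.

Lemma reversible_first_integral : has_analytic_first_integral xdot (ydot n a).
Proof.
  destruct constants_ok as (HA & Hr & HAr & Hr1).
  assert (Hd : 0 < delta) by (unfold delta; lra).
  exists H, (mkposreal delta Hd). cbv zeta. split; [|split].
  - intros x y Hxy.
    destruct (proj1 (ball_square _ _ _) Hxy) as [Hx Hy]. simpl in Hx, Hy.
    apply (psum_squares_analytic _ 1 A delta); try lra; [apply F_bounded|].
    unfold delta. simpl. nra.
  - exists 0, (delta / 2). split.
    + apply ball_square. simpl. rewrite Rabs_R0, Rabs_pos_eq; lra.
    + assert (H00 : H 0 0 <= 0).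
      { destruct (H_sandwich 0 0) as [_ B]; try (rewrite Rabs_R0; lra).
        simpl in B. lra. }
      destruct (H_sandwich 0 (delta / 2)) as [B _];
        [rewrite Rabs_R0; lra|rewrite Rabs_pos_eq; lra|].
      assert (0 < (delta / 2) ^ 2) by (apply pow_lt; lra).
      simpl (0 ^ 4) in B. lra.
  - intros s t x y Hsol Hin.
    assert (D : forall r : R, Rbar_lt s r -> Rbar_lt r t ->
                  is_derive (fun r => H (x r) (y r)) r 0).
    { intros r Hs Ht. specialize (Hin r Hs Ht).
      destruct (proj1 (ball_square _ _ _) Hin) as [Hx Hy]. simpl in Hx, Hy.
      apply (H_derive_zero x y (fun r => ydot n a (x r) (y r))); try lra.
      apply (locally_interval _ _ s t Hs Ht). intros v Hv1 Hv2.
      destruct (Hsol v Hv1 Hv2) as [Dx Dy].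
      split; [exact Dx|]. split; [exact Dy|].
      apply continuous_ydot; [lia| |]; eexists; [exact Dx|exact Dy]. }
    assert (Hle : forall u v : R, u <= v -> Rbar_lt s u -> Rbar_lt v t ->
                    H (x u) (y u) = H (x v) (y v)).
    { intros u v Huv Hu Hv. apply (derive_zero_const (fun r => H (x r) (y r)));
        [assumption|].
      intros r Hr'. apply D.
      - apply Rbar_lt_le_trans with u; [assumption|]. apply Hr'.
      - apply Rbar_le_lt_trans with v; [|assumption]. apply Hr'. }
    intros u v Hu1 Hu2 Hv1 Hv2. destruct (Rle_lt_dec u v).
    + now apply Hle.
    + symmetry. apply Hle; auto. lra.
Qed.

(** * Trapping and periodicity for the clamped field *)

Let f (x y : R) : R := ydot n a (clamp delta x) (clamp delta y).

Lemma delta_pos : 0 < delta <= 1.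
Proof. destruct constants_ok as (HA & Hr & _ & Hr1). unfold delta. lra. Qed.

Lemma clamped_even (x y : R) : f x (- y) = f x y.
Proof.
  pose proof delta_pos. unfold f. rewrite clamp_opp by lra. apply ydot_even.
Qed.

Lemma clamped_lipschitz : exists L, 1 <= L /\ lipschitz2 f L.
Proof. pose proof delta_pos. apply ydot_clamp_lipschitz; [lia|lra]. Qed.

Lemma clamped_id (x y : R) :
  Rabs x <= delta -> Rabs y <= delta -> f x y = ydot n a x y.
Proof. intros Hx Hy. unfold f. now rewrite !clamp_id. Qed.

Lemma clamped_solution_continuous (x y : R -> R) (t : R) :
  second_order_solution f x y -> continuous x t /\ continuous y t.
Proof.
  intros Hs. destruct (Hs t) as [Dx Dy].
  split; apply (ex_derive_continuous (V := R_NormedModule)).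
  - now exists (y t).
  - now exists (f (x t) (y t)).
Qed.

Lemma clamped_derive_zero (x y : R -> R) (t : R) :
  second_order_solution f x y -> Rabs (x t) <= delta -> Rabs (y t) <= delta ->
  is_derive (fun s => H (x s) (y s)) t 0.
Proof.
  intros Hs Hx Hy. destruct clamped_lipschitz as (L & HL & Hf).
  apply (H_derive_zero x y (fun s => f (x s) (y s))); auto; [|now apply clamped_id].
  apply filter_forall. intros s. destruct (Hs s) as [Dx Dy].
  split; [exact Dx|]. split; [exact Dy|].
  destruct (clamped_solution_continuous x y s Hs).
  apply (continuous_lipschitz2 f L); auto. lra.
Qed.

(** On the boundary of the square y^2 + x^4 is at least delta^4, as [delta <= 1], so [H] is at least
    delta^4 / 2 there; orbits starting below this level cannot reach the boundary. *)
Definition trapped (p : R * R) : Prop :=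
  Rabs (fst p) < delta /\ Rabs (snd p) < delta /\ H (fst p) (snd p) < delta ^ 4 / 2.

(** Real induction on the time: as long as the solution is in the closed square, [H] is conserved,
    and its level keeps the solution off the boundary. *)
Lemma trap_forward (x y : R -> R) (t : R) :
  second_order_solution f x y -> trapped (x 0, y 0) -> 0 <= t ->
  Rabs (x t) < delta /\ Rabs (y t) < delta /\ H (x t) (y t) = H (x 0) (y 0).
Proof.
  intros Hs (Hx0 & Hy0 & H0) Ht. simpl in *. pose proof delta_pos as Hd.
  assert (Hconst : forall t, 0 <= t ->
     (forall s, 0 <= s <= t -> Rabs (x s) <= delta /\ Rabs (y s) <= delta) ->
     H (x t) (y t) = H (x 0) (y 0)).
  { intros r Hr Hin. symmetry.
    apply (derive_zero_const (fun s => H (x s) (y s))); [assumption|].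
    intros s Hsr. destruct (Hin s Hsr). now apply clamped_derive_zero. }
  assert (P : forall t, 0 <= t -> Rabs (x t) < delta /\ Rabs (y t) < delta).
  { apply continuous_induction.
    - auto.
    - intros s _ [Hxs Hys]. destruct (clamped_solution_continuous x y s Hs).
      apply filter_and; now apply continuous_Rabs_lt.
    - intros r Hr Hbelow. destruct (clamped_solution_continuous x y r Hs) as [Cx Cy].
      assert (Hxr : Rabs (x r) <= delta).
      { apply (continuous_le_left (fun s => Rabs (x s))); auto.
        - apply (continuous_comp x Rabs r Cx (continuous_Rabs _)).
        - intros s Hsr. destruct (Hbelow s Hsr). lra. }
      assert (Hyr : Rabs (y r) <= delta).
      { apply (continuous_le_left (fun s => Rabs (y s))); auto.
        - apply (continuous_comp y Rabs r Cy (continuous_Rabs _)).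
        - intros s Hsr. destruct (Hbelow s Hsr). lra. }
      assert (E : H (x r) (y r) = H (x 0) (y 0)).
      { apply Hconst; [lra|]. intros s Hsr.
        destruct (Req_dec s r) as [->|]; [auto|].
        destruct (Hbelow s ltac:(lra)). lra. }
      destruct (H_sandwich _ _ Hxr Hyr) as [B _]. rewrite E in B.
      pose proof (pow2_ge_0 (y r)). pose proof (pow2_ge_0 (x r ^ 2)).
      assert (Hx4 : Rabs (x r) ^ 4 < delta ^ 4).
      { rewrite RPow_abs. rewrite Rabs_pos_eq;
          replace (x r ^ 4) with ((x r ^ 2) ^ 2) by ring; [|lra].
        replace (x r ^ 4) with ((x r ^ 2) ^ 2) in B by ring. lra. }
      assert (Hy2 : Rabs (y r) ^ 2 < delta ^ 2).
      { rewrite pow2_abs. replace (x r ^ 4) with ((x r ^ 2) ^ 2) in B by ring.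
        assert (Hd2 : 0 <= delta ^ 2 <= 1).
        { split; [apply pow2_ge_0|]. apply Rle_trans with (1 ^ 2); [|lra].
          apply pow_incr. lra. }
        replace (delta ^ 4) with (delta ^ 2 * delta ^ 2) in * by ring. nra. }
      split; apply Rnot_le_lt; intros Hge.
      + apply (Rlt_not_le _ _ Hx4). apply pow_incr. lra.
      + apply (Rlt_not_le _ _ Hy2). apply pow_incr. lra. }
  destruct (P t Ht). split; [assumption|]. split; [assumption|].
  apply Hconst; [assumption|]. intros s Hst. destruct (P s ltac:(lra)). lra.
Qed.

(** The field is even in y, so reversing time and the sign of y maps solutions to solutions; [c]
    places the instant of reflection. *)
Lemma clamped_reflect (x y : R -> R) (c : R) :
  second_order_solution f x y ->
  second_order_solution f (fun t => x (c - t)) (fun t => - y (c - t)).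
Proof.
  intros Hs t. destruct (Hs (c - t)) as [Dx Dy].
  assert (Dc : is_derive (fun s : R => c - s) t (-1)) by (auto_derive; [auto|ring]).
  split.
  - evar_last; [apply (is_derive_comp x (fun s => c - s) t _ _ Dx Dc)|].
    unfold scal. simpl. unfold mult. simpl. ring.
  - evar_last.
    + apply is_derive_opp_R.
      apply (is_derive_comp y (fun s => c - s) t _ _ Dy Dc).
    + rewrite clamped_even. unfold scal. simpl. unfold mult. simpl. ring.
Qed.

Lemma clamped_translate (x y : R -> R) (c : R) :
  second_order_solution f x y ->
  second_order_solution f (fun t => x (c + t)) (fun t => y (c + t)).
Proof.
  intros Hs t. destruct (Hs (c + t)) as [Dx Dy].
  assert (Dc : is_derive (fun s : R => c + s) t 1) by (auto_derive; [auto|ring]).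
  split.
  - evar_last; [apply (is_derive_comp x (fun s => c + s) t _ _ Dx Dc)|].
    unfold scal. simpl. unfold mult. simpl. ring.
  - evar_last; [apply (is_derive_comp y (fun s => c + s) t _ _ Dy Dc)|].
    unfold scal. simpl. unfold mult. simpl. ring.
Qed.

Lemma trap_all (x y : R -> R) (t : R) :
  second_order_solution f x y -> trapped (x 0, y 0) ->
  Rabs (x t) < delta /\ Rabs (y t) < delta /\ H (x t) (y t) = H (x 0) (y 0).
Proof.
  intros Hs H0. destruct (Rle_lt_dec 0 t) as [Ht|Ht]; [now apply trap_forward|].
  pose proof (clamped_reflect x y 0 Hs) as Hr.
  destruct (trap_forward _ _ (- t) Hr) as (B1 & B2 & B3).
  - rewrite Rminus_0_r. unfold trapped in *. simpl in *.
    now rewrite Rabs_Ropp, H_even.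
  - lra.
  - replace (0 - - t) with t in * by ring. rewrite Rminus_0_r, !H_even in B3.
    rewrite Rabs_Ropp in B2. auto.
Qed.

(** The reflected and the original solution have the same data at time [t1]. *)
Lemma symmetric_at_crossing (x y : R -> R) (t1 t : R) :
  second_order_solution f x y -> y t1 = 0 ->
  x (2 * t1 - t) = x t /\ y (2 * t1 - t) = - y t.
Proof.
  intros Hs Hy. destruct clamped_lipschitz as (L & HL & Hf).
  destruct (second_order_unique f L _ _ _ _ (t - t1) ltac:(lra) Hf
              (clamped_reflect x y t1 Hs) (clamped_translate x y t1 Hs)) as [E1 E2].
  - f_equal. ring.
  - rewrite Rminus_0_r, Rplus_0_r, Hy. ring.
  - replace (t1 - (t - t1)) with (2 * t1 - t) in * by ring.
    replace (t1 + (t - t1)) with t in * by ring. split; [assumption|lra].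
Qed.

Lemma trapped_periodic (x y : R -> R) :
  second_order_solution f x y -> trapped (x 0, y 0) -> (x 0, y 0) <> (0, 0) ->
  exists T, periodic_solution xdot (ydot n a) T x y /\ forall t, trapped (x t, y t).
Proof.
  intros Hs H0 Hne. pose proof delta_pos as Hd.
  assert (Htrap : forall t, Rabs (x t) < delta /\ Rabs (y t) < delta
                            /\ H (x t) (y t) = H (x 0) (y 0))
    by (intros; now apply trap_all).
  assert (Hpos : 0 < H (x 0) (y 0)).
  { destruct (Htrap 0) as (Hx & Hy & _).
    destruct (H_sandwich (x 0) (y 0)) as [B _]; try lra.
    eapply Rlt_le_trans; [|exact B].
    pose proof (pow2_ge_0 (y 0)).
    assert (0 <= x 0 ^ 4)
      by (replace (x 0 ^ 4) with ((x 0 ^ 2) ^ 2) by ring; apply pow2_ge_0).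
    destruct (Req_dec (y 0) 0) as [Hy0|Hy0].
    - assert (Hx0 : x 0 <> 0) by (intros Hx0; apply Hne; congruence).
      assert (0 < x 0 ^ 4).
      { replace (x 0 ^ 4) with ((x 0 ^ 2) ^ 2) by ring. apply pow2_gt_0.
        now apply pow_nonzero. }
      lra.
    - assert (0 < y 0 ^ 2) by now apply pow2_gt_0. lra. }
  (* [angular_momentum] gives -(y^2 + x^4) / 2, and [H] is at most 3/2 of y^2 + x^4; the ratio is
     1/3. *)
  set (kappa := H (x 0) (y 0) / 3).
  assert (HW : forall t, x t * f (x t) (y t) - y t ^ 2 <= - kappa).
  { intros t. destruct (Htrap t) as (Hx & Hy & Ht).
    rewrite clamped_id by lra.
    pose proof (angular_momentum (x t) (y t) ltac:(lra) ltac:(lra)).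
    destruct (H_sandwich (x t) (y t)) as [_ B]; try lra.
    unfold kappa. rewrite Ht in B. lra. }
  assert (Hzero : forall t0, exists t, t0 <= t /\ y t = 0).
  { intros t0. apply (turning_zero x y (fun t => f (x t) (y t)) kappa).
    - unfold kappa. lra.
    - intros t. apply Hs.
    - intros t. apply Hs.
    - intros t. destruct (Htrap t) as (Hx & Hy & _). lra.
    - intros t _. apply HW. }
  destruct (Hzero 0) as (t1 & _ & Hy1).
  (* Searching from [t1 + 1] forces [t1 < t2], so that the period is positive. *)
  destruct (Hzero (t1 + 1)) as (t2 & Ht2 & Hy2).
  exists (2 * (t2 - t1)). split; [split; [lra|split; [|split]]|].
  - intros t _ _. destruct (Hs t) as [Dx Dy]. split; [exact Dx|].
    destruct (Htrap t) as (Hx & Hy & _). rewrite clamped_id in Dy by lra. exact Dy.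
  - intros t.
    destruct (symmetric_at_crossing x y t1 t Hs Hy1) as [A1 A2].
    destruct (symmetric_at_crossing x y t2 (2 * t1 - t) Hs Hy2) as [B1 B2].
    (* The reflections about the two crossing times compose to a translation by twice their
       distance. *)
    replace (t + 2 * (t2 - t1)) with (2 * t2 - (2 * t1 - t)) by ring.
    rewrite B1, B2, A1, A2. split; [reflexivity|ring].
  (* A constant solution would be an equilibrium, where x w - y^2 = 0, against the bound
     [- kappa]. *)
  - apply NNPP. intros Hno.
    assert (Hc : forall t, x t = x 0 /\ y t = y 0).
    { intros t. apply pair_equal_spec.
      apply NNPP. intros Hn. apply Hno. now exists t. }
    assert (Ey : y 0 = 0).
    { rewrite <- (is_derive_unique _ _ _ (proj1 (Hs 0))).
      rewrite (Derive_ext x (fun _ => x 0)); [apply Derive_const|]. apply Hc. }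
    assert (Ef : f (x 0) (y 0) = 0).
    { rewrite <- (is_derive_unique _ _ _ (proj2 (Hs 0))).
      rewrite (Derive_ext y (fun _ => y 0)); [apply Derive_const|]. apply Hc. }
    assert (Hk : 0 < kappa) by (unfold kappa; lra).
    specialize (HW 0). rewrite Ef, Ey in HW. lra.
  - intros t. destruct (Htrap t) as (Hx & Hy & Ht). destruct H0 as (_ & _ & H0).
    unfold trapped. simpl in *. rewrite Ht. auto.
Qed.

(** Two strict conditions concern the coordinates; for the level of [H], [psum_lipschitz] in (x^2,
    y^2) and |z'^2 - z^2| <= 2 eps bound the change of [H] by 4 C eps, which is below the margin
    [h]. *)
Lemma trapped_open : open trapped.
Proof.
  intros [x y] (Hx & Hy & Hh). simpl in Hx, Hy, Hh.
  pose proof delta_pos as Hd. destruct constants_ok as (HA & Hr & HAr & Hr1).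
  set (C := 1 * A / (1 - 4 * A * rho)).
  assert (HC : 0 <= C).
  { unfold C. apply Rmult_le_pos; [lra|]. left. apply Rinv_0_lt_compat. lra. }
  set (h := delta ^ 4 / 2 - H x y).
  assert (Hh0 : 0 < h) by (unfold h; lra).
  set (eps := Rmin (Rmin (delta - Rabs x) (delta - Rabs y)) (h / (4 * (C + 1)))).
  assert (He : 0 < eps).
  { apply Rmin_pos; [apply Rmin_pos; lra|apply Rdiv_lt_0_compat; lra]. }
  assert (Hle : eps <= delta - Rabs x /\ eps <= delta - Rabs y
                /\ eps <= h / (4 * (C + 1))).
  { unfold eps.
    pose proof (Rmin_l (Rmin (delta - Rabs x) (delta - Rabs y)) (h / (4 * (C + 1)))).
    pose proof (Rmin_r (Rmin (delta - Rabs x) (delta - Rabs y)) (h / (4 * (C + 1)))).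
    pose proof (Rmin_l (delta - Rabs x) (delta - Rabs y)).
    pose proof (Rmin_r (delta - Rabs x) (delta - Rabs y)). lra. }
  destruct Hle as (He1 & He2 & He3).
  exists (mkposreal eps He). intros [x' y'] [Bx By]. simpl in Bx, By.
  change (Rabs (x' - x) < eps) in Bx. change (Rabs (y' - y) < eps) in By.
  assert (Hx' : Rabs x' < delta) by (split_Rabs; lra).
  assert (Hy' : Rabs y' < delta) by (split_Rabs; lra).
  split; [exact Hx'|]. split; [exact Hy'|]. simpl.
  assert (Hsq : forall z, Rabs z < delta -> Rabs (z ^ 2) < rho).
  { intros z Hz. destruct (square_in z ltac:(lra)) as [B1 B2].
    rewrite Rabs_pos_eq; lra. }
  pose proof (psum_lipschitz (pde_solution g (n + 1)) 1 A rho (x ^ 2) (y ^ 2)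
    (x' ^ 2) (y' ^ 2) F_bounded ltac:(lra) (Hsq _ Hx) (Hsq _ Hy) (Hsq _ Hx')
    (Hsq _ Hy')) as Lip.
  fold C in Lip. fold (F (x' ^ 2) (y' ^ 2)) (F (x ^ 2) (y ^ 2)) in Lip.
  fold (H x' y') (H x y) in Lip.
  assert (Hdiff : forall z z', Rabs z < delta -> Rabs z' < delta ->
                    Rabs (z' - z) < eps -> Rabs (z' ^ 2 - z ^ 2) <= 2 * eps).
  { intros z z' Hz Hz' Hzz.
    replace (z' ^ 2 - z ^ 2) with ((z' + z) * (z' - z)) by ring.
    rewrite Rabs_mult.
    assert (Rabs (z' + z) <= 2) by (eapply Rle_trans; [apply Rabs_triang|lra]).
    apply Rmult_le_compat; try apply Rabs_pos; lra. }
  pose proof (Hdiff _ _ Hx Hx' Bx). pose proof (Hdiff _ _ Hy Hy' By).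
  assert (C * (Rabs (x' ^ 2 - x ^ 2) + Rabs (y' ^ 2 - y ^ 2)) <= C * (4 * eps))
    by (apply Rmult_le_compat_l; lra).
  apply Rle_div_r in He3; [|lra].
  assert (HH : Rabs (H x' y' - H x y) < h) by nra.
  unfold h in HH. pose proof (Rle_abs (H x' y' - H x y)). lra.
Qed.

Lemma reversible_center : origin_is_center xdot (ydot n a).
Proof.
  split; [reflexivity|]. split; [rewrite ydot_reversible; ring|].
  pose proof delta_pos as Hd.
  exists trapped. split; [exact trapped_open|]. split.
  - assert (R0 : Rabs 0 < delta) by (rewrite Rabs_R0; lra).
    split; [exact R0|]. split; [exact R0|]. simpl fst. simpl snd.
    destruct (H_sandwich 0 0) as [_ B]; try lra.
    assert (0 < delta ^ 4) by (apply pow_lt; lra). simpl (0 ^ _) in B. lra.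
  - intros [x0 y0] Hp Hne. destruct clamped_lipschitz as (L & HL & Hf).
    destruct (picard_lindelof f L x0 y0 HL Hf) as (x & y & Hs & <- & <-).
    destruct (trapped_periodic x y Hs Hp Hne) as (T & Hper & Htrap).
    now exists x, y, T.
Qed.

End Reversible.

Theorem theorem4p5 (n : nat) (hn : (2 <= n)%nat) (a : nat -> nat -> R) :
  origin_is_analytic_center xdot (ydot n a) <->
  (a 2%nat 1%nat = 0 /\ a 0%nat 3%nat = 0 /\
   forall k : nat, (k <= n + 1)%nat -> a (2 * n + 2 - 2 * k)%nat (2 * k + 1)%nat = 0).
Proof.
  split.
  - now apply analytic_center_necessary.
  - intros (H21 & H03 & Hodd). split.
    + now apply reversible_center.
    + now apply reversible_first_integral.
Qed.
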